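(* Let $\Lambda=\Lambda(\mathbf{m},\boldsymbol{\lambda})$ be a canonical algebra over $k$ and let $\mathbf{d}$ be the dimension vector of a regular $\Lambda$-module with $p^{\mathbf{d}}>0$. If $\mathrm{mod}_\Lambda(\mathbf{d})$ is irreducible, the ring of semi-invariants $\mathrm{SI}(\Lambda,\mathbf{d})$ is a polynomial ring in $s$ variables, and the codimension of $\mathcal{Z}(\mathbf{d})$ in $\mathrm{mod}_\Lambda(\mathbf{d})$ equals $s$, then $k[\mathrm{mod}_\Lambda(\mathbf{d})]$ is free as an $\mathrm{SI}(\Lambda,\mathbf{d})$-module.
   Context: $k$ is an algebraically closed field of characteristic $0$; $\mathbb{N}$ is the set of non-negative integers; $[i,j]=\{l\in\mathbb{Z}\mid i\le l\le j\}$. Canonical algebras. Let $\mathbf{m}=(m_1,\dots,m_n)$, $n\ge 3$, be integers greater than $1$ and $\boldsymbol{\lambda}=(\lambda_3,\dots,\lambda_n)$ pairwise distinct non-zero elements of $k$ with $\lambda_3=1$. The quiver $\Delta$ has vertices $0$, $\infty$ and $(i,j)$ for $i\in[1,n]$, $j\in[1,m_i-1]$, and arrows $\alpha_{i,j}$ from $(i,j)$ to $(i,j-1)$ for $i\in[1,n]$, $j\in[1,m_i]$, where $(i,0)$ means $0$ and $(i,m_i)$ means $\infty$. The canonical algebra $\Lambda=\Lambda(\mathbf{m},\boldsymbol{\lambda})$ is the path algebra of $\Delta$ modulo the ideal generated by the relations $\alpha_{1,1}\cdots\alpha_{1,m_1}+\lambda_i\alpha_{2,1}\cdots\alpha_{2,m_2}-\alpha_{i,1}\cdots\alpha_{i,m_i}$,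 $i\in[3,n]$ (each $\alpha_{i,1}\cdots\alpha_{i,m_i}$ is the path from $\infty$ to $0$ along the $i$-th arm). $\Lambda$-modules (finite dimensional) are identified with representations of $\Delta$ satisfying these relations; $\mathbf{dim}\, M\in\mathbb{Z}^{\Delta_0}$ is the dimension vector. Regular modules. Let $\mathbf{e}_x$ be the standard basis vectors of $\mathbb{Z}^{\Delta_0}$, $\mathbf{e}_{i,j}=\mathbf{e}_{(i,j)}$ for $j\in[1,m_i-1]$, $\mathbf{h}=\sum_{x\in\Delta_0}\mathbf{e}_x$, $\mathbf{e}_{i,0}=\mathbf{h}-\sum_{j\in[1,m_i-1]}\mathbf{e}_{i,j}$. A module is regular if it is a direct sum of indecomposable modules $X$ with $(\mathbf{dim}\,X)_0=(\mathbf{dim}\,X)_\infty$. The dimension vector $\mathbf{d}$ of a regular module has a unique presentation (canonical decomposition) $\mathbf{d}=p^{\mathbf{d}}\mathbf{h}+\sum_{i\in[1,n]}\sum_{j\in[0,m_i-1]}p^{\mathbf{d}}_{i,j}\mathbf{e}_{i,j}$ with $p^{\mathbf{d}}\ge0$, all $p^{\mathbf{d}}_{i,j}\ge0$ integers, and such that for each $i\in[1,n]$ there is $j\in[0,m_i-1]$ with $p^{\mathbf{d}}_{i,j}=0$. This defines $p^{\mathbf{d}}$. Module varieties and semi-invariants. For $\mathbf{d}\in\mathbb{N}^{\Delta_0}$, let $\mathbb{A}(\mathbf{d})=\prod_{\alpha\in\Delta_1}\mathbb{M}(d_{t\alpha},d_{s\alpha})$, where an arrow $\alpha$ goes from $s\alpha$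 to $t\alpha$ and $\mathbb{M}(a,b)$ is the space of $a\times b$ matrices over $k$; $\mathrm{mod}_\Lambda(\mathbf{d})\subseteq\mathbb{A}(\mathbf{d})$ is the closed subset (variety) of tuples satisfying the relations, and $k[\mathrm{mod}_\Lambda(\mathbf{d})]$ is its coordinate ring. $\mathrm{GL}(\mathbf{d})=\prod_x\mathrm{GL}(d_x)$ acts by $(g\cdot M)_\alpha=g_{t\alpha}M_\alpha g_{s\alpha}^{-1}$ and on $k[\mathrm{mod}_\Lambda(\mathbf{d})]$ by $(g\cdot f)(M)=f(g^{-1}\cdot M)$. For $\sigma\in\mathbb{Z}^{\Delta_0}$, $\mathrm{SI}(\Lambda,\mathbf{d})_\sigma$ is the space of $f\in k[\mathrm{mod}_\Lambda(\mathbf{d})]$ with $g\cdot f=\bigl(\prod_{x}\det(g_x)^{\sigma_x}\bigr)f$ for all $g\in\mathrm{GL}(\mathbf{d})$ (semi-invariants of weight $\sigma$). The ring of semi-invariants is $\mathrm{SI}(\Lambda,\mathbf{d})=\bigoplus_\sigma\mathrm{SI}(\Lambda,\mathbf{d})_\sigma$, the sum over $\sigma\in\mathbb{Z}^{\Delta_0}$ with $\sigma_x=0$ whenever $d_x=0$. $\mathcal{Z}(\mathbf{d})\subseteq\mathrm{mod}_\Lambda(\mathbf{d})$ is the set of common zeros of all semi-invariants of non-zero weight. *)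

(* Defs.v *)
From HB Require Import structures.
From mathcomp Require Import all_boot all_order all_algebra.
From mathcomp Require Import boolp classical_sets functions.
From mathcomp Require Import mpoly.

Set Implicit Arguments.
Unset Strict Implicit.
Unset Printing Implicit Defensive.
Import GRing.Theory.
Local Open Scope ring_scope.
Local Open Scope classical_set_scope.

(* Arms are numbered from 0, so the textbook arm i is [i.-1 : 'I_arms]; the    *)
(* values of [lam] on the first two arms are irrelevant and never used.        *)
Record canonicalData (k : fieldType) := CanonicalData {
  arms : nat;
  len : 'I_arms -> nat;
  lam : 'I_arms -> k;
  arms_ge3 : (3 <= arms)%N;
  len_gt1 : forall i, (1 < len i)%N;
  lam_neq0 : forall i : 'I_arms, (2 <= i)%N -> lam i != 0;
  lam_inj : forall i j : 'I_arms,
    (2 <= i)%N -> (2 <= j)%N -> lam i = lam j -> i = j;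
  lam_third : forall i : 'I_arms, i = 2%N :> nat -> lam i = 1
}.

Section CanonicalAlgebra.
Variables (k : fieldType) (L : canonicalData k).

Definition arm1 : 'I_(arms L) := Ordinal (ltn_trans (isT : 0 < 2)%N (arms_ge3 L)).
Definition arm2 : 'I_(arms L) := Ordinal (ltn_trans (isT : 1 < 2)%N (arms_ge3 L)).

(* [inl false] is 0, [inl true] is oo, and [inr (i; j)] is (i, j + 1).         *)
Definition vertex : finType :=
  (bool + {i : 'I_(arms L) & 'I_(len i).-1})%type.
Definition vertex0 : vertex := inl false.
Definition vertex_oo : vertex := inl true.
Definition inner_vertex (i : 'I_(arms L)) (j : 'I_(len i).-1) : vertex :=
  inr (Tagged (fun i : 'I_(arms L) => 'I_(len i).-1) j).

(* (i, j) for all j in [0, m_i], with (i, 0) = 0 and (i, m_i) = oo.            *)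
Definition arm_vertex (i : 'I_(arms L)) (j : nat) : vertex :=
  if j is j'.+1 then
    oapp (@inner_vertex i) vertex_oo (insub j')
  else vertex0.

Lemma arm_vertex_len i : arm_vertex i (len i) = vertex_oo.
Proof.
have -> : arm_vertex i (len i) = arm_vertex i (len i).-1.+1.
  by congr arm_vertex; rewrite prednK // ltnW // len_gt1.
by rewrite /= insubF // ltnn.
Qed.

(* [(i; j)] is the arrow alpha_{i, j + 1}, from (i, j + 1) to (i, j).          *)
Definition arrow : finType := {i : 'I_(arms L) & 'I_(len i)}.
Definition src (a : arrow) : vertex := arm_vertex (tag a) (tagged a).+1.
Definition tgt (a : arrow) : vertex := arm_vertex (tag a) (tagged a).

Definition dimvec := vertex -> nat.

(* The affine space A(d).                                                      *)
Definition rep (d : dimvec) : Type :=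
  forall a : arrow, 'M[k]_(d (tgt a), d (src a)).

Section ModuleVariety.
Variable d : dimvec.

(* M_{alpha_{i, j + 1}}, extended by 0 to j >= m_i.                            *)
Definition arm_map (M : rep d) (i : 'I_(arms L)) (j : nat) :
    'M[k]_(d (arm_vertex i j), d (arm_vertex i j.+1)) :=
  if @idP (j < len i)%N is ReflectT lt_j then
    M (Tagged (fun i : 'I_(arms L) => 'I_(len i)) (Ordinal lt_j))
  else 0.

(* M_{alpha_{i, 1}} ... M_{alpha_{i, j}}.                                      *)
Fixpoint arm_path (M : rep d) (i : 'I_(arms L)) (j : nat) :
    'M[k]_(d vertex0, d (arm_vertex i j)) :=
  if j is j'.+1 then arm_path M i j' *m arm_map M i j' else 1%:M.

Definition full_path (M : rep d) (i : 'I_(arms L)) :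
    'M[k]_(d vertex0, d vertex_oo) :=
  castmx (erefl, congr1 d (arm_vertex_len i)) (arm_path M i (len i)).

Definition module_variety : set (rep d) :=
  [set M | forall i : 'I_(arms L), (2 <= i)%N ->
     full_path M arm1 + lam i *: full_path M arm2 - full_path M i = 0].

Definition GL := {g : forall x, 'M[k]_(d x) | forall x, g x \in unitmx}.

Program Definition invGL (g : GL) : GL := fun x => invmx (sval g x).
Next Obligation. by rewrite unitmx_inv (svalP g). Qed.

Definition act_rep (g : GL) (M : rep d) : rep d :=
  fun a => sval g (tgt a) *m M a *m invmx (sval g (src a)).

Lemma arm_path_act g M i j :
  arm_path (act_rep g M) i j =
  sval g vertex0 *m arm_path M i j *m invmx (sval g (arm_vertex i j)).
Proof.
elim: j => [|j IHj] /=; first by rewrite mulmx1 mulmxV // (svalP g).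
rewrite IHj /arm_map; case: {-}_ / idP => [lt_j|_]; last first.
  by rewrite !mulmx0 mul0mx.
rewrite /act_rep /tgt /src /= !mulmxA; congr (_ *m _ *m _).
by rewrite mulmxKV // (svalP g).
Qed.

Lemma full_path_act g M i :
  full_path (act_rep g M) i =
  sval g vertex0 *m full_path M i *m invmx (sval g vertex_oo).
Proof.
rewrite /full_path arm_path_act.
by case: _ / (arm_vertex_len i); rewrite !castmx_id.
Qed.

Lemma act_module g M : module_variety M -> module_variety (act_rep g M).
Proof.
move=> relM i i_ge2; rewrite !full_path_act.
rewrite scalemxAl scalemxAr -mulmxDl -mulmxDr -mulmxBl -mulmxBr.
by rewrite relM // mulmx0 mul0mx.
Qed.

Definition act (g : GL) (M : module_variety) : module_variety :=
  SigSub (mem_set (act_module g (set_mem (valP M)))).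

(* The coordinate functions M |-> (M_a)_{r,c} of A(d), numbered by             *)
(* ['I_#|coord|].                                                              *)
Definition coord : finType :=
  {a : arrow & ('I_(d (tgt a)) * 'I_(d (src a)))%type}.
Definition coords (M : rep d) (i : 'I_#|coord|) : k :=
  let c := enum_val i in M (tag c) (tagged c).1 (tagged c).2.

Definition zariski_closed (Y : set (rep d)) : Prop :=
  exists P : set {mpoly k[#|coord|]},
    Y = [set M | forall p, P p -> p.@[coords M] = 0].

Definition irreducible (Y : set (rep d)) : Prop :=
  Y !=set0 /\
  forall Y1 Y2, zariski_closed Y1 -> zariski_closed Y2 ->
    Y `<=` Y1 `|` Y2 -> Y `<=` Y1 \/ Y `<=` Y2.

Definition irr_closed (Y : set (rep d)) : Prop :=
  zariski_closed Y /\ irreducible Y.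

(* There is a chain Y = C_0 < C_1 < ... < C_r of irreducible closed subsets    *)
(* of X.                                                                       *)
Definition irr_chain (X Y : set (rep d)) (r : nat) : Prop :=
  exists C : nat -> set (rep d),
    [/\ C 0%N = Y,
        forall i, (i <= r)%N -> irr_closed (C i) /\ C i `<=` X
      & forall i, (i < r)%N -> C i `<` C i.+1].

(* The codimension of Z in X is the infimum, over the irreducible closed       *)
(* Y <= Z, of the supremum of the lengths of the chains from Y in X; it is oo  *)
(* for empty Z.                                                                *)
Definition codim_ge (X Z : set (rep d)) (r : nat) : Prop :=
  forall Y, irr_closed Y -> Y `<=` Z -> irr_chain X Y r.

Definition codim_eq (X Z : set (rep d)) (r : nat) : Prop :=
  codim_ge X Z r /\ ~ codim_ge X Z r.+1.

Definition polynomial_function : {pred (module_variety -> k)} :=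
  fun f => `[< exists p : {mpoly k[#|coord|]},
                 forall M : module_variety, f M = p.@[coords (val M)] >].

Lemma polynomial_function_subring : subring_closed polynomial_function.
Proof.
split.
- by apply/asboolP; exists 1 => M; rewrite meval1.
- move=> f g /asboolP[p fE] /asboolP[q gE]; apply/asboolP.
  by exists (p - q) => M; rewrite mevalB -fE -gE.
- move=> f g /asboolP[p fE] /asboolP[q gE]; apply/asboolP.
  by exists (p * q) => M; rewrite mevalM -fE -gE.
Qed.

Record coordinate_ring := CoordinateRing {
  coordinate_fun :> module_variety -> k;
  _ : coordinate_fun \in polynomial_function
}.

HB.instance Definition _ := [isSub for coordinate_fun].
HB.instance Definition _ := [Choice of coordinate_ring by <:].
HB.instance Definition _ :=
  GRing.SubChoice_isSubComPzRing.Build (module_variety -> k)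
    polynomial_function coordinate_ring polynomial_function_subring.

Definition weight := vertex -> int.

Definition admissible (sigma : weight) : Prop :=
  forall x, d x = 0%N -> sigma x = 0.

Definition semi_invariant (sigma : weight) : set coordinate_ring :=
  [set f | forall (g : GL) (M : module_variety),
     f (act (invGL g) M) = (\prod_x \det (sval g x) ^ sigma x) * f M].

(* The admissible weights give pairwise distinct characters of GL(d), so the   *)
(* sum of the spaces of semi-invariants inside the coordinate ring is direct.  *)
Definition SI : set coordinate_ring :=
  [set f | exists (r : nat) (sigma : 'I_r -> weight)
                  (F : 'I_r -> coordinate_ring),
     (forall i, admissible (sigma i) /\ semi_invariant (sigma i) (F i)) /\
     f = \sum_i F i].

(* Without admissibility the constant 1 would have a non-zero weight as soon   *)
(* as some d x = 0.                                                            *)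
Definition nullcone : set (rep d) :=
  [set M | exists2 M' : module_variety, val M' = M &
     forall (sigma : weight) (f : coordinate_ring),
       admissible sigma -> (exists x, sigma x != 0) ->
       semi_invariant sigma f -> f M' = 0].

(* [S] is a k-subalgebra isomorphic to k[T_1, ..., T_s].                       *)
Definition polynomial_ring_in (S : set coordinate_ring) (s : nat) : Prop :=
  exists phi : {rmorphism {mpoly k[s]} -> coordinate_ring},
    [/\ forall (c : k) (M : module_variety), phi c%:MP M = c,
        injective phi
      & range phi = S].

End ModuleVariety.

Section Modules.

Definition rep0 : rep (fun=> 0%N) := fun=> 0.

Definition rep_sum (d e : dimvec) (M : rep d) (N : rep e) :
    rep (fun x => (d x + e x)%N) :=
  fun a => block_mx (M a) 0 0 (N a).

Definition rep_iso (d e : dimvec) (M : rep d) (N : rep e) : Prop :=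
  exists (f : forall x, 'M[k]_(e x, d x)) (g : forall x, 'M[k]_(d x, e x)),
    [/\ forall x, g x *m f x = 1%:M,
        forall x, f x *m g x = 1%:M
      & forall a, f (tgt a) *m M a = N a *m f (src a)].

Definition indecomposable (d : dimvec) (M : rep d) : Prop :=
  [/\ module_variety M,
      exists x, d x <> 0%N
    & forall (d1 d2 : dimvec) (M1 : rep d1) (M2 : rep d2),
        module_variety M1 -> module_variety M2 ->
        rep_iso M (rep_sum M1 M2) ->
        (forall x, d1 x = 0%N) \/ (forall x, d2 x = 0%N)].

Inductive regular : forall d : dimvec, rep d -> Prop :=
| regular_zero : regular rep0
| regular_sum (d e : dimvec) (X : rep d) (M : rep e) :
    indecomposable X -> d vertex0 = d vertex_oo -> regular M ->
    regular (rep_sum X M)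
| regular_iso (d e : dimvec) (M : rep d) (N : rep e) :
    rep_iso M N -> regular M -> regular N.

End Modules.

Definition e_vertex (x : vertex) : {ffun vertex -> int} :=
  [ffun y => (y == x)%:R].

Definition h_vec : {ffun vertex -> int} := \sum_x e_vertex x.

Definition e_arm (i : 'I_(arms L)) (j : nat) : {ffun vertex -> int} :=
  if j == 0%N then h_vec - \sum_(1 <= l < len i) e_vertex (arm_vertex i l)
  else e_vertex (arm_vertex i j).

Definition canonical_decomposition (d : dimvec) (p : nat)
    (q : forall i : 'I_(arms L), 'I_(len i) -> nat) : Prop :=
  [ffun x => (d x)%:Z] =
    h_vec *+ p + \sum_(i < arms L) \sum_(j < len i) e_arm i j *+ q i j
  /\ forall i, exists j, q i j = 0%N.

End CanonicalAlgebra.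

(* A, as a module over the subring S, has a basis B.                           *)
Definition free_over (A : comPzRingType) (S : set A) : Prop :=
  exists B : set A,
    (forall a : A, exists (s : seq A) (c : A -> A),
       (forall b, b \in s -> B b /\ S (c b)) /\ a = \sum_(b <- s) c b * b) /\
    (forall (s : seq A) (c : A -> A),
       uniq s -> (forall b, b \in s -> B b /\ S (c b)) ->
       \sum_(b <- s) c b * b = 0 -> forall b, b \in s -> c b = 0).

(* Main.v *)
(* Give the arrows of arm i degree (prod m) / m_i.  The module variety X is     *)
(* then cut out of an affine space by t homogeneous equations, which are linear *)
(* in the arrows starting at oo.  The cokernels of the products of the other    *)
(* arrows of the arms can be put in general position, so that some maximal      *)
(* minor (the pivot) of this linear system is not zero; as X is irreducible, it *)
(* is rational of codimension t.                                                *)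
(* In place of the Cohen-Macaulay property we use that homogeneous polynomials  *)
(* of positive degree, as many as there are variables and generating an ideal   *)
(* of finite colength, form a regular sequence in any order: this is clear for  *)
(* the variables, and any two such systems are linked by systems that differ in *)
(* a single element.  Applied to the equations and the pivot, this shows that   *)
(* the equations generate the ideal of X; applied to the equations and s        *)
(* homogeneous generators of the semi-invariants, whose zeros are the nullcone, *)
(* it shows that these generators form a regular sequence on k[X].  Homogeneous *)
(* lifts of a basis of the quotient are then a basis of k[X].                   *)
(* Krull dimension is measured by the growth of the number of linearly          *)
(* independent elements of bounded degree.                                      *)
Require Import Defs.
From HB Require Import structures.
From mathcomp Require Import all_boot all_order all_algebra perm.
From mathcomp Require Import boolp classical_sets functions.
From mathcomp Require Import mpoly zify ring.

Set Implicit Arguments.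
Unset Strict Implicit.
Unset Printing Implicit Defensive.
Import GRing.Theory.
Local Open Scope ring_scope.

(** Let X be the module variety, N the number of matrix entries, P the polynomial ring in them, and
    g the t scalar equations of the relations, with ideal G.

    The ideal of X. The equations form a linear system in the entries of the last arrows.
    [decomposition_pivot] derives from the canonical decomposition that some maximal minor delta of
    it is a nonzero polynomial, so Cramer's rule eliminates t variables once delta is inverted. As X
    is irreducible, its ideal I is prime; by [growth_vanishing] the quotient P/I has dimension at
    most N - t, and every element of I is moved into G by a power of delta. A prime containing G and
    delta contains I strictly, so its dimension drops by one ([growth_drop]). Hence g and delta form
    a regular sequence, delta can be cancelled, and G = I ([vanishing_ideal_gen]).

    Regularity. [regular_of_growth] says that r forms of positive degree are a regular sequence in
    any order if every prime containing them has dimension at most N - r. Noether normalization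
    completes them to N forms generating an ideal of finite colength, and [hsop_regular] links such
    a system to the variables, exchanging one form at a time ([hsop_connect], [exchange_regular]).

    Semi-invariants. A one-parameter subgroup of GL(d) induces the grading, so every semi-invariant
    is homogeneous ([semi_invariant_homog]), and a polynomial ring of semi-invariants in s variables
    has s homogeneous generators y of positive degree ([homogeneous_generators]). Their zeros on X
    lie in the nullcone ([nullcone_mem]). Its codimension bounds the dimension of every prime
    containing g and y through [chain_growth], so y is a regular sequence on k[X] = P/G
    ([restrict_regular]). A homogeneous basis of k[X]/(y) is then a basis of k[X] over k[y]
    ([free_over_regular]). *)

(** * Ideals as predicates *)

Section Ideals.
Variable A : comPzRingType.
Implicit Types (J K : A -> Prop) (a b c : A).

Definition is_ideal J : Prop :=
  [/\ J 0, forall a b, J a -> J b -> J (a + b) & forall a b, J b -> J (a * b)].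

Definition is_prime J : Prop :=
  [/\ is_ideal J, ~ J 1 & forall a b, J (a * b) -> J a \/ J b].

Definition radical J a : Prop := exists m, J (a ^+ m).

Definition ideal_add J K a : Prop := exists b c, [/\ J b, K c & a = b + c].

(** The family comes with a set of indices so that all subfamilies can be handled without
    reordering. *)
Definition ideal_gen (T : finType) (f : T -> A) (S : {set T}) a : Prop :=
  exists h : T -> A, a = \sum_(i in S) h i * f i.

Definition nonzerodivisor_mod J a : Prop := forall u, J (a * u) -> J u.

Section Basics.
Variables (J : A -> Prop) (idJ : is_ideal J).

Lemma ideal0 : J 0. Proof. by case: idJ. Qed.
Lemma idealD a b : J a -> J b -> J (a + b). Proof. by case: idJ => _ + _; apply. Qed.
Lemma idealMl a b : J b -> J (a * b). Proof. by case: idJ => _ _; apply. Qed.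
Lemma idealMr a b : J a -> J (a * b). Proof. by rewrite mulrC; apply: idealMl. Qed.
Lemma idealN a : J a -> J (- a). Proof. by rewrite -mulN1r; apply: idealMl. Qed.
Lemma idealB a b : J a -> J b -> J (a - b).
Proof. by move=> Ja Jb; apply: idealD => //; apply: idealN. Qed.

Lemma ideal_sum (T : Type) (r : seq T) (Q : pred T) (F : T -> A) :
  (forall i, Q i -> J (F i)) -> J (\sum_(i <- r | Q i) F i).
Proof. by move=> JF; apply: big_ind => //; [apply: ideal0 | apply: idealD]. Qed.

Lemma ideal_subl a b : J (a - b) -> J b -> J a.
Proof. by move=> Jab Jb; rewrite -(subrK b a); apply: idealD. Qed.

Lemma ideal_subr a b : J (a - b) -> J a -> J b.
Proof. by move=> Jab Ja; rewrite -[b](subKr a); apply: idealB. Qed.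

Lemma ideal_congrD a b a' b' : J (a - a') -> J (b - b') -> J (a + b - (a' + b')).
Proof. by move=> Ja Jb; rewrite opprD addrACA; apply: idealD. Qed.

Lemma ideal_congrM a b a' b' : J (a - a') -> J (b - b') -> J (a * b - a' * b').
Proof.
move=> Ja Jb; have -> : a * b - a' * b' = (a - a') * b + a' * (b - b').
  by rewrite mulrBl mulrBr subrKA.
by apply: idealD; [apply: idealMr | apply: idealMl].
Qed.

Lemma ideal_congrX a b m : J (a - b) -> J (a ^+ m - b ^+ m).
Proof. by move=> Jab; rewrite subrXX; apply: idealMr. Qed.

Lemma ideal_expr a m m' : (m <= m')%N -> J (a ^+ m) -> J (a ^+ m').
Proof. by move=> /subnK <-; rewrite exprD; apply: idealMl. Qed.

Lemma sub_radical a : J a -> radical J a.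
Proof. by exists 1%N. Qed.

Lemma radical_ideal : is_ideal (radical J).
Proof.
split.
- by exists 1%N; rewrite expr1; apply: ideal0.
- move=> a b [m Ja] [m' Jb]; exists (m + m')%N; rewrite exprDn.
  apply: ideal_sum => i _; rewrite -mulr_natl; apply: idealMl.
  case: (leqP m' i) => mi.
    by apply: idealMl; apply: ideal_expr Jb.
  by apply: idealMr; apply: ideal_expr Ja; lia.
- by move=> a b [m Jb]; exists m; rewrite exprMn; apply: idealMl.
Qed.

Lemma radical_idem a : radical (radical J) a -> radical J a.
Proof. by move=> [m [m' Ja]]; exists (m * m')%N; rewrite exprM. Qed.

End Basics.

Lemma radicalS J K a : (forall b, J b -> K b) -> radical J a -> radical K a.
Proof. by move=> JK [m Ja]; exists m; apply: JK. Qed.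

Lemma prime_exp J a m : is_prime J -> J (a ^+ m) -> J a.
Proof.
move=> [idJ J1 prJ]; elim: m => [/J1//|m IHm].
by rewrite exprS => /prJ[//|/IHm].
Qed.

Lemma ideal_add_ideal J K : is_ideal J -> is_ideal K -> is_ideal (ideal_add J K).
Proof.
move=> idJ idK; split.
- by exists 0, 0; rewrite addr0; split=> //; apply: ideal0.
- move=> a b [a1 [a2 [Ja Ka ->]]] [b1 [b2 [Jb Kb ->]]].
  exists (a1 + b1), (a2 + b2); rewrite addrACA; split=> //; exact: idealD.
- move=> a b [b1 [b2 [Jb Kb ->]]]; exists (a * b1), (a * b2).
  by rewrite mulrDr; split=> //; apply: idealMl.
Qed.

Lemma ideal_addl J K a : is_ideal K -> J a -> ideal_add J K a.
Proof. by move=> idK Ja; exists a, 0; rewrite addr0; split=> //; apply: ideal0. Qed.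

Lemma ideal_addr J K a : is_ideal J -> K a -> ideal_add J K a.
Proof. by move=> idJ Ka; exists 0, a; rewrite add0r; split=> //; apply: ideal0. Qed.

Lemma ideal_add_sub J K I a : is_ideal I -> (forall b, J b -> I b) ->
  (forall b, K b -> I b) -> ideal_add J K a -> I a.
Proof. by move=> idI JI KI [b [c [/JI Ib /KI Ic ->]]]; apply: idealD. Qed.

Section Gen.
Variables (T : finType) (f : T -> A).
Implicit Type S : {set T}.

Lemma ideal_gen_ideal S : is_ideal (ideal_gen f S).
Proof.
split.
- by exists (fun=> 0); rewrite big1 // => i _; rewrite mul0r.
- move=> a b [h ->] [h' ->]; exists (fun i => h i + h' i).
  by rewrite -big_split; apply: eq_bigr => i _; rewrite mulrDl.
- move=> a b [h ->]; exists (fun i => a * h i).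
  by rewrite mulr_sumr; apply: eq_bigr => i _; rewrite mulrA.
Qed.

Lemma ideal_gen_mem S i : i \in S -> ideal_gen f S (f i).
Proof.
move=> Si; exists (fun j => (j == i)%:R); rewrite (bigD1 i) //= eqxx mul1r.
by rewrite big1 ?addr0 // => j /andP[_ /negPf->]; rewrite mul0r.
Qed.

Lemma ideal_gen_sub S J a : is_ideal J -> (forall i, i \in S -> J (f i)) ->
  ideal_gen f S a -> J a.
Proof. by move=> idJ Jf [h ->]; apply: ideal_sum => // i Si; apply: idealMl => //; apply: Jf. Qed.

Lemma ideal_genS S S' a : S \subset S' -> ideal_gen f S a -> ideal_gen f S' a.
Proof.
move=> /fintype.subsetP SS'; apply: ideal_gen_sub; first exact: ideal_gen_ideal.
by move=> i Si; apply/ideal_gen_mem/SS'.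
Qed.

Lemma ideal_genU1 S i a : ideal_gen f (i |: S) a ->
  exists u v, ideal_gen f S v /\ a = u * f i + v.
Proof.
move=> [h ->]; case: (boolP (i \in S)) => Si.
  exists 0, (\sum_(j in S) h j * f j); rewrite mul0r add0r.
  split; first by exists h.
  by apply: eq_bigl => j; rewrite in_setU1; case: eqP => // ->; rewrite Si.
exists (h i), (\sum_(j in S) h j * f j); split; first by exists h.
by rewrite big_setU1.
Qed.

End Gen.

Lemma eq_ideal_gen (T : finType) (f g : T -> A) (S : {set T}) a :
  {in S, f =1 g} -> ideal_gen f S a -> ideal_gen g S a.
Proof. by move=> fg [h ->]; exists h; apply: eq_bigr => i Si; rewrite fg. Qed.

End Ideals.

Section MapIdeal.
Variables (A B : comPzRingType) (f : {rmorphism A -> B}) (J : B -> Prop).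

Lemma preim_ideal : is_ideal J -> is_ideal (fun a => J (f a)).
Proof.
move=> idJ; split=> [|a b Ja Jb|a b Jb].
- by rewrite rmorph0; apply: ideal0.
- by rewrite rmorphD; apply: idealD.
- by rewrite rmorphM; apply: idealMl.
Qed.

End MapIdeal.

(** By Zorn's lemma there is a maximal ideal among those that contain J and avoid the multiplicative
    set S; such an ideal is prime. *)
Lemma exists_prime_disjoint (A : comPzRingType) (J S : A -> Prop) :
  is_ideal J -> S 1 -> (forall a b, S a -> S b -> S (a * b)) ->
  (forall a, J a -> ~ S a) ->
  exists I, [/\ is_prime I, forall a, J a -> I a & forall a, I a -> ~ S a].
Proof.
move=> idJ S1 SM JS.
(* The empty chain has the empty set as union; requiring only J together with I to be an ideal lets
   that set qualify. *)
pose P (I : set A) := is_ideal (fun a => J a \/ I a) /\ forall a, I a -> ~ S a.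
have [F FP Ftot|I [[idI IS] Imax]] := @Zorn_bigcup A P.
  split=> [|a [X FX Xa]]; last by have [_] := FP X FX; apply.
  have idX X : F X -> is_ideal (fun a => J a \/ X a) by move=> /FP[].
  have inc X a : F X -> J a \/ X a -> J a \/ (\bigcup_(X in F) X)%classic a.
    by move=> FX [Ja|Xa]; [left | right; exists X].
  split; first by left; apply: ideal0.
  - move=> a b [Ja [Jb|[Y FY Yb]]|[X FX Xa] [Jb|[Y FY Yb]]].
    + by left; apply: idealD.
    + by apply: (inc _ _ FY); apply: (idealD (idX Y FY)); [left | right].
    + by apply: (inc _ _ FX); apply: (idealD (idX X FX)); [right | left].
    + have [XY|YX] := Ftot X Y FX FY.
        by apply: (inc _ _ FY); apply: (idealD (idX Y FY)); right => //; apply: XY.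
      by apply: (inc _ _ FX); apply: (idealD (idX X FX)); right => //; apply: YX.
  - move=> a b [Jb|[X FX Xb]]; first by left; apply: idealMl.
    by apply: (inc _ _ FX); apply: (idealMl (idX X FX)); right.
pose p a := J a \/ I a.
have pS a : p a -> ~ S a by move=> [/JS|/IS].
(* By maximality, the ideal obtained by adjoining a must meet S. *)
have meets a : ~ p a -> exists x y, p x /\ S (x + y * a).
  move=> pa; pose B b := exists x y, p x /\ b = x + y * a.
  have idB : is_ideal B.
    split.
    - by exists 0, 0; rewrite mul0r addr0; split=> //; apply: (ideal0 idI).
    - move=> _ _ [x [y [px ->]]] [x' [y' [px' ->]]]; exists (x + x'), (y + y').
      by rewrite mulrDl addrACA; split=> //; apply: (idealD idI).
    - move=> b _ [x [y [px ->]]]; exists (b * x), (b * y).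
      by rewrite mulrDr mulrA; split=> //; apply: (idealMl idI).
  have pB b : p b -> B b by exists b, 0; rewrite mul0r addr0.
  have Ba : B a by exists 0, 1; rewrite mul1r add0r; split=> //; apply: (ideal0 idI).
  apply: contrapT => nomeet; apply: (Imax B).
    split=> [b Ib|/(_ a Ba) Ia]; first by apply: pB; right.
    by apply: pa; right.
  split=> [|_ [x [y [px ->]]] Sb]; last by apply: nomeet; exists x, y.
  rewrite (_ : (fun b => _) = B) //; apply/funext => b; apply/propext.
  by split=> [[Jb|]|]; [apply: pB; left | | right].
exists p; split=> //; last by left.
split=> // [p1|a b pab]; first exact: (pS 1).
apply: contrapT => /not_orP[/meets[x [y [px Sxy]]] /meets[x' [y' [px' Sxy']]]].
apply: (pS _ _ (SM _ _ Sxy Sxy')).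
have -> : (x + y * a) * (x' + y' * b) = (x' + y' * b) * x + y * a * x' + y * y' * (a * b).
  by ring.
by apply: (idealD idI); [apply: (idealD idI) |]; apply: (idealMl idI).
Qed.

(** * Zeros of polynomials over an infinite field *)

(** Digits in base B: the lowest one is the residue modulo B, the others follow by induction. *)
Lemma expansion_inj n (B : nat) (m m' : 'I_n -> nat) :
  (forall i, m i < B)%N -> (forall i, m' i < B)%N ->
  (\sum_i m i * B ^ i = \sum_i m' i * B ^ i)%N -> m =1 m'.
Proof.
elim: n m m' => [|n IHn] m m' mB m'B; first by move=> _ [].
rewrite !big_ord_recl /= !expn0 !muln1.
have shift (u : 'I_n.+1 -> nat) :
    (\sum_(i < n) u (lift ord0 i) * B ^ bump 0 i =
     B * \sum_(i < n) u (lift ord0 i) * B ^ i)%N.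
  by rewrite big_distrr; apply: eq_bigr => i _ /=; rewrite expnS mulnCA.
rewrite !shift => eq_mm'.
have eq0 : m ord0 = m' ord0.
  rewrite -(modn_small (mB ord0)) -(modn_small (m'B ord0)).
  by rewrite -(modnMDl (\sum_(i < n) m (lift ord0 i) * B ^ i) (m ord0))
    -(modnMDl (\sum_(i < n) m' (lift ord0 i) * B ^ i) (m' ord0)) addnC mulnC
    eq_mm' addnC [in RHS]mulnC.
have B_gt0 : (0 < B)%N by apply: leq_ltn_trans (mB ord0).
have /(IHn (m \o lift ord0) (m' \o lift ord0)) eqS :
    (\sum_(i < n) m (lift ord0 i) * B ^ i = \sum_(i < n) m' (lift ord0 i) * B ^ i)%N.
  by move: eq_mm'; rewrite eq0 => /addnI/eqP; rewrite eqn_pmul2l // => /eqP.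
by move=> i; case: (unliftP ord0 i) => [j|] -> //; apply: eqS => l; [apply: mB|apply: m'B].
Qed.

(* Kronecker substitution x_i |-> t^(B^i) reduces to one variable. *)
Lemma mpoly_nonroot (k : closedFieldType) n (p : {mpoly k[n]}) :
  p != 0 -> exists v, p.@[v] != 0.
Proof.
move=> p0; pose B := (msize p).+1.
pose e (m : 'X_{1..n}) := (\sum_i m i * B ^ i)%N.
have small m i : m \in msupp p -> (m i < B)%N.
  move=> /msize_mdeg_lt; rewrite mdegE => lt; rewrite ltnS.
  by apply: leq_trans (ltnW lt); rewrite (bigD1 i) //= leq_addr.
pose P : {poly k} := \sum_(m <- msupp p) p@_m *: 'X^(e m).
have [m0 m0p] : exists m, m \in msupp p.
  by case E: (msupp p) (msupp_eq0 p) p0 => [|m s]; [move=> <- | exists m; rewrite inE eqxx].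
have P0 : P != 0.
  apply: contraTneq m0p => P0; rewrite mcoeff_msupp negbK.
  have := congr1 (fun q : {poly k} => q`_(e m0)) P0; rewrite coef0 coef_sum.
  case: (boolP (m0 \in msupp p)) => [m0p|/memN_msupp_eq0->//].
  rewrite (bigD1_seq m0) ?msupp_uniq //= coefZ coefXn eqxx mulr1 big_seq_cond.
  rewrite big1 ?addr0 => [->//|m /andP[mp nm]]; rewrite coefZ coefXn.
  case: eqP => [/esym/expansion_inj eq_m|_]; last by rewrite mulr0.
  case/eqP: nm; apply/mnmP; apply: eq_m => i; exact: small.
have /closed_nonrootP[x Px] := P0; exists (fun i => x ^+ (B ^ i)).
rewrite mevalE; congr (_ != 0): Px; rewrite horner_sum; apply: eq_bigr => m _.
rewrite hornerZ hornerXn /e -prodrXr; congr (_ * _); apply: eq_bigr => i _.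
by rewrite -exprM mulnC.
Qed.

(** * Hilbert's Nullstellensatz *)

Section PolySpecialize.
Variables (k : closedFieldType) (A : comNzRingType) (ev : {rmorphism A -> k}).
Variables (s : k -> A) (sK : cancel s ev).
Variables (K : {poly A} -> Prop) (idK : is_ideal K) (properK : ~ K 1).
Variables (g : {poly A}) (monic_g : g \is monic) (Kg : K g).
Hypothesis evK : forall c, K c%:P -> ev c = 0.

Let gk_monic : map_poly ev g \is monic. Proof. exact: monic_map. Qed.
Let size_gk : size (map_poly ev g) = size g.
Proof. by rewrite size_map_poly_id0 // (monicP monic_g) rmorph1 oner_neq0. Qed.

(* The norm of [f] for the extension A[X]/(g) of A lies in K and specializes
   to 1. *)
Let evK_neq1 f : K f -> map_poly ev f != 1.
Proof.
move=> Kf; apply/eqP => ev_f; pose d := (size g).-1.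
have sg : size g = d.+1 by rewrite prednK // size_poly_gt0 monic_neq0.
have d_gt0 : (0 < d)%N.
  rewrite lt0n; apply/eqP => d0; apply: properK; move: (sg); rewrite d0 => /eqP/size_poly1P[c c0 gE].
  by move: monic_g (Kg); rewrite gE monicE lead_coefC => /eqP ->.
pose r i := Pdiv.Ring.rmodp (f * 'X^i) g.
have rE i : f * 'X^i = Pdiv.Ring.rdivp (f * 'X^i) g * g + r i.
  exact: Pdiv.RingMonic.rdivp_eq.
have sr i : (size (r i) <= d)%N.
  by rewrite -ltnS -sg Pdiv.Ring.ltn_rmodpN0 // monic_neq0.
(* The matrix of multiplication by f on A[X]/(g) in the basis of powers of X. *)
pose M : 'M[A]_d := \matrix_(i < d, j < d) (r i)`_j.
pose v : 'cV[{poly A}]_d := \col_j 'X^j.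
have Mv i : K ((map_mx polyC M *m v) i 0).
  rewrite mxE; have -> : \sum_j map_mx polyC M i j * v j 0 = r i.
    rewrite -[r i]coefK (poly_def (size _)).
    rewrite (big_ord_widen d (fun j => (r i)`_j *: 'X^j)) // [RHS]big_mkcond /=.
    apply: eq_bigr => j _; rewrite !mxE mul_polyC.
    by case: ltnP => // /(nth_default 0) ->; rewrite scale0r.
  have -> : r i = f * 'X^i - Pdiv.Ring.rdivp (f * 'X^i) g * g by apply/eqP; rewrite eq_sym subr_eq addrC -rE.
  by apply: idealB => //; [apply: idealMr | apply: idealMl].
(* Multiplying [M *m v], whose entries lie in K, by the adjugate gives [\det M] times v, and the
   entry of v at index 0 is 1. *)
have KdetM : K (\det M)%:P.
  have := mul_adj_mx (map_mx polyC M) => /(congr1 (fun N => (N *m v) (Ordinal d_gt0) 0)).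
  rewrite -mulmxA mul_scalar_mx det_map_mx [in RHS]mxE [v _ _]mxE mulr1 => <-.
  by rewrite mxE; apply: ideal_sum => // j _; apply: idealMl.
(* As f specializes to 1, the remainder of [f * 'X^i] specializes to 'X^i, and M to the identity. *)
have := evK KdetM; rewrite -det_map_mx (_ : map_mx ev M = 1%:M); last first.
  apply/matrixP => i j; rewrite !mxE.
  suff -> : ev (r i)`_j = ('X^i)`_j by rewrite coefXn eq_sym.
  rewrite -coef_map; congr ((_ : {poly k})`_j); apply/eqP; rewrite eq_sym -subr_eq0.
  have := congr1 (map_poly ev) (rE i); rewrite rmorphD !rmorphM /= ev_f mul1r.
  rewrite map_polyXn => XE; apply: contraT => ne0.
  have qE : 'X^i - map_poly ev (r i) = map_poly ev (Pdiv.Ring.rdivp (f * 'X^i) g) * map_poly ev g.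
    by rewrite XE addrK.
  have sz : (size ('X^i - map_poly ev (r i))%R < size (map_poly ev g))%N.
    rewrite size_gk sg ltnS (leq_trans (size_polyD _ _)) // geq_max size_polyXn ltn_ord.
    by rewrite size_polyN (leq_trans (size_poly _ _)).
  move: sz ne0; rewrite qE; case: (eqVneq (map_poly ev (Pdiv.Ring.rdivp (f * 'X^i) g)) 0) => [->|q0].
    by rewrite mul0r eqxx.
  rewrite size_Mmonic // size_gk sg => + _; have: (0 < size (map_poly ev (Pdiv.Ring.rdivp (f * 'X^i) g)))%N.
    by rewrite size_poly_gt0.
  by move=> q_gt0; rewrite addnS /= ltnS -[X in (_ <= X)%N]add0n leq_add2r leqNgt q_gt0.
by rewrite det1 => /eqP; rewrite oner_eq0.
Qed.

(** The lying-over step of the Nullstellensatz. As ev is onto, the image of K in k[X] is an ideal;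
    it is nonzero because of g, and proper by the norm argument. Any root of its element u of least
    degree will do. *)
Lemma poly_specialize : exists c, forall h, K h -> (map_poly ev h).[c] = 0.
Proof.
pose I u := exists2 h, K h & u = map_poly ev h.
have lift (u : {poly k}) : exists w, map_poly ev w = u.
  exists (\poly_(i < size u) s u`_i); apply/polyP => i.
  rewrite coef_map coef_poly; case: ltnP => iu; first by rewrite /= sK.
  by rewrite /= rmorph0 nth_default.
have IM u v : I v -> I (u * v).
  move=> [h Kh ->]; have [w <-] := lift u; exists (w * h); first exact: idealMl.
  by rewrite rmorphM.
have ex : exists n, `[< exists u, [/\ I u, u != 0 & size u = n] >].
  exists (size (map_poly ev g)); apply/asboolP; exists (map_poly ev g).
  by split=> //; [exists g | apply: monic_neq0].
case: (ex_minnP ex) => n /asboolP[u [Iu u0 un]] minu.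
have u_n1 : size u != 1%N.
  apply/negP => /size_poly1P[c c0 uE]; have [h Kh /esym] : I 1.
    by rewrite -polyC1 -(mulVf c0) polyCM; apply: IM; rewrite -uE.
  by move/eqP; apply/negP/evK_neq1.
have /closed_rootP[c uc] := u_n1; exists c => h Kh.
suff /eqP : map_poly ev h %% u == 0.
  by move=> h0; rewrite (divp_eq (map_poly ev h) u) h0 addr0 hornerM (rootP uc) mulr0.
apply: contraT => r0; have := ltn_modp (map_poly ev h) u; rewrite u0 => lt.
suff : (n <= size (map_poly ev h %% u)%R)%N by rewrite -un leqNgt lt.
apply: minu; apply/asboolP; exists (map_poly ev h %% u); split=> //.
have -> : map_poly ev h %% u = map_poly ev h - map_poly ev h %/ u * u.
  by rewrite {2}(divp_eq (map_poly ev h) u) addrC addKr.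
have [h' Kh' ->] := IM (map_poly ev h %/ u) u Iu.
by exists (h - h'); [apply: idealB | rewrite rmorphB].
Qed.

End PolySpecialize.

Lemma mpoly_rmorph_eq (R : comNzRingType) n (S : pzRingType)
    (F G : {rmorphism {mpoly R[n]} -> S}) :
  (forall c, F c%:MP = G c%:MP) -> (forall i, F 'X_i = G 'X_i) -> F =1 G.
Proof.
move=> FGC FGX p; rewrite (mpolyE p) !rmorph_sum; apply: eq_bigr => m _.
rewrite -mul_mpolyC !rmorphM FGC; congr (_ * _).
rewrite mpolyXE_id !rmorph_prod; apply: eq_bigr => i _.
by rewrite !rmorphXn FGX.
Qed.

Section LeadingCoefficient.
Variable A : comNzRingType.
Implicit Types p q : {poly A}.

(** The coefficient at the degree bound may be zero, which makes the notion multiplicative over any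
    ring. *)
Definition deg_coef p a c : Prop := (size p <= a.+1)%N /\ p`_a = c.

Lemma deg_coefM p q a b c e :
  deg_coef p a c -> deg_coef q b e -> deg_coef (p * q) (a + b) (c * e).
Proof.
move=> [sp pa] [sq qb]; split.
  apply: (leq_trans (size_polyMleq p q)); move: (leq_add sp sq).
  by rewrite addnS addSn; case: (_ + _)%N.
rewrite coefM; have lt_a : (a < (a + b).+1)%N by lia.
rewrite (bigD1 (Ordinal lt_a)) //= addKn pa qb big1 ?addr0 // => i ia.
have [lt|gt] : (i < a)%N \/ (a < i)%N.
- by apply/orP; rewrite -neq_ltn; apply: contra ia => /eqP ia; apply/eqP/val_inj.
- by rewrite [q`_ _]nth_default ?mulr0 //; apply: leq_trans sq _; lia.
- by rewrite nth_default ?mul0r //; apply: leq_trans sp _; lia.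
Qed.

Lemma deg_coef_exp p a c m : deg_coef p a c -> deg_coef (p ^+ m) (a * m) (c ^+ m).
Proof.
move=> pac; elim: m => [|m IHm]; last by rewrite !exprS mulnS; apply: deg_coefM.
by rewrite !expr0 muln0; split; rewrite ?size_poly1 ?coef1.
Qed.

Lemma deg_coef_prod (I : Type) (r : seq I) (F : I -> {poly A}) (a : I -> nat) c :
  (forall i, deg_coef (F i) (a i) (c i)) ->
  deg_coef (\prod_(i <- r) F i) (\sum_(i <- r) a i) (\prod_(i <- r) c i).
Proof.
move=> FP; elim: r => [|i r IHr]; last by rewrite !big_cons; apply: deg_coefM.
by rewrite !big_nil; split; rewrite ?size_poly1 ?coef1.
Qed.

End LeadingCoefficient.

Section Null.
Variable k : closedFieldType.

Section Step.
Variables (n : nat) (c : 'I_n.+1 -> k).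

(** The change of coordinates x_i -> x_i + c_i T, where the last variable goes to c_max T alone. A
    general c makes a given nonzero polynomial monic in T up to a constant. *)
Definition shear_var (i : 'I_n.+1) : {poly {mpoly k[n]}} :=
  (if unlift ord_max i is Some j then ('X_j)%:P else 0) + (c i)%:MP%:P * 'X.

Definition shear : {rmorphism {mpoly k[n.+1]} -> {poly {mpoly k[n]}}} :=
  mmap (polyC \o @mpolyC n k) shear_var.

Definition unshear_var (j : 'I_n) : {mpoly k[n.+1]} :=
  'X_(lift ord_max j) - (c (lift ord_max j) / c ord_max)%:MP * 'X_ord_max.

Definition unshear0 : {rmorphism {mpoly k[n]} -> {mpoly k[n.+1]}} :=
  mmap (@mpolyC n.+1 k) unshear_var.

Definition unshear : {rmorphism {poly {mpoly k[n]}} -> {mpoly k[n.+1]}} :=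
  horner_eval ((c ord_max)^-1%:MP * 'X_ord_max) \o map_poly unshear0.

Lemma shearK : c ord_max != 0 -> cancel shear unshear.
Proof.
move=> c_max p; apply: (mpoly_rmorph_eq (F := unshear \o shear) (G := idfun)) => [e|i] /=.
  rewrite /shear /= mmapC /= /unshear /= map_polyC /= /horner_eval hornerC.
  by rewrite /unshear0 /= mmapC.
rewrite /shear /= mmapX mmap1U /shear_var rmorphD rmorphM /= !map_polyC /=.
rewrite map_polyX /horner_eval hornerD hornerM hornerC hornerX mmapC.
case: unliftP => [j|] -> /=.
  rewrite map_polyC hornerC /= mmapX mmap1U /unshear_var mulrA -mpolyCM.
  by rewrite subrK.
by rewrite rmorph0 horner0 add0r mulrA -mpolyCM divff // mpolyC1 mul1r.
Qed.

Lemma deg_coef_shearX (m : 'X_{1..n.+1}) :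
  deg_coef (shear 'X_[m]) (mdeg m) (\prod_i (c i) ^+ m i)%:MP.
Proof.
rewrite /shear /= mmapX mdegE rmorph_prod; apply: deg_coef_prod => i.
rewrite rmorphXn; rewrite -[X in deg_coef _ X _]mul1n; apply: deg_coef_exp.
split; rewrite /shear_var mul_polyC.
  rewrite (leq_trans (size_polyD _ _)) // geq_max (leq_trans (size_scale_leq _ _)) ?size_polyX //.
  by case: (unlift _ _) => [j|]; rewrite ?size_polyC ?size_poly0 // (leq_trans (leq_b1 _)).
rewrite coefD coefZ coefX mulr1.
by case: (unlift _ _) => [j|]; rewrite ?coefC ?coef0 /= add0r.
Qed.

(** Only the monomials of top degree reach this power of T, each contributing its value at c. *)
Lemma deg_coef_shear (f : {mpoly k[n.+1]}) :
  deg_coef (shear f) (msize f).-1 ((pihomog mdeg (msize f).-1 f).@[c])%:MP.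
Proof.
have szm m : m \in msupp f -> (mdeg m <= (msize f).-1)%N.
  by move=> /msize_mdeg_lt; lia.
have fE : shear f = \sum_(m <- msupp f) (f@_m)%:MP *: shear 'X_[m].
  rewrite {1}(mpolyE f) rmorph_sum; apply: eq_bigr => m _.
  by rewrite -mul_mpolyC rmorphM /shear /= mmapC mul_polyC.
split.
  rewrite fE; apply: (leq_trans (size_sum _ _ _)); rewrite big_seq.
  apply/bigmax_leqP_seq => m mf _; apply: leq_trans (size_scale_leq _ _) _.
  by apply: leq_trans (proj1 (deg_coef_shearX m)) _; rewrite ltnS szm.
rewrite fE coef_sum pihomogE (raddf_sum (meval c)) /= (raddf_sum (@mpolyC n k)) [RHS]big_mkcond /=.
rewrite big_seq [RHS]big_seq; apply: eq_bigr => m mf; rewrite coefZ.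
have [sm cm] := deg_coef_shearX m; case: eqP => [<-|/eqP ne].
  by rewrite cm mevalZ mevalX mpolyCM.
by rewrite nth_default ?mulr0 //; apply: leq_trans sm _; rewrite ltn_neqAle ne szm.
Qed.

End Step.

(** Induction on n. A nonzero element of J becomes monic in T after a shear; a zero of the
    contraction of J to the other variables, given by induction, extends to T by
    [poly_specialize]. *)
Lemma weak_nullstellensatz n (J : {mpoly k[n]} -> Prop) :
  is_ideal J -> ~ J 1 -> exists v, forall p, J p -> p.@[v] = 0.
Proof.
elim: n J => [|n IHn] J idJ J1.
  exists (fun=> 0) => p Jp; rewrite (nvar0_mpolyC p) mevalC.
  apply/eqP/contraT => p0; case: J1.
  rewrite -mpolyC1 -(mulVf p0) mpolyCM; apply: idealMl => //.
  by rewrite -nvar0_mpolyC.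
have [f0|/existsNP[f /not_implyP[Jf /eqP f0]]] := pselect (forall f, J f -> f = 0).
  by exists (fun=> 0) => p /f0 ->; rewrite meval0.
set D := (msize f).-1; pose fD := pihomog mdeg D f.
have fD0 : fD != 0.
  apply/eqP => fD0; have := mleadc_eq0 f; rewrite (negPf f0) => /negP; apply.
  suff <- : fD@_(mlead f) = f@_(mlead f) by rewrite fD0 mcoeff0.
  rewrite /fD pihomogE raddf_sum /= big_mkcond (bigD1_seq (mlead f)) ?msupp_uniq ?mlead_supp //=.
  rewrite /D -mlead_deg // eqxx mcoeffZ mcoeffX eqxx mulr1 big1 ?addr0 // => m ne.
  by rewrite mcoeffZ mcoeffX (negPf ne) mulr0 if_same.
have X0 : 'X_ord_max != 0 :> {mpoly k[n.+1]}.
  by rewrite -msize_poly_eq0 msizeX.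
have [c] := mpoly_nonroot (mulf_neq0 fD0 X0).
rewrite mevalM mevalXU mulf_eq0 negb_or => /andP[fDc c0].
pose K h := J (unshear c h); have idK : is_ideal K by apply: preim_ideal.
have [degf coef_f] := deg_coef_shear c f; rewrite -/D -/fD in degf coef_f.
pose g := ((fD.@[c])^-1)%:MP *: shear c f.
have gD : g`_D = 1 by rewrite coefZ coef_f -mpolyCM mulVf.
have Kg : K g.
  by rewrite /K /g -mul_polyC rmorphM; apply: idealMl; rewrite ?shearK //.
have monic_g : g \is monic.
  have sg : (size g <= D.+1)%N by apply: leq_trans (size_scale_leq _ _) _.
  rewrite monicE /lead_coef (_ : (size g).-1 = D) ?gD //.
  have : (D < size g)%N.
    by rewrite ltnNge; apply/negP => /(nth_default 0)/eqP; rewrite gD oner_eq0.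
  lia.
have K1 : ~ K 1 by rewrite /K rmorph1.
have idK0 : is_ideal (fun a => K a%:P) by exact: (preim_ideal (@polyC {mpoly k[n]}) idK).
have [a Ka] := IHn _ idK0 K1.
have [b Kb] := poly_specialize (s := @mpolyC n k) (ev := meval a) (mevalC _) idK K1 monic_g Kg Ka.
exists (fun i => (map_poly (meval a) (shear_var c i)).[b]) => p Jp.
rewrite -(Kb (shear c p)); last by rewrite /K shearK //.
apply: (mpoly_rmorph_eq (F := meval _)
   (G := horner_eval b \o map_poly (meval a) \o shear c)) => [e|i] /=.
  by rewrite mevalC mmapC /= map_polyC /horner_eval hornerC /= mevalC.
by rewrite mevalXU mmapX mmap1U.
Qed.


Reserved Notation "x %:F" (format "x %:F").

Section Rabinowitsch.
Variables (n : nat) (J : {mpoly k[n]} -> Prop) (f : {mpoly k[n]}).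
Hypotheses (idJ : is_ideal J) (f0 : f != 0).

Let F := {fraction {mpoly k[n]}}.
Local Notation tofrac := (@FracField.tofrac {mpoly k[n]}).
Local Notation "x %:F" := (tofrac x).
Let fF : F := f%:F.
Let fF0 : fF != 0. Proof. by rewrite tofrac_eq0. Qed.

(* T is interpreted as 1/f. *)
Let loc : {rmorphism {poly {mpoly k[n]}} -> F} :=
  horner_eval (fF^-1) \o map_poly tofrac.

Let loc_num h : exists M p, p%:F = fF ^+ M * loc h.
Proof.
elim/poly_ind: h => [|h c [M [p ph]]]; first by exists 0%N, 0; rewrite !rmorph0 mulr0.
exists M.+1, (p + f ^+ M.+1 * c); rewrite tofracD ph tofracM tofracXn rmorphD mulrDr.
congr (_ + _ * _).
  by rewrite rmorphM /= map_polyX /horner_eval hornerX exprSr -mulrA [fF * _]mulrCA mulfV // mulr1.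
by rewrite /= map_polyC /horner_eval hornerC.
Qed.

(** The preimage in P[T] of the extension of J to P[1/f], with denominators cleared. *)
Let K h : Prop := exists M p, J p /\ p%:F = fF ^+ M * loc h.

Let idK : is_ideal K.
Proof.
split.
- by exists 0%N, 0; rewrite !rmorph0 mulr0; split=> //; apply: ideal0.
- move=> a b [M [p [Jp pE]]] [M' [p' [Jp' p'E]]].
  exists (M + M')%N, (f ^+ M' * p + f ^+ M * p'); split.
    by apply: idealD => //; apply: idealMl.
  by rewrite tofracD !tofracM !tofracXn pE p'E rmorphD mulrDr exprD !mulrA [_ ^+ M' * _]mulrC.
- move=> a b [M [p [Jp pE]]]; have [M' [p' p'E]] := loc_num a.
  exists (M' + M)%N, (p' * p); split; first exact: idealMl.
  by rewrite tofracM pE p'E rmorphM exprD mulrACA.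
Qed.

(** Rabinowitsch's trick: K contains J and f T - 1, so it has no zero; hence it contains 1, which
    means that a power of f is in J. *)
Lemma nullstellensatz_neq0 : (forall v, (forall p, J p -> p.@[v] = 0) -> f.@[v] = 0) ->
  radical J f.
Proof.
move=> vanish; apply: contrapT => notrad.
have K1 : ~ K 1.
  move=> [M [p [Jp]]]; rewrite rmorph1 mulr1 -tofracXn => /eqP; rewrite tofrac_eq => /eqP pE.
  by apply: notrad; exists M; rewrite -pE.
(* For this c the shear merely renames the last variable to T. *)
pose c (i : 'I_n.+1) : k := (i == ord_max)%:R.
have shearC p : shear c (mwiden p) = p%:P.
  apply: (mpoly_rmorph_eq (F := shear c \o @mwiden n k) (G := @polyC _)) => [e|i] /=.
    by rewrite mwidenC /shear /= mmapC.
  rewrite mwidenX mnmwiden1 /shear /= mmapX mmap1U /shear_var.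
  have -> : widen_ord (leqnSn n) i = lift ord_max i by apply/val_inj/esym/lift_max.
  by rewrite liftK /c eq_sym (negPf (neq_lift _ _)) mpolyC0 polyC0 mul0r addr0.
have idK' : is_ideal (fun p => K (shear c p)) := preim_ideal (shear c) idK.
have K1' : ~ K (shear c 1) by rewrite rmorph1.
have [v vK] := weak_nullstellensatz idK' K1'.
have vJ p : J p -> (mwiden p).@[v] = 0.
  move=> Jp; apply: vK; rewrite shearC; exists 0%N, p; split=> //.
  by rewrite mul1r /= map_polyC /horner_eval hornerC.
have vE p : (mwiden p).@[v] = p.@[v \o widen_ord (leqnSn n)].
  apply: (mpoly_rmorph_eq (F := meval v \o @mwiden n k) (G := meval _)) => [e|i] /=.
    by rewrite mwidenC !mevalC.
  by rewrite mwidenX mnmwiden1 !mevalXU.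
have /vK : K (shear c (mwiden f * 'X_ord_max - 1)).
  rewrite rmorphB rmorphM rmorph1 shearC /shear /= mmapX mmap1U /shear_var unlift_none.
  rewrite add0r /c eqxx mpolyC1 mul1r; exists 0%N, 0; split; first exact: ideal0.
  rewrite mul1r rmorphB rmorphM rmorph1 /= map_polyC map_polyX /horner_eval hornerC hornerX.
  by rewrite mulfV // subrr tofrac0.
rewrite mevalB mevalM meval1 vE vanish ?mul0r ?sub0r; first by move/eqP; rewrite oppr_eq0 oner_eq0.
by move=> p Jp; rewrite -vE vJ.
Qed.

End Rabinowitsch.

Lemma nullstellensatz n (J : {mpoly k[n]} -> Prop) (f : {mpoly k[n]}) : is_ideal J ->
  (forall v, (forall p, J p -> p.@[v] = 0) -> f.@[v] = 0) -> radical J f.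
Proof.
move=> idJ; have [-> _|/eqP f0] := pselect (f = 0); last exact: nullstellensatz_neq0.
by apply: sub_radical; apply: ideal0.
Qed.

End Null.

(** * Growth of quotients of weighted polynomial rings *)

Definition subst (k : comNzRingType) (r n : nat) (z : 'I_r -> {mpoly k[n]}) :
  {rmorphism {mpoly k[r]} -> {mpoly k[n]}} := mmap (@mpolyC n k) z.

Section SubstTheory.
Variables (k : comNzRingType) (r n : nat).
Implicit Types (z : 'I_r -> {mpoly k[n]}) (F : {mpoly k[r]}).

Lemma substC z c : subst z c%:MP = c%:MP. Proof. exact: mmapC. Qed.
Lemma substX z m : subst z 'X_[m] = \prod_i z i ^+ m i. Proof. exact: mmapX. Qed.
Lemma substXU z i : subst z 'X_i = z i.
Proof. by rewrite /subst /= mmapX mmap1U. Qed.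
Lemma substZ z c F : subst z (c *: F) = c *: subst z F.
Proof. by rewrite -!mul_mpolyC rmorphM substC. Qed.

Lemma substE z F : subst z F = \sum_(m <- msupp F) F@_m *: \prod_i z i ^+ m i.
Proof.
rewrite {1}(mpolyE F) rmorph_sum; apply: eq_bigr => m _.
by rewrite substZ substX.
Qed.

Lemma subst_const (v : 'I_r -> k) F :
  subst (fun i => (v i)%:MP_[n]) F = (F.@[v])%:MP.
Proof.
rewrite substE mevalE (raddf_sum (@mpolyC n k)); apply: eq_bigr => m _.
rewrite /= mpolyCM -mul_mpolyC rmorph_prod; congr (_ * _).
by apply: eq_bigr => i _; rewrite rmorphXn.
Qed.

Lemma subst_scale z t d F : F \is d.-homog ->
  subst (fun i => t * z i) F = t ^+ d * subst z F.
Proof.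
move=> /dhomogP homF; rewrite !substE mulr_sumr big_seq [RHS]big_seq.
apply: eq_bigr => m /homF <-; rewrite -scalerAr; congr (_ *: _).
by rewrite /= mdegE -prodrXr -big_split; apply: eq_bigr => i _; rewrite exprMn.
Qed.

Lemma subst_congr (J : {mpoly k[n]} -> Prop) z z' F : is_ideal J ->
  (forall i, J (z i - z' i)) -> J (subst z F - subst z' F).
Proof.
move=> idJ zz'; rewrite !substE -sumrB; apply: ideal_sum => // m _.
rewrite -scalerBr -mul_mpolyC; apply: idealMl => //.
by elim/big_rec2: _ => [|i x y _]; rewrite ?subrr; [apply: ideal0 |
   move=> xy; apply: ideal_congrM => //; apply: ideal_congrX].
Qed.

End SubstTheory.

Lemma subst_comp (k : comNzRingType) (r n e : nat) (z : 'I_r -> {mpoly k[n]})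
    (y : 'I_n -> {mpoly k[e]}) F : subst y (subst z F) = subst (fun i => subst y (z i)) F.
Proof.
rewrite (substE z) rmorph_sum substE; apply: eq_bigr => m _.
rewrite substZ rmorph_prod; congr (_ *: _).
by apply: eq_bigr => i _; rewrite rmorphXn.
Qed.

Section Growth.
Variables (k : closedFieldType) (n : nat) (mf : measure n).
Local Notation P := {mpoly k[n]}.
Implicit Types (I J : P -> Prop) (p f : P).

Definition wdeg_le a p : Prop := forall m, m \in msupp p -> (mf m <= a)%N.

Definition independent_mod J (T : finType) (p : T -> P) : Prop :=
  forall c : T -> k, J (\sum_t c t *: p t) -> forall t, c t = 0.

(* I.e. the Krull dimension of P/J is at most q. *)
Definition growth_le J (q : nat) : Prop :=
  exists C, forall m (T : finType) (p : T -> P), (forall t, wdeg_le m (p t)) ->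
    independent_mod J p -> (#|T| <= C * m.+1 ^ q)%N.

Definition homogeneous_ideal J : Prop := forall d p, J p -> J (pihomog mf d p).

Definition alg_independent_mod J r (z : 'I_r -> P) : Prop :=
  forall F : {mpoly k[r]}, J (subst z F) -> F = 0.

(** Nilpotence of the variables makes P/J finite-dimensional; the unit ideal is allowed. *)
Definition finite_colength J : Prop := forall i, radical J 'X_i.

Lemma wdeg_leW a b p : (a <= b)%N -> wdeg_le a p -> wdeg_le b p.
Proof. by move=> ab pa m /pa h; apply: leq_trans ab. Qed.

Lemma wdeg_le_ex p : exists a, wdeg_le a p.
Proof. by exists (mmeasure mf p) => m /mmeasure_mnm_lt/ltnW. Qed.

Lemma wdeg_leC a c : wdeg_le a c%:MP.
Proof. by move=> m; rewrite msuppC; case: eqP => // _; rewrite inE => /eqP->; rewrite mf0. Qed.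

Lemma wdeg_leD a p f : wdeg_le a p -> wdeg_le a f -> wdeg_le a (p + f).
Proof. by move=> pa fa m /msuppD_le; rewrite mem_cat => /orP[/pa|/fa]. Qed.

Lemma wdeg_leM a b p f : wdeg_le a p -> wdeg_le b f -> wdeg_le (a + b) (p * f).
Proof.
move=> pa fb m /msuppM_le/allpairsP[[m1 m2] /= [/pa m1a /fb m2b ->]].
by rewrite mfD leq_add.
Qed.

Lemma wdeg_leX a p m : wdeg_le a p -> wdeg_le (m * a) (p ^+ m).
Proof.
move=> pa; elim: m => [|m IHm]; last by rewrite exprS mulSn; apply: wdeg_leM.
by rewrite expr0 -mpolyC1; apply: wdeg_leC.
Qed.

Lemma wdeg_le_prod (T : Type) (s : seq T) (F : T -> P) (a : T -> nat) :
  (forall t, wdeg_le (a t) (F t)) ->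
  wdeg_le (\sum_(t <- s) a t) (\prod_(t <- s) F t).
Proof.
move=> Fa; elim: s => [|t s IHs]; last by rewrite !big_cons; apply: wdeg_leM.
by rewrite !big_nil -mpolyC1; apply: wdeg_leC.
Qed.

Lemma homog_sum a p : wdeg_le a p -> p = \sum_(d < a.+1) pihomog mf d p.
Proof.
move=> pa; apply: pihomog_partitionE; rewrite mmeasureE.
by apply/bigmax_leqP_seq => m /pa.
Qed.

Lemma pihomogMr d e p f : f \is d.-homog for mf ->
  pihomog mf e (p * f) = (if (d <= e)%N then pihomog mf (e - d) p * f else 0).
Proof.
move=> homf; rewrite {1}(mpolyE p) mulr_suml raddf_sum /= pihomogE mulr_suml.
have -> : (if (d <= e)%N then \sum_(m <- msupp p | mf m == (e - d)%N) p@_m *: 'X_[m] * f else 0)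
    = \sum_(m <- msupp p) (if (mf m + d == e)%N then p@_m *: 'X_[m] * f else 0).
  case: leqP => de; last first.
    by rewrite big1 // => m _; case: eqP => // h; lia.
  by rewrite big_mkcond; apply: eq_bigr => m _; rewrite -(eqn_add2r d) subnK.
apply: eq_bigr => m _.
have homXf : 'X_[m] * f \is (mf m + d).-homog for mf.
  by apply: dhomogM => //; rewrite dhomogX.
rewrite -scalerAl linearZ /=; case: eqP => [<-|/eqP ne]; first by rewrite pihomog_dE.
by rewrite (pihomog_ne0 ne) // scaler0.
Qed.

Lemma pihomogMl d e p f : f \is d.-homog for mf ->
  pihomog mf e (f * p) = (if (d <= e)%N then f * pihomog mf (e - d) p else 0).
Proof. by move=> homf; rewrite mulrC (pihomogMr _ _ homf); case: ifP => // _; rewrite mulrC. Qed.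

Lemma homogeneous_gen (T : finType) (f : T -> P) (S : {set T}) :
  (forall t, exists d, f t \is d.-homog for mf) -> homogeneous_ideal (ideal_gen f S).
Proof.
move=> homf d p Sp; move: d.
apply: (ideal_gen_sub (J := fun p => forall d, ideal_gen f S (pihomog mf d p)) _ _ Sp).
  have idS := ideal_gen_ideal f S; split=> [e|a b Ja Jb e|a b Jb e].
  - by rewrite raddf0; apply: ideal0.
  - by rewrite raddfD; apply: (idealD idS (Ja e) (Jb e)).
  - have [c ac] := wdeg_le_ex a; rewrite (homog_sum ac) mulr_suml raddf_sum.
    apply: ideal_sum => // i _; rewrite /= (pihomogMl (d := i)) ?pihomogP //.
    by case: ifP => _; [exact: (idealMl idS _ (Jb _)) | exact: ideal0 idS].
move=> t St e; have [dt homt] := homf t; case: (eqVneq dt e) => [<-|ne].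
  by rewrite pihomog_dE //; apply: ideal_gen_mem.
by rewrite (pihomog_ne0 ne) //; apply: ideal0; apply: ideal_gen_ideal.
Qed.

(** With more vectors than generators the coefficient matrix has a nonzero left kernel, which is a
    linear dependence modulo J. *)
Lemma span_independent J (T S : finType) (p : T -> P) (e : S -> P) : is_ideal J ->
  (forall t, exists c : S -> k, J (p t - \sum_s c s *: e s)) ->
  independent_mod J p -> (#|T| <= #|S|)%N.
Proof.
move=> idJ /choice[c cP] indep; rewrite leqNgt; apply/negP => lt.
pose M : 'M[k]_(#|T|, #|S|) := \matrix_(i, j) c (enum_val i) (enum_val j).
have ker0 : kermx M != 0.
  rewrite kermx_eq0 /row_free neq_ltn; apply/orP; left.
  exact: leq_ltn_trans (rank_leq_col M) lt.
have /rowV0Pn[u /sub_kermxP uM u0] := ker0.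
pose a t := u 0 (enum_rank t).
have Ja : J (\sum_t a t *: p t).
  have e0 : \sum_t a t *: (\sum_s c t s *: e s) = 0.
    under eq_bigr do rewrite scaler_sumr.
    rewrite exchange_big /= big1 // => s _.
    under eq_bigr do rewrite scalerA.
    rewrite -scaler_suml (_ : \sum_t _ = (u *m M) 0 (enum_rank s)); last first.
      rewrite mxE (reindex _ (onW_bij _ (@enum_val_bij T))) /=.
      by apply: eq_bigr => j _; rewrite mxE /a enum_valK enum_rankK.
    by rewrite uM mxE scale0r.
  have -> : \sum_t a t *: p t = \sum_t a t *: (p t - \sum_s c t s *: e s).
    by under [RHS]eq_bigr do rewrite scalerBr; rewrite sumrB e0 subr0.
  apply: ideal_sum => // t _; rewrite -mul_mpolyC.
  by apply: idealMl.
case/eqP: u0; apply/rowP => j; rewrite mxE.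
by have := indep a Ja (enum_val j); rewrite /a enum_valK.
Qed.

Lemma leq_expn2r a b q : (a <= b)%N -> (a ^ q <= b ^ q)%N.
Proof. by case: q => // q; rewrite leq_exp2r. Qed.

Lemma exp_bounded C r q : (forall m, m.+1 ^ r <= C * m.+1 ^ q)%N -> (r <= q)%N.
Proof.
move=> bound; rewrite leqNgt; apply/negP => qr; have := bound C.
rewrite -(subnK (ltnW qr)) expnD leq_pmul2r ?expn_gt0 // leqNgt => /negP; apply.
have := @leq_pexp2l C.+1 1 (r - q) isT; rewrite expn1; apply.
by rewrite subn_gt0.
Qed.

(** The (m+1)^r monomials in z with exponents at most m are independent and their degrees are linear
    in m. *)
Lemma alg_independent_growth J q r (z : 'I_r -> P) :
  growth_le J q -> alg_independent_mod J z -> (r <= q)%N.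
Proof.
move=> [C bound] indep.
have /choice[a za] : forall i, exists a, wdeg_le a (z i) by move=> i; apply: wdeg_le_ex.
pose D := (\sum_i a i)%N; apply: (@exp_bounded (C * D.+1 ^ q)) => m.
pose T : finType := {ffun 'I_r -> 'I_m.+1}.
pose p (t : T) := \prod_i z i ^+ t i.
have -> : (m.+1 ^ r)%N = #|T| by rewrite card_ffun !card_ord.
rewrite -mulnA -expnMn; apply: leq_trans (bound (m * D)%N T p _ _) _.
- move=> t; apply: (@wdeg_leW (\sum_i t i * a i)%N).
    by rewrite big_distrr; apply: leq_sum => i _; rewrite leq_mul2r -ltnS ltn_ord orbT.
  by apply: wdeg_le_prod => i; apply: wdeg_leX.
- move=> c Jc t; pose mon (u : T) : 'X_{1..r} := [multinom (u i : nat) | i < r].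
  have mon_inj : injective mon.
    by move=> u v /mnmP uv; apply/ffunP => i; apply: val_inj; have := uv i; rewrite !mnmE.
  have F0 : \sum_u c u *: 'X_[mon u] = 0 :> {mpoly k[r]}.
    apply: indep; rewrite rmorph_sum /=; congr J: Jc; apply: eq_bigr => u _.
    by rewrite substZ substX; congr (_ *: _); apply: eq_bigr => i _; rewrite mnmE.
  have := congr1 (mcoeff (mon t)) F0; rewrite mcoeff0 raddf_sum (bigD1 t) //= big1.
    by rewrite addr0 mcoeffZ mcoeffX eqxx mulr1.
  by move=> u /negPf ut; rewrite mcoeffZ mcoeffX (inj_eq mon_inj) ut mulr0.
- by rewrite leq_mul2l; apply/orP; right; apply: leq_expn2r; lia.
Qed.

(* If p_1, ..., p_H are independent modulo J, then the f^j p_i are independent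
   modulo I. *)
Lemma growth_drop (I J : P -> Prop) f q : is_prime I -> is_ideal J ->
  (forall p, I p -> J p) -> ~ J 1 -> J f -> ~ I f -> growth_le I q ->
  exists2 q', q = q'.+1 & growth_le J q'.
Proof.
move=> prI idJ IJ J1 Jf If [C bound]; have [idI _ prI'] := prI.
have [a fa] := wdeg_le_ex f.
have key m (T : finType) (p : T -> P) : (forall t, wdeg_le m (p t)) ->
    independent_mod J p -> (#|T| * m.+1 <= C * (a.+1 * m.+1) ^ q)%N.
  move=> pm indep; pose pp (u : T * 'I_m.+1) := f ^+ u.2 * p u.1.
  have -> : (#|T| * m.+1)%N = #|{: T * 'I_m.+1}| by rewrite card_prod card_ord.
  have le_exp : ((m * a + m).+1 ^ q <= (a.+1 * m.+1) ^ q)%N.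
    by apply: leq_expn2r; lia.
  apply: leq_trans (leq_mul (leqnn C) le_exp); apply: (bound _ _ pp) => [[t j]|c Ic].
    apply: wdeg_leM; last exact: pm.
    apply: (@wdeg_leW (j * a) (m * a)); last exact: wdeg_leX.
    by rewrite leq_mul2r -ltnS ltn_ord orbT.
  (* Reduction modulo J kills the coefficients of f^0; then f can be divided out, as I is prime and
     does not contain it. *)
  have indI l (c' : nat -> T -> k) : I (\sum_(j < l) f ^+ j * \sum_t c' j t *: p t) ->
      forall j t, (j < l)%N -> c' j t = 0.
    elim: l c' => [//|l IHl] c'; rewrite big_ord_recl expr0 mul1r => Ic'.
    have c0 u : c' 0%N u = 0.
      apply: (indep (c' 0%N)); have /IJ := Ic'.
      rewrite -[X in _ -> J X](addrK (\sum_(i < l) f ^+ lift ord0 i * \sum_t c' (lift ord0 i) t *: p t)).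
      move=> h; apply: idealB => //; apply: ideal_sum => // i _; apply: idealMr => //.
      by rewrite exprS; apply: idealMr.
    case=> [|j] t jl; first exact: c0.
    apply: (IHl (fun j => c' j.+1)) => //; move: Ic'; rewrite [X in X + _]big1; last first.
      by move=> u _; rewrite c0 scale0r.
    rewrite add0r; have -> : \sum_(i < l) f ^+ lift ord0 i * \sum_t c' (lift ord0 i) t *: p t =
        f * \sum_(i < l) f ^+ i * \sum_t c' i.+1 t *: p t.
      by rewrite mulr_sumr; apply: eq_bigr => i _; rewrite mulrA -exprS.
    by case/prI'.
  move=> [t j]; pose c' (i : nat) u := if insub i is Some i' then c (u, i') else 0.
  have := indI m.+1 c' _ j t (ltn_ord j); rewrite {2}/c' valK; apply.
  have ppE : \sum_u c u *: pp u = \sum_u \sum_(i < m.+1) c (u, i) *: pp (u, i).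
    by rewrite pair_bigA; apply: eq_bigr => -[].
  congr I: Ic; rewrite ppE exchange_big.
  apply: eq_bigr => i _; rewrite mulr_sumr; apply: eq_bigr => u _.
  by rewrite /c' valK /pp /= scalerAr.
(* For q = 0, the single element 1 in degree C would give C + 1 <= C. *)
case: q bound key => [|q] bound key.
  have /(key C unit (fun=> 1)) : forall t : unit, wdeg_le C 1.
    by move=> _; rewrite -mpolyC1; apply: wdeg_leC.
  rewrite card_unit mul1n expn0 muln1 ltnn => impossible.
  case: notF; apply: impossible => c; rewrite (bigD1 tt) //= big1 ?addr0 => [Jc []|[]//].
  apply/eqP/contraT => c0; case: J1; have := idealMl idJ ((c tt)^-1%:MP) Jc.
  by rewrite mul_mpolyC scalerA mulVf // scale1r.
exists q => //; exists (C * a.+1 ^ q.+1)%N => m T p pm indep.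
have := key m T p pm indep.
by rewrite expnMn mulnA [X in (_ <= _ * X)%N]expnSr mulnA leq_pmul2r.
Qed.


Lemma finite_colength_radical J p : is_ideal J -> finite_colength J ->
  p@_0%MM = 0 -> radical J p.
Proof.
move=> idJ fcJ p0; have idR := radical_ideal idJ.
rewrite (mpolyE p) big_seq; apply: ideal_sum => // m mp; rewrite -mul_mpolyC.
apply: idealMl => //; have [i mi] : exists i, m i != 0%N.
  case: (pickP [pred i | m i != 0%N]) => [i mi|m0]; first by exists i.
  move: mp; rewrite mcoeff_msupp (_ : m = 0%MM) ?p0 ?eqxx //.
  by apply/mnmP => i; rewrite mnm0E; apply/eqP; move: (m0 i) => /= /negbFE.
have -> : m = (m - U_(i) + U_(i))%MM.
  by rewrite submK //; apply/mnm_lepP => j; rewrite mnm1E; case: eqP => // <-; rewrite lt0n.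
by rewrite mpolyXD; apply: idealMl.
Qed.

Lemma finite_colengthS J K : (forall p, J p -> K p) -> finite_colength J -> finite_colength K.
Proof. by move=> JK fcJ i; apply: radicalS (fcJ i). Qed.

(** The subspace spanned by J and E as an intersection of subspaces, which gives an induction
    principle without coefficients. *)
Definition spanned_mod J (E : P -> Prop) p : Prop := forall W : P -> Prop,
  (forall a, J a -> W a) -> (forall a b, W a -> W b -> W (a + b)) ->
  (forall c a, W a -> W (c *: a)) -> (forall e, E e -> W e) -> W p.

Lemma spanned_modS J (E E' : P -> Prop) p : (forall e, E e -> E' e) ->
  spanned_mod J E p -> spanned_mod J E' p.
Proof. by move=> EE' sp W JW WD WZ EW; apply: sp => // e /EE'; apply: EW. Qed.

Lemma spanned_mod_scale J E c p : spanned_mod J E p -> spanned_mod J E (c *: p).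
Proof. by move=> sp W JW WD WZ EW; apply: (WZ); apply: sp. Qed.

Lemma spanned_mod_sum J E (T : Type) (s : seq T) (Q : pred T) (F : T -> P) :
  is_ideal J -> (forall t, Q t -> spanned_mod J E (F t)) ->
  spanned_mod J E (\sum_(t <- s | Q t) F t).
Proof.
move=> idJ spF W JW WD WZ EW; apply: big_ind => [|//|t Qt]; first by apply: JW; apply: ideal0.
exact: spF.
Qed.

Lemma spanned_mod_fin J (S : finType) (e : S -> P) p : is_ideal J ->
  spanned_mod J (fun a => exists s, a = e s) p ->
  exists c : S -> k, J (p - \sum_s c s *: e s).
Proof.
move=> idJ sp; apply: (sp (fun p => exists c : S -> k, J (p - \sum_s c s *: e s))) => [a Ja|a b [c Ja] [c' Jb]|c a [c' Ja]|_ [s ->]].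
- exists (fun=> 0); rewrite big1 ?subr0 // => s _; exact: scale0r.
- exists (fun s => c s + c' s); under eq_bigr do rewrite scalerDl.
  by rewrite big_split; apply: ideal_congrD.
- exists (fun s => c * c' s); under eq_bigr do rewrite -scalerA.
  by rewrite -scaler_sumr -scalerBr -mul_mpolyC; apply: idealMl.
- exists (fun t => (t == s)%:R); rewrite (bigD1 s) //= eqxx scale1r big1 ?addr0 ?subrr.
    exact: ideal0.
  by move=> t /negPf ->; rewrite scale0r.
Qed.

Section FiniteColengthGrowth.
Variables (J : P -> Prop) (q : nat) (z : 'I_q -> P) (dz : 'I_q -> nat).
Hypotheses (idJ : is_ideal J) (homJ : homogeneous_ideal J).
Hypotheses (dz_gt0 : forall l, (0 < dz l)%N) (hom_z : forall l, z l \is (dz l).-homog for mf).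
Variable M : nat.
Hypothesis XM : forall i, ideal_add J (ideal_gen z [set: 'I_q]) ('X_i ^+ M).

Let E e p : Prop := exists (b : 'I_q -> nat) (g : 'X_{1..n}),
  [/\ forall l, (b l <= e)%N, forall i, (g i < M)%N & p = \prod_l z l ^+ b l * 'X_[g]].

Let E_mul l e e' p : (e < e')%N -> spanned_mod J (E e) p -> spanned_mod J (E e') (p * z l).
Proof.
move=> ee' sp W JW WD WZ EW; apply: (sp (fun a => W (a * z l))) => [a Ja|a b Wa Wb|c a Wa|_ [b [g [bE gM ->]]]].
- by apply: JW; apply: idealMr.
- by rewrite mulrDl; apply: WD.
- by rewrite -scalerAl; apply: WZ.
- apply: EW; exists (fun j => b j + (j == l))%N, g; split=> // [j|].
    by have := bE j; case: (j == l); lia.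
  rewrite mulrAC; congr (_ * _); rewrite [RHS](bigD1 l) //= eqxx addn1 exprSr mulrAC.
  congr (_ * _); rewrite (bigD1 l) //=; congr (_ * _).
  by apply: eq_bigr => j /negPf ->; rewrite addn0.
Qed.

(** Induction on the degree: an exponent at least M allows 'X_i ^+ M to be replaced by an element of
    J plus multiples of the z_l, and the cofactor of z_l has smaller degree. *)
Let homog_spanned e p : p \is e.-homog for mf -> spanned_mod J (E e) p.
Proof.
have [N] := ubnP e; elim: N e p => // N IHN e p eN /dhomogP hom_p.
rewrite (mpolyE p) big_seq; apply: spanned_mod_sum => // m mp.
apply: spanned_mod_scale.
have me := hom_p m mp; have [small|/fintype.forallPn[i]] := boolP [forall i, (m i < M)%N].
  move=> W JW WD WZ EW; apply: EW; exists (fun=> 0%N), m; split=> //.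
    by move=> i; apply: (fintype.forallP small).
  by rewrite big1 ?mul1r.
rewrite -leqNgt => Mm; have [j [_ [Jj [h ->] XE]]] := XM i.
set m' := (m - U_(i) *+ M)%MM.
have mE : 'X_[m] = 'X_[m'] * j + \sum_l 'X_[m'] * h l * z l :> P.
  have -> : m = (m' + U_(i) *+ M)%MM.
    rewrite submK //; apply/mnm_lepP => l; rewrite mulmnE mnm1E.
    by case: eqP => [<-|]; rewrite ?mul1n ?mul0n.
  rewrite mpolyXD -mpolyXn XE mulrDr mulr_sumr; congr (_ + _).
  by apply: eq_big => [l|l _]; rewrite ?inE // mulrA.
have -> : 'X_[m] = pihomog mf e 'X_[m] :> P by rewrite pihomog_dE // dhomogX me.
rewrite mE raddfD raddf_sum => W JW WD WZ EW; apply: (WD).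
  by apply: JW; apply: homJ; apply: idealMl.
suff : spanned_mod J (E e) (\sum_l pihomog mf e ('X_[m'] * h l * z l)) by apply.
apply: spanned_mod_sum => // l _; rewrite (pihomogMr _ _ (hom_z l)).
case: leqP => de; last by move=> W' JW' *; apply: JW'; apply: ideal0.
have := dz_gt0 l => d0; apply: (@E_mul l (e - dz l)); first lia.
by apply: IHN; [lia | apply: pihomogP].
Qed.

Lemma finite_colength_growth_exp : growth_le J q.
Proof.
exists (M ^ n)%N => m T p pm; rewrite mulnC.
pose S : finType := ({ffun 'I_q -> 'I_m.+1} * {ffun 'I_n -> 'I_M})%type.
pose mon (s : S) : P := \prod_l z l ^+ s.1 l * 'X_[[multinom (s.2 i : nat) | i < n]].
have -> : (m.+1 ^ q * M ^ n)%N = #|S| by rewrite card_prod !card_ffun !card_ord.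
apply: (@span_independent J T S p mon idJ) => t; apply: spanned_mod_fin => //.
rewrite (homog_sum (pm t)); apply: spanned_mod_sum => // d _.
apply: spanned_modS (homog_spanned (pihomogP _ _ _)) => _ [b [g [bd gM ->]]].
have bm l : (b l < m.+1)%N by apply: leq_ltn_trans (bd l) (ltn_ord d).
exists ([ffun l => Ordinal (bm l)], [ffun i => Ordinal (gM i)]).
congr (_ * 'X_[_]); first by apply: eq_bigr => l _; rewrite ffunE.
by apply/mnmP => i; rewrite mnmE ffunE.
Qed.

End FiniteColengthGrowth.

Lemma finite_colength_growth J q (z : 'I_q -> P) : is_ideal J -> homogeneous_ideal J ->
  (forall l, exists2 d, (0 < d)%N & z l \is d.-homog for mf) ->
  finite_colength (ideal_add J (ideal_gen z [set: 'I_q])) -> growth_le J q.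
Proof.
move=> idJ homJ hom_z /choice[M XM].
have /choice[dz dzP] : forall l, exists d, (0 < d)%N /\ z l \is d.-homog for mf.
  by move=> l; have [d] := hom_z l; exists d.
apply: (@finite_colength_growth_exp J q z dz idJ homJ _ _ (\sum_i M i)%N) => [l|l|i].
- by have [] := dzP l.
- by have [] := dzP l.
apply: ideal_expr (XM i); first by apply: ideal_add_ideal => //; apply: ideal_gen_ideal.
by rewrite (bigD1 i) //= leq_addr.
Qed.

(* A form F with F(f) in J and F(c) != 0 shows that f_j is nilpotent modulo J
   and the c_j f_i - c_i f_j, which may thus replace the f_i. *)
Lemma noether_normalization J D N (f : 'I_N -> P) : (0 < D)%N ->
  is_ideal J -> homogeneous_ideal J -> ~ J 1 ->
  (forall i, f i \is D.-homog for mf) ->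
  finite_colength (ideal_add J (ideal_gen f [set: 'I_N])) ->
  exists r (z : 'I_r -> P), [/\ forall i, z i \is D.-homog for mf,
    finite_colength (ideal_add J (ideal_gen z [set: 'I_r])) & alg_independent_mod J z].
Proof.
move=> D0 idJ homJ J1; elim: N f => [|N IHN] f hom_f fc.
  exists 0%N, f; split=> // F; rewrite (nvar0_mpolyC F) substC => JF.
  apply/eqP/contraT; rewrite mpolyC_eq0 => F0; case: J1.
  by rewrite -mpolyC1 -(mulVf F0) mpolyCM; apply: idealMl.
have [indep|/existsNP[F /not_implyP[JF /eqP F0]]] := pselect (alg_independent_mod J f).
  by exists N.+1, f.
have homF d : subst f (pihomog mdeg d F) \is (d * D).-homog for mf.
  rewrite substE big_seq; apply: rpred_sum => u up; apply: rpredZ.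
  have /dhomogP/(_ u up) <- := pihomogP mdeg d F; rewrite /= mdegE big_distrl /=.
  elim/big_rec2: _ => [|i x y _ hom_x]; first exact: dhomog1.
  by apply: dhomogM => //; rewrite mulnC; apply: dhomogMn.
(* As all f_i have the same degree D > 0, the components of F become the components of F(f), so J
   contains each of them. *)
have JFd d : J (subst f (pihomog mdeg d F)).
  have -> : subst f (pihomog mdeg d F) = pihomog mf (d * D) (subst f F); last exact: homJ.
  set L := maxn (msize F) d.+1; have dlt : (d < L)%N by rewrite leq_max ltnSn orbT.
  have FE : subst f F = \sum_(e < L) subst f (pihomog mdeg e F).
    by rewrite {1}(@pihomog_partitionE _ _ mdeg L F) ?leq_maxl // rmorph_sum.
  rewrite FE (raddf_sum (pihomog mf (d * D))) [RHS](bigD1 (Ordinal dlt)) //.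
  rewrite /= (pihomog_dE (homF d)) big1 ?addr0 // => e ne.
  have ed : (e : nat) != d by apply: contra ne => /eqP ed; rewrite -val_eqE /= ed.
  by apply: (pihomog_ne0 _ (homF e)); rewrite eqn_pmul2r.
have [d Fd0] : exists d, pihomog mdeg d F != 0.
  apply/not_existsP => Fd0; case/eqP: F0.
  rewrite (@pihomog_partitionE _ _ mdeg (msize F) F) // big1 // => d _.
  by apply/eqP; have /negP := Fd0 d; rewrite negbK.
set G := pihomog mdeg d F in Fd0; have homG : G \is d.-homog by apply: pihomogP.
pose j := @ord_max N; have Xj : 'X_j != 0 :> {mpoly k[N.+1]} by rewrite -msize_poly_eq0 msizeX.
have [c] := mpoly_nonroot (mulf_neq0 Fd0 Xj).
rewrite mevalM mevalXU mulf_eq0 negb_or => /andP[Gc cj].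
pose f' i := c j *: f (lift j i) - c (lift j i) *: f j.
set K := ideal_add J (ideal_gen f' [set: 'I_N]).
have idg := ideal_gen_ideal f' [set: 'I_N]; have idK : is_ideal K by apply: ideal_add_ideal.
have idR := radical_ideal idK.
have Kf i : K (c j *: f i - c i *: f j).
  case: (unliftP j i) => [i'|] ->; last by rewrite subrr; apply: ideal0.
  by apply: ideal_addr => //; apply: (ideal_gen_mem f'); rewrite inE.
have Kfj : K (f j ^+ d).
  (* Modulo K, c_j f_i = c_i f_j; as G is a form, c_j^d G(f) = f_j^d G(c), and the left side is in
     J. *)
  have K1 : K (subst (fun i => f j * (c i)%:MP) G).
    apply: (@ideal_subr _ _ idK (subst (fun i => (c j)%:MP * f i) G)).
      apply: subst_congr => // i; rewrite [f j * _]mulrC !mul_mpolyC; exact: Kf.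
    by rewrite (subst_scale _ _ homG); apply: ideal_addl => //; apply: idealMl => //; apply: JFd.
  rewrite (subst_scale _ _ homG) subst_const in K1.
  have := idealMl idK ((G.@[c])^-1)%:MP K1.
  by rewrite mulrCA -mpolyCM mulVf // mpolyC1 mulr1.
have Rf i : radical K (f i).
  have -> : f i = (c j)^-1%:MP * (c j *: f i - c i *: f j + (c i)%:MP * f j).
    by rewrite !mul_mpolyC subrK scalerA mulVf // scale1r.
  apply: idealMl => //; apply: idealD => //; first by apply: sub_radical.
  by apply: idealMl => //; exists d.
have [] := IHN f'.
- by move=> i; apply: rpredB; apply: rpredZ.
- move=> i; apply: radical_idem; have [M XM] := fc i; exists M.
  apply: (ideal_add_sub idR _ _ XM) => p; first by move=> Jp; apply/sub_radical/ideal_addl.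
  by apply: ideal_gen_sub.
by move=> r [z zP]; exists r, z.
Qed.

End Growth.

(** * Regular sequences *)

Section Kill.
Variables (k : comNzRingType) (n : nat).
Local Notation P := {mpoly k[n]}.
Implicit Types (p : P) (S : {set 'I_n}).

Lemma subst_id p : subst (fun i => 'X_i) p = p.
Proof.
rewrite substE {3}(mpolyE p); apply: eq_bigr => m _.
by rewrite mpolyXE_id.
Qed.

(** The equation [kill S p = p] expresses that p does not involve the variables in S. *)
Definition kill S : {rmorphism P -> P} := subst (fun i => if i \in S then 0 else 'X_i).

Lemma kill_congr S p : ideal_gen (fun i => 'X_i) S (p - kill S p).
Proof.
have idS := ideal_gen_ideal (fun i => 'X_i : P) S.
rewrite -{1}[p]subst_id; apply: subst_congr => // i; case: ifP => iS.
  by rewrite subr0; apply: (ideal_gen_mem (fun i => 'X_i)).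
by rewrite subrr; apply: ideal0.
Qed.

Lemma kill_gen S p : ideal_gen (fun i => 'X_i) S p -> kill S p = 0.
Proof.
move=> [h ->]; rewrite rmorph_sum big1 // => i iS.
by rewrite rmorphM /kill substXU iS mulr0.
Qed.

Lemma kill_kill S S' p : kill S (kill S' p) = kill (S :|: S') p.
Proof.
rewrite /kill subst_comp; congr (subst _ p); apply/funext => i; rewrite inE.
by case: (boolP (i \in S')) => _; rewrite ?rmorph0 ?orbT // substXU orbF.
Qed.

Lemma kill_absorb S S' S'' p : S' \subset S'' :|: S -> kill S p = p ->
  kill S' (kill S'' p) = kill S'' p.
Proof.
move=> sub pE; have E : S' :|: (S'' :|: S) = S'' :|: S by apply/finset.setUidPr.
by rewrite -pE !kill_kill -finset.setUA E.
Qed.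

Lemma killT p : kill [set: 'I_n] p = (p.@[fun=> 0])%:MP.
Proof.
rewrite -subst_const /kill; congr (subst _ p); apply/funext => i.
by rewrite inE mpolyC0.
Qed.

Lemma kill0 p : kill finset.set0 p = p.
Proof.
rewrite -[RHS]subst_id /kill; congr (subst _ p); apply/funext => i.
by rewrite inE.
Qed.

End Kill.

Section Regular.
Variables (k : closedFieldType) (n : nat) (mf : measure n).
Hypothesis mf_gt0 : forall i, (0 < mf U_(i)%MM)%N.
Local Notation P := {mpoly k[n]}.

(** A regular sequence in every order, with no condition that the ideal be proper. *)
Definition strongly_regular (T : finType) (a : T -> P) : Prop :=
  forall (S : {set T}) j, j \notin S -> nonzerodivisor_mod (ideal_gen a S) (a j).

Definition homog_pos (p : P) : Prop := exists2 d, (0 < d)%N & p \is d.-homog for mf.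

Definition upd (T : eqType) (a : T -> P) j e : T -> P := fun i => if i == j then e else a i.

Lemma homog_pos_homog p : homog_pos p -> exists d, p \is d.-homog for mf.
Proof. by case=> d; exists d. Qed.

Lemma homog_pos_coef0 p : homog_pos p -> p@_0%MM = 0.
Proof. by case=> d d0 hom_p; apply: (dhomog_nemf_coeff hom_p); rewrite mf0 eq_sym -lt0n. Qed.

Lemma homog_pos0 : homog_pos 0.
Proof. by exists 1%N => //; apply: dhomog0. Qed.

Lemma coef0_ideal : is_ideal (fun p : P => p@_0%MM = 0).
Proof.
split=> [|a b a0 b0|a b b0]; first exact: mcoeff0.
- by rewrite mcoeffD a0 b0 addr0.
- by rewrite rmorphM /= b0 mulr0.
Qed.

Lemma proper_gen (T : finType) (a : T -> P) (S : {set T}) :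
  (forall i, homog_pos (a i)) -> ~ ideal_gen a S 1.
Proof.
move=> hom_a /(ideal_gen_sub coef0_ideal) h; have := h (fun i _ => homog_pos_coef0 (hom_a i)).
by move/eqP; rewrite mcoeff1 eqxx oner_eq0.
Qed.

Lemma nonzerodivisor_exp (J : P -> Prop) a m u :
  nonzerodivisor_mod J a -> J (a ^+ m * u) -> J u.
Proof.
move=> nzd; elim: m u => [|m IHm] u; first by rewrite mul1r.
by rewrite exprS -mulrA => /nzd/IHm.
Qed.

(** Here I' is I + (a). If c u is in I then u = w a + v with v in I, and cancelling a shows that c w
    is in I, where w has smaller degree; so induction on the degree applies. *)
Lemma nonzerodivisor_descend (I I' : P -> Prop) a c :
  is_ideal I -> homogeneous_ideal mf I -> homog_pos a -> homog_pos c ->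
  nonzerodivisor_mod I a -> (forall p, I p -> I' p) ->
  (forall p, I' p -> exists u v, I v /\ p = u * a + v) ->
  nonzerodivisor_mod I' c -> nonzerodivisor_mod I c.
Proof.
move=> idI homI [da da0 hom_a] [dc dc0 hom_c] nza II' I'E nzc.
have hom_case N e u : (e < N)%N -> u \is e.-homog for mf -> I (c * u) -> I u.
  elim: N e u => // N IHN e u eN hom_u Icu.
  have [w [v [Iv uE]]] := I'E u (nzc u (II' _ Icu)).
  have {}uE : u = pihomog mf e (w * a) + pihomog mf e v by rewrite -(raddfD (pihomog mf e)) -uE /= pihomog_dE.
  have Ive := homI e _ Iv; move: uE; rewrite (pihomogMr _ _ hom_a).
  case: leqP => dae uE; last by rewrite uE add0r.
  rewrite uE; apply: idealD => //; apply: idealMr => //.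
  apply: (IHN (e - da)%N); [have := da0; lia | exact: pihomogP | apply: nza].
  set w' := pihomog mf (e - da) w in uE *.
  have -> : a * (c * w') = c * u - c * pihomog mf e v by rewrite uE; ring.
  by apply: idealB => //; apply: idealMl.
move=> u Icu; have [m um] := wdeg_le_ex mf u; rewrite (homog_sum um).
apply: ideal_sum => // e _; apply: (hom_case e.+1 e) => //; first exact: pihomogP.
by have := homI (dc + e)%N _ Icu; rewrite (pihomogMl _ _ hom_c) leq_addr addKn.
Qed.

Section Exchange.
Variables (T : finType) (a : T -> P) (j : T) (c : P).
Hypotheses (hom_a : forall i, homog_pos (a i)) (hom_c : homog_pos c).
Hypothesis reg_a : strongly_regular a.
Hypothesis rad_aj : radical (ideal_gen (upd a j c) [set: T]) (a j).

Let updN (S : {set T}) p : j \notin S -> ideal_gen (upd a j c) S p <-> ideal_gen a S p.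
Proof.
move=> jS; have eqS : {in S, upd a j c =1 a}.
  by move=> i Si; rewrite /upd; case: eqP => // ij; rewrite -ij Si in jS.
by split; apply: eq_ideal_gen => // i /eqS.
Qed.

Let updE : upd a j c j = c. Proof. by rewrite /upd eqxx. Qed.

(** Modulo the other a_i a power of a_j is a multiple of c, and a_j is not a zero divisor there. *)
Let nzd_c_max : nonzerodivisor_mod (ideal_gen a (~: [set j])) c.
Proof.
have jU : j \notin ~: [set j] by rewrite !inE eqxx.
have idU := ideal_gen_ideal a (~: [set j]).
move=> u cu; case: rad_aj => m; have -> : [set: T] = j |: ~: [set j].
  by apply/setP => i; rewrite !inE orbN.
move=> /ideal_genU1[x [v [/(updN _ jU) Uv ajE]]]; rewrite updE in ajE.
apply: (nonzerodivisor_exp (m := m) (reg_a jU)); rewrite ajE mulrDl -mulrA.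
by apply: idealD => //; [apply: idealMl | apply: idealMr].
Qed.

(** Starting from all indices except j, [nonzerodivisor_descend] removes them one at a time. *)
Let nzd_c (S : {set T}) : j \notin S -> nonzerodivisor_mod (ideal_gen a S) c.
Proof.
have [N] := ubnP #|~: S|; elim: N S => // N IHN S SN jS.
have [l /andP[lS lj]|none] := pickP [pred l | (l \notin S) && (l != j)]; last first.
  suff -> : S = ~: [set j] by apply: nzd_c_max.
  apply/setP => i; rewrite !inE; have /= := none i.
  by case: eqP => [->|_]; [rewrite (negPf jS) | rewrite andbT => /negbFE].
have jlS : j \notin l |: S by rewrite in_setU1 eq_sym negb_or lj.
apply: (@nonzerodivisor_descend _ (ideal_gen a (l |: S)) (a l)) => //.
- exact: ideal_gen_ideal.
- by apply: homogeneous_gen => i; apply: homog_pos_homog.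
- exact: reg_a.
- by move=> p; apply: ideal_genS; apply: finset.subsetU1.
- by move=> p /ideal_genU1.
- apply: IHN => //; apply: leq_trans (SN : (#|~: S| <= N)%N); apply: proper_card.
  by apply/properP; split; [rewrite finset.setCS finset.subsetU1 | exists l; rewrite !inE ?eqxx].
Qed.

(** The new case has c among the moduli S = j |: S'. If a_i u = v c + w, then v = v' a_i + w'
    because c is regular modulo a_i and S'; so a_i (u - c v') is in the ideal of S', where a_i
    cancels. *)
Lemma exchange_regular : strongly_regular (upd a j c).
Proof.
move=> S i iS u; have [jS|jS] := boolP (j \in S); last first.
  case: (eqVneq i j) => [->|ij]; first by rewrite updE => /(updN _ jS)/(nzd_c jS)/(updN _ jS).
  rewrite {2}/upd (negPf ij) => /(updN _ jS) h; apply/(updN _ jS); exact: reg_a h.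
have ij : i != j by apply: contraNneq iS => ->.
pose S' := S :\ j; have SE : S = j |: S' by rewrite finset.setD1K.
have jS' : j \notin S' by rewrite !inE eqxx.
have iS' : i \notin S' by rewrite !inE (negPf iS) andbF.
have jiS' : j \notin i |: S' by rewrite in_setU1 eq_sym (negPf ij).
have idS' := ideal_gen_ideal a S'; have idiS' := ideal_gen_ideal a (i |: S').
rewrite SE {2}/upd (negPf ij) => /ideal_genU1[v [w [/(updN _ jS') S'w auE]]].
rewrite updE in auE.
have iS'w : ideal_gen a (i |: S') w by apply: ideal_genS S'w; apply: finset.subsetU1.
have /(nzd_c jiS')/ideal_genU1[v' [w' [S'w' vE]]] : ideal_gen a (i |: S') (c * v).
  have -> : c * v = a i * u - w by rewrite auE addrK mulrC.
  by apply: idealB => //; apply: idealMr => //; apply: ideal_gen_mem; apply: finset.setU11.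
have /(reg_a iS') S'u : ideal_gen a S' (a i * (u - c * v')).
  have -> : a i * (u - c * v') = c * w' + w by rewrite mulrBr auE vE; ring.
  by apply: idealD => //; apply: idealMl.
have idjS' := ideal_gen_ideal (upd a j c) (j |: S').
apply: (ideal_subl idjS' (b := c * v')).
  by apply: ideal_genS (finset.subsetU1 _ _) _; apply/(updN _ jS').
by apply: idealMr => //; have := ideal_gen_mem (upd a j c) (finset.setU11 j S'); rewrite updE.
Qed.

End Exchange.

Lemma strongly_regular_comp (S T : finType) (a : T -> P) (phi : S -> T) :
  injective phi -> strongly_regular a -> strongly_regular (a \o phi).
Proof.
move=> phi_inj reg_a U j jU u.
have genE p : ideal_gen (a \o phi) U p <-> ideal_gen a (phi @: U) p.
  split; apply: ideal_gen_sub; try exact: ideal_gen_ideal.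
    by move=> i Ui; apply: ideal_gen_mem; apply: imset_f.
  by move=> _ /imsetP[i Ui ->]; apply: (ideal_gen_mem (a \o phi)).
by move=> /genE/reg_a h; apply/genE/h; rewrite mem_imset.
Qed.

Definition hsop (a : 'I_n -> P) : Prop :=
  (forall i, homog_pos (a i)) /\ finite_colength (ideal_gen a [set: 'I_n]).

Lemma vars_homog_pos i : homog_pos 'X_i.
Proof. by exists (mf U_(i)%MM) => //; rewrite dhomogX. Qed.

Lemma vars_hsop : hsop (fun i => 'X_i).
Proof.
split=> [i|i]; first exact: vars_homog_pos.
by apply: sub_radical; apply: (ideal_gen_mem (fun i => 'X_i)); rewrite inE.
Qed.

Lemma vars_regular : strongly_regular (fun i : 'I_n => 'X_i).
Proof.
move=> S j jS u Sju; have : kill k S ('X_j * u) = 0 by apply: kill_gen.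
move=> /eqP; rewrite rmorphM mulf_eq0 {1}/kill substXU (negPf jS).
rewrite (negPf (_ : 'X_j != 0)) /=; last by rewrite -msize_poly_eq0 msizeX.
by move=> /eqP ru; rewrite -[u]subr0 -ru; apply: kill_congr.
Qed.

(** Input for Noether normalization: powers of the variables, all of degree D, the product of the
    weights. *)
Lemma homog_finite_colength (J : P -> Prop) : is_ideal J ->
  exists D (f : 'I_n -> P), [/\ (0 < D)%N, forall i, f i \is D.-homog for mf &
    finite_colength (ideal_add J (ideal_gen f [set: 'I_n]))].
Proof.
move=> idJ; pose D := (\prod_i mf U_(i)%MM)%N.
exists D, (fun i => 'X_i ^+ (D %/ mf U_(i)%MM)); split=> [|i|i]; first exact: prodn_gt0.
  have {2}-> : D = (mf U_(i)%MM * (D %/ mf U_(i)%MM))%N.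
    by rewrite mulnC divnK // /D (bigD1 i) //= dvdn_mulr.
  by apply: dhomogMn; rewrite dhomogX.
exists (D %/ mf U_(i)%MM)%N; apply: ideal_addr => //.
by apply: (ideal_gen_mem (fun i => 'X_i ^+ (D %/ mf U_(i)%MM))); rewrite inE.
Qed.

(* e is found by Noether normalization of the intersection of the ideals
   generated by the a_i and by the b_i with i != j, whose quotients have
   dimension at most one. *)
Lemma hsop_connect a b j : hsop a -> hsop b ->
  exists e, hsop (upd a j e) /\ hsop (upd b j e).
Proof.
move=> [hom_a fc_a] [hom_b fc_b]; pose U := ~: [set j].
pose J p := ideal_gen a U p /\ ideal_gen b U p.
have idJ1 := ideal_gen_ideal a U; have idJ2 := ideal_gen_ideal b U.
have homJ (c : 'I_n -> P) : (forall i, homog_pos (c i)) -> homogeneous_ideal mf (ideal_gen c U).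
  by move=> hom_c; apply: homogeneous_gen => i; apply: homog_pos_homog.
have idJ : is_ideal J.
  by split=> [|p q [? ?] [? ?]|p q [? ?]]; split; [exact: ideal0..|exact: idealD|exact: idealD|exact: idealMl|exact: idealMl].
have homJ' : homogeneous_ideal mf J by move=> d p [h1 h2]; split; apply: homJ.
have J1 : ~ J 1 by move=> [/proper_gen h _]; apply: h.
have [D [f [D0 hom_f fcf]]] := homog_finite_colength idJ.
have [r [z [hom_z fc_z indep_z]]] := noether_normalization D0 idJ homJ' J1 hom_f fcf.
have growth1 (c : 'I_n -> P) : hsop c -> growth_le mf (ideal_gen c U) 1.
  move=> [hom_c fc_c]; apply: (@finite_colength_growth _ _ _ _ 1 (fun=> c j)) => //.
  - exact: ideal_gen_ideal.
  - exact: homJ.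
  - by move=> _; apply: hom_c.
  have idU := ideal_gen_ideal c U; have idj := ideal_gen_ideal (fun _ : 'I_1 => c j) [set: 'I_1].
  apply: (finite_colengthS _ fc_c) => p; apply: ideal_gen_sub; first exact: ideal_add_ideal.
  move=> i _; case: (eqVneq i j) => [->|ij].
    by apply: ideal_addr => //; apply: (ideal_gen_mem (fun _ : 'I_1 => c j) (i := ord0)); rewrite inE.
  by apply: ideal_addl => //; apply: ideal_gen_mem; rewrite !inE.
(* If z satisfied a relation modulo each of the two ideals, the product of these relations would
   hold modulo J. *)
have r1 : (r <= 1)%N.
  have [indep|/existsNP[F1 /not_implyP[JF1 /eqP F10]]] := pselect (alg_independent_mod (ideal_gen a U) z).
    by apply: alg_independent_growth indep; apply: growth1.
  have [indep|/existsNP[F2 /not_implyP[JF2 /eqP F20]]] := pselect (alg_independent_mod (ideal_gen b U) z).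
    by apply: alg_independent_growth indep; apply: growth1.
  case/eqP: (mulf_neq0 F10 F20); apply: indep_z; rewrite rmorphM.
  by split; [apply: idealMr | apply: idealMl].
(* For r = 0 the ideal J itself has finite colength, and e = 0 serves. *)
have [e [hom_e ze]] : exists e, homog_pos e /\ forall i, z i = e.
  case: r z hom_z r1 {fc_z indep_z} => [|[|//]] z hom_z _.
    by exists 0; split; [apply: homog_pos0 | case].
  by exists (z ord0); split; [exists D | move=> i; rewrite (ord1 i)].
have hsop_e (c : 'I_n -> P) : (forall i, homog_pos (c i)) ->
    (forall p, J p -> ideal_gen c U p) -> hsop (upd c j e).
  move=> hom_c Jc; split=> [i|]; first by rewrite /upd; case: eqP.
  have idc := ideal_gen_ideal (upd c j e) [set: 'I_n].
  apply: (finite_colengthS _ fc_z) => p; apply: ideal_add_sub => // {}p.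
    move=> /Jc; apply: ideal_gen_sub => // i; rewrite !inE => ij.
    have <- : upd c j e i = c i by rewrite /upd (negPf ij).
    by apply: ideal_gen_mem; rewrite inE.
  apply: ideal_gen_sub => // i _; rewrite ze.
  have : ideal_gen (upd c j e) [set: 'I_n] (upd c j e j) by apply: ideal_gen_mem; rewrite inE.
  by rewrite {2}/upd eqxx.
by exists e; split; apply: hsop_e => // p [].
Qed.

Lemma hsop_exchange a j c : hsop a -> strongly_regular a -> hsop (upd a j c) ->
  strongly_regular (upd a j c).
Proof.
move=> [hom_a _] reg_a [hom_c fc_c]; apply: exchange_regular => //.
  by have := hom_c j; rewrite /upd eqxx.
by apply: finite_colength_radical => //; [apply: ideal_gen_ideal | apply: homog_pos_coef0].
Qed.

Lemma upd_upd (a : 'I_n -> P) j e e' : upd (upd a j e) j e' = upd a j e'.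
Proof. by apply/funext => i; rewrite /upd; case: eqP. Qed.

Lemma upd_id (a : 'I_n -> P) j : upd a j (a j) = a.
Proof. by apply/funext => i; rewrite /upd; case: eqP => [->|]. Qed.

(** Induction on the number of positions where two systems differ, starting from the variables.
    Putting a common e at position j makes them agree there; regularity passes from b to
    [upd b j e], by induction to [upd c j e], and then to c. *)
Lemma hsop_regular a : hsop a -> strongly_regular a.
Proof.
suff main N b c : (#|[pred i | b i != c i]| < N)%N -> hsop b -> strongly_regular b ->
    hsop c -> strongly_regular c.
  by move=> ha; apply: (main _ _ a (ltnSn _) vars_hsop vars_regular).
elim: N b c => // N IHN b c dN hb reg_b hc.
have [j bcj|none] := pickP [pred i | b i != c i]; last first.
  by have <- : b = c by apply/funext => i; have /negbFE/eqP := none i.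
have [e [hbe hce]] := hsop_connect j hb hc.
have reg_be : strongly_regular (upd b j e) by apply: hsop_exchange.
have reg_ce : strongly_regular (upd c j e).
  apply: IHN reg_be hce => //; apply: leq_trans (dN : (#|[pred i | b i != c i]| <= N)%N); apply: proper_card.
  apply/properP; split; last by exists j => //; rewrite !inE /upd eqxx eqxx.
  by apply/fintype.subsetP => i; rewrite !inE /upd; case: (eqVneq i j) => [->|].
by rewrite -(upd_id c j) -(upd_upd c j e); apply: hsop_exchange; rewrite ?upd_upd ?upd_id.
Qed.

(** A Noether normalization z of P/(f) has at most q elements, so f and z together form a system as
    in [hsop_regular]. *)
Theorem regular_of_growth r q (f : 'I_r -> P) : (r + q)%N = n ->
  (forall i, homog_pos (f i)) ->
  (forall I, is_prime I -> (forall p, ideal_gen f [set: 'I_r] p -> I p) -> growth_le mf I q) ->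
  strongly_regular f.
Proof.
move=> rqn hom_f growthf; pose J := ideal_gen f [set: 'I_r].
have idJ : is_ideal J := ideal_gen_ideal _ _.
have homJ : homogeneous_ideal mf J by apply: homogeneous_gen => i; apply: homog_pos_homog.
have [D [u [D0 hom_u fcu]]] := homog_finite_colength idJ.
have [r' [z [hom_z fc_z indep_z]]] := noether_normalization D0 idJ homJ (proper_gen hom_f) hom_u fcu.
(* Nonzero polynomials in z avoid J, so z stays algebraically independent modulo some prime above J,
   whose growth bounds r'. *)
have r'q : (r' <= q)%N.
  have [|_ _ [F1 [F10 ->]] [F2 [F20 ->]]|p Jp [F [F0 pE]]|I [prI JI IS]] :=
    @exists_prime_disjoint _ J (fun p => exists F, F != 0 /\ p = subst z F) idJ.
  - by exists 1; rewrite oner_neq0 rmorph1.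
  - by exists (F1 * F2); rewrite mulf_neq0 // rmorphM.
  - by case/eqP: F0; apply: indep_z; rewrite -pE.
  apply: (alg_independent_growth (growthf I prI JI) (z := z)) => F IF.
  by apply/eqP/contraT => F0; case: (IS _ IF); exists F.
(* Zeros pad the system to n elements when r' < q. *)
pose a (i : 'I_n) : P := match fintype.split (cast_ord (esym rqn) i) with
  | inl x => f x | inr y => if insub (y : nat) is Some y' then z y' else 0 end.
pose phi (x : 'I_r) : 'I_n := cast_ord rqn (lshift q x).
have phiE x : a (phi x) = f x by rewrite /a /phi cast_ordK (unsplitK (inl x)).
have phi_inj : injective phi by move=> x y /cast_ord_inj/lshift_inj.
suff ha : hsop a.
  have := strongly_regular_comp phi_inj (hsop_regular ha).
  by have -> : a \o phi = f by apply/funext => x; apply: phiE.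
split=> [i|].
  rewrite /a; case: fintype.split => [x|y]; first exact: hom_f.
  by case: insub => [y'|]; [exists D | apply: homog_pos0].
have ida := ideal_gen_ideal a [set: 'I_n].
apply: (finite_colengthS _ fc_z) => p; apply: ideal_add_sub => // {}p.
  by apply: ideal_gen_sub => // x _; rewrite -phiE; apply: ideal_gen_mem; rewrite inE.
apply: ideal_gen_sub => // y _.
have -> : z y = a (cast_ord rqn (rshift r (widen_ord r'q y))).
  by rewrite /a cast_ordK (unsplitK (inr (widen_ord r'q y))) /= valK.
by apply: ideal_gen_mem; rewrite inE.
Qed.

End Regular.

(** * Freeness over a polynomial subring *)

Section Freeness.
Variables (k : closedFieldType) (n : nat) (mf : measure n).
Local Notation P := {mpoly k[n]}.
Variables (R : comPzRingType) (pi : {rmorphism P -> R}).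
Hypothesis pi_surj : forall a, exists p, a = pi p.
Hypothesis hom_ker : homogeneous_ideal mf (fun p => pi p = 0).
Variables (r : nat) (y : 'I_r -> P).
Hypothesis hom_y : forall i, homog_pos mf (y i).
Hypothesis reg_y : forall (S : {set 'I_r}) j, j \notin S ->
  nonzerodivisor_mod (ideal_gen (pi \o y) S) (pi (y j)).

Let K := ideal_gen (pi \o y) [set: 'I_r].
Let idK : is_ideal K. Proof. exact: ideal_gen_ideal. Qed.

Let degree_part e a : Prop := exists2 p, p \is e.-homog for mf & a = pi p.

Let indep (B : set R) : Prop := forall (s : seq R) (c : R -> k), uniq s ->
  (forall b, b \in s -> B b) -> K (\sum_(b <- s) pi (c b)%:MP * b) ->
  forall b, b \in s -> c b = 0.

(** A homogeneous basis of R/(y), as a maximal set of homogeneous elements independent modulo K. *)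
Let max_indep : exists B : set R, [/\ forall b, B b -> exists e, degree_part e b, indep B &
  forall B' : set R, (B `<=` B')%classic -> (forall b, B' b -> exists e, degree_part e b) ->
    indep B' -> (B' `<=` B)%classic].
Proof.
have [F FP Ftot|B [[homB indB] Bmax]] :=
    @Zorn_bigcup R (fun B => (forall b, B b -> exists e, degree_part e b) /\ indep B).
  split=> [b [X FX Xb]|]; first by have [+ _] := FP X FX; apply.
  move=> s c us sF; have [-> //|[X [FX sX]]] : s = [::] \/ exists X, F X /\ forall b, b \in s -> X b.
    elim: s sF {us} => [|b s IHs] sF; [by left | right].
    have [X FX Xb] := sF b (mem_head b s).
    have [s0|[Y [FY sY]]] := IHs (fun x xs => sF x (mem_behead (s := b :: s) xs)).
      by exists X; split=> // x; rewrite s0 inE => /eqP ->.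
    have [XY|YX] := Ftot X Y FX FY.
      by exists Y; split=> // x; rewrite inE => /orP[/eqP ->|/sY//]; apply: XY.
    by exists X; split=> // x; rewrite inE => /orP[/eqP ->//|/sY/YX].
  by have [_ indX] := FP X FX; apply: indX.
exists B; split=> // B' BB' homB' indB'; apply: contrapT => nB'B.
by apply: (Bmax B').
Qed.

Section Basis.
Variables (B : set R) (homB : forall b, B b -> exists e, degree_part e b) (indB : indep B).
Hypothesis maxB : forall B' : set R, (B `<=` B')%classic ->
  (forall b, B' b -> exists e, degree_part e b) -> indep B' -> (B' `<=` B)%classic.

Let span a : Prop := exists (s : seq R) (c : R -> {mpoly k[r]}),
  [/\ uniq s, forall b, b \in s -> B b & a = \sum_(b <- s) pi (subst y (c b)) * b].

Let span0 : span 0.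
Proof. by exists [::], (fun=> 0); rewrite big_nil. Qed.

Let spanB F b : B b -> span (pi (subst y F) * b).
Proof.
move=> Bb; exists [:: b], (fun=> F); rewrite big_seq1; split=> // x.
by rewrite inE => /eqP ->.
Qed.

Let spanM F a : span a -> span (pi (subst y F) * a).
Proof.
move=> [s [c [us sB ->]]]; exists s, (fun b => F * c b); split=> //.
by rewrite mulr_sumr; apply: eq_bigr => b _; rewrite mulrA -!rmorphM.
Qed.

Let extend (s t : seq R) (c : R -> {mpoly k[r]}) : uniq s -> uniq t -> {subset s <= t} ->
  \sum_(b <- s) pi (subst y (c b)) * b =
  \sum_(b <- t) pi (subst y (if b \in s then c b else 0)) * b.
Proof.
move=> us ut st; rewrite [RHS](bigID (mem s)) /= [X in _ + X]big1 ?addr0; last first.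
  by move=> b /negPf ->; rewrite !rmorph0 mul0r.
rewrite -[RHS]big_filter.
have ps : perm_eq s [seq b <- t | b \in s].
  apply: uniq_perm => // [|b]; first exact: filter_uniq.
  by rewrite mem_filter; case: (boolP (b \in s)) => // /st ->.
by rewrite -(perm_big _ ps); apply: eq_big_seq => b ->.
Qed.

Let spanD a b : span a -> span b -> span (a + b).
Proof.
move=> [s [c [us sB ->]]] [t [c' [ut tB ->]]].
pose u := undup (s ++ t); have uu : uniq u by apply: undup_uniq.
have su : {subset s <= u} by move=> x xs; rewrite mem_undup mem_cat xs.
have tu : {subset t <= u} by move=> x xs; rewrite mem_undup mem_cat xs orbT.
exists u, (fun x => (if x \in s then c x else 0) + (if x \in t then c' x else 0)).
split=> // [x|]; first by rewrite mem_undup mem_cat => /orP[/sB|/tB].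
rewrite (extend _ us uu su) (extend _ ut uu tu) -big_split; apply: eq_bigr => x _.
by rewrite !rmorphD mulrDl.
Qed.

Let span_sum (T : Type) (s : seq T) (Q : pred T) (F : T -> R) :
  (forall t, Q t -> span (F t)) -> span (\sum_(t <- s | Q t) F t).
Proof. by move=> spF; apply: big_ind; [apply: span0 | apply: spanD | apply: spF]. Qed.

(* Otherwise B could be enlarged by u. *)
Let homog_mod u e : degree_part e u -> exists (s : seq R) (c : R -> k),
  (forall b, b \in s -> B b) /\ K (u - \sum_(b <- s) pi (c b)%:MP * b).
Proof.
move=> homu; have [Bu|nBu] := pselect (B u).
  exists [:: u], (fun=> 1); split=> [b|]; first by rewrite inE => /eqP ->.
  by rewrite big_seq1 mpolyC1 rmorph1 mul1r subrr; apply: ideal0.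
pose B' b := B b \/ b = u.
have : ~ indep B'.
  move=> indB'; apply: nBu; apply: (maxB (B' := B')) => //; last by right.
    by move=> b; left.
  by move=> b [/homB//|->]; exists e.
move=> /existsNP[s /existsNP[c /not_implyP[us /not_implyP[sB' /not_implyP[Ksum]]]]].
move=> /existsNP[b0 /not_implyP[b0s cb0]].
have [us'|us'] := boolP (u \in s); last first.
  case: cb0; apply: (indB us _ Ksum) => // b bs.
  by have [//|bu] := sB' b bs; rewrite -bu bs in us'.
have remB b : b \in rem u s -> B b.
  by rewrite mem_rem_uniq // inE => /andP[/eqP bu /sB'[]].
have sumE : \sum_(b <- s) pi (c b)%:MP * b =
    pi (c u)%:MP * u + \sum_(b <- rem u s) pi (c b)%:MP * b by rewrite (big_rem u).
have cu : c u != 0.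
  apply/eqP => cu0; apply: cb0; have [->//|b0u] := eqVneq b0 u.
  apply: (indB (rem_uniq u us)) => //; last by rewrite mem_rem_uniq // inE b0u.
  by move: Ksum; rewrite sumE cu0 mpolyC0 rmorph0 mul0r add0r.
exists (rem u s), (fun b => - (c u)^-1 * c b); split=> //.
have -> : u - \sum_(b <- rem u s) pi (- (c u)^-1 * c b)%:MP * b =
    pi ((c u)^-1)%:MP * \sum_(b <- s) pi (c b)%:MP * b.
  rewrite sumE mulrDr mulrA -rmorphM -mpolyCM mulVf // mpolyC1 rmorph1 mul1r.
  rewrite mulr_sumr -sumrN; congr (_ + _); apply: eq_bigr => b _.
  by rewrite mulrA -rmorphM -mpolyCM mulNr mpolyCN rmorphN mulNr opprK.
exact: idealMl.
Qed.

(** Graded Nakayama: modulo constant combinations of B, u is a combination of the y_i whose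
    coefficients have smaller degree. *)
Let span_homog e u : degree_part e u -> span u.
Proof.
have [N] := ubnP e; elim: N e u => // N IHN e u eN homu.
have [s [c [sB [h]]]] := homog_mod homu; have [p hom_p uE] := homu.
(* R carries no grading of its own, so components are compared on lifts to P, where [hom_ker]
   applies. *)
have /choice[lift liftE] : forall b, exists p, B b -> (exists e, p \is e.-homog for mf) /\ b = pi p.
  move=> b; have [/homB[e' [q homq ->]]|nb] := pselect (B b); last by exists 0.
  by exists q => _; split=> //; exists e'.
have /choice[hl hlE] : forall i, exists q, h i = pi q by move=> i; apply: pi_surj.
move=> sumE; have : pi (p - \sum_(b <- s) (c b)%:MP * lift b - \sum_i hl i * y i) = 0.
  rewrite !rmorphB -uE !rmorph_sum /=; apply/eqP; rewrite subr_eq0; apply/eqP.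
  have -> : \sum_(b <- s) pi ((c b)%:MP * lift b) = \sum_(b <- s) pi (c b)%:MP * b.
    by apply: eq_big_seq => b /sB/liftE[_ bE]; rewrite rmorphM -bE.
  by rewrite sumE; apply: eq_big => [i|i _]; rewrite ?inE // rmorphM -hlE.
move=> /(hom_ker e); rewrite !(raddfB (pihomog mf e)) /= (pihomog_dE hom_p) !rmorphB -uE.
move=> /eqP; rewrite subr_eq0 subr_eq => /eqP ->; rewrite !(raddf_sum (pihomog mf e)) /=.
apply: spanD.
  rewrite rmorph_sum; apply: span_sum => i _.
  have [d d0 homd] := hom_y i; rewrite (pihomogMr _ _ homd); case: leqP => de; last by rewrite rmorph0.
  rewrite rmorphM mulrC -(substXU y i); apply: spanM; apply: (IHN (e - d)%N); first lia.
  by exists (pihomog mf (e - d) (hl i)) => //; apply: pihomogP.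
rewrite rmorph_sum big_seq; apply: span_sum => b /sB Bb; have [[d homd] bE] := liftE b Bb.
rewrite mul_mpolyC linearZ /=; have [<-|ne] := eqVneq d e; last first.
  by rewrite (pihomog_ne0 ne) // scaler0 rmorph0.
rewrite pihomog_dE // -mul_mpolyC rmorphM -bE -(substC y); exact: spanB.
Qed.

Let span_all a : span a.
Proof.
have [p ->] := pi_surj a; have [e pe] := wdeg_le_ex mf p.
rewrite (homog_sum pe) rmorph_sum; apply: span_sum => d _.
by apply: (@span_homog d); exists (pihomog mf d p) => //; apply: pihomogP.
Qed.

(* Induction on the variables, dividing by one of them as long as possible. *)
Let independent (T : {set 'I_r}) (s : seq R) (F : R -> {mpoly k[r]}) : uniq s ->
  (forall b, b \in s -> B b) -> (forall b, kill k (~: T) (F b) = F b) ->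
  ideal_gen (pi \o y) (~: T) (\sum_(b <- s) pi (subst y (F b)) * b) ->
  forall b, b \in s -> F b = 0.
Proof.
have [m] := ubnP #|T|; elim: m T F => // m IHm T F Tm us sB.
have [->|[j jT]] := set_0Vmem T.
  rewrite finset.setC0 => FT.
  have FC b : F b = ((F b).@[fun=> 0])%:MP by rewrite -killT FT.
  move=> Fsum b bs; rewrite FC (_ : (F b).@[_] = 0) ?mpolyC0 //.
  apply: (indB (c := fun b => (F b).@[fun=> 0]) us sB) => //.
  congr K: Fsum; apply: eq_bigr => x _; by rewrite {1}FC substC.
pose T' := T :\ j; have TE : ~: T' = j |: ~: T.
  by apply/setP => i; rewrite !inE; case: (i == j).
have T'm : (#|T'| < m)%N by move: Tm; rewrite (cardsD1 j) jT.
have idT := ideal_gen_ideal (pi \o y) (~: T); have idT' := ideal_gen_ideal (pi \o y) (~: T').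
have jC : j \notin ~: T by rewrite !inE jT.
(* The size bound N makes repeated division by 'X_j terminate. *)
have [N] : exists N, forall b, b \in s -> (msize (F b) <= N)%N.
  exists (\sum_(b <- s) msize (F b))%N => b bs; rewrite (bigD1_seq b) //=; exact: leq_addr.
elim: N F => [|N IHN] F FN FT Fsum b bs.
  by apply/eqP; rewrite -msize_poly_eq0 -leqn0 FN.
have /choice[F1 F1E] : forall x, exists G, F x = kill k [set j] (F x) + G * 'X_j.
  move=> x; have [h] := kill_congr [set j] (F x); rewrite big_set1 => hE.
  by exists (h j); rewrite -hE addrC subrK.
(* The parts free of 'X_j satisfy the relation modulo y_j as well, so they vanish by induction on
   T. *)
have F00 x : x \in s -> kill k [set j] (F x) = 0.
  move=> xs; apply: (IHm T' (fun z => kill k [set j] (F z)) T'm us sB _ _ x xs) => [z|].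
    by apply: kill_absorb (FT z); rewrite TE.
  have -> : \sum_(z <- s) pi (subst y (kill k [set j] (F z))) * z =
      \sum_(z <- s) pi (subst y (F z)) * z - \sum_(z <- s) pi (subst y (F1 z)) * z * pi (y j).
    rewrite -sumrB; apply: eq_bigr => z _; rewrite {2}F1E !rmorphD !rmorphM substXU mulrDl.
    by rewrite mulrAC addrK.
  rewrite TE; apply: idealB; first exact: ideal_gen_ideal.
    by apply: ideal_genS Fsum; apply: finset.subsetU1.
  apply: ideal_sum => [|z _]; first exact: ideal_gen_ideal.
  apply: idealMl; first exact: ideal_gen_ideal.
  by apply: (ideal_gen_mem (pi \o y)); apply: finset.setU11.
have FX x : x \in s -> F x = F1 x * 'X_j by move=> /F00 h; rewrite {1}F1E h add0r.
have Xj0 : 'X_j != 0 :> {mpoly k[r]} by rewrite -msize_poly_eq0 msizeX.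
pose G x := if x \in s then F1 x else 0.
have Gs x : x \in s -> G x = F1 x by rewrite /G => ->.
suff G0 : G b = 0 by rewrite (FX b bs) -(Gs b bs) G0 mul0r.
apply: (IHN G _ _ _ b bs) => [x xs|x|].
- rewrite (Gs x xs); have := FN x xs; rewrite (FX x xs); have [->|F10] := eqVneq (F1 x) 0.
    by rewrite msize0.
  by rewrite msizeM // msizeX mdeg1 addn2.
- rewrite /G; case: ifP => xs; last by rewrite rmorph0.
  by have := FT x; rewrite (FX x xs) rmorphM {2}/kill substXU (negPf jC) => /(mulIf Xj0).
(* All coefficients being divisible by 'X_j, the factor y_j of the relation is cancelled. *)
apply: (reg_y jC); rewrite mulr_sumr; congr (ideal_gen _ _): Fsum.
apply: eq_big_seq => x xs; rewrite Gs // FX // !rmorphM substXU.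
by rewrite -mulrA mulrCA.
Qed.

Lemma basis_free : free_over (fun a : R => exists F, a = pi (subst y F)).
Proof.
exists B; split=> [a|s c us sBS csum].
  have [s [c [us sB ->]]] := span_all a; exists s, (fun b => pi (subst y (c b))).
  by split=> // b bs; split; [apply: sB | exists (c b)].
have /choice[F FE] : forall b, exists F, b \in s -> c b = pi (subst y F).
  move=> b; have [bs|nbs] := boolP (b \in s); last by exists 0.
  by have [_ [F FE]] := sBS b bs; exists F.
move=> b bs; rewrite FE // (@independent [set: 'I_r] s F us) ?rmorph0 //.
- by move=> x /sBS[].
- by move=> x; rewrite finset.setCT kill0.
rewrite (eq_big_seq (fun x => c x * x)) => [|x xs]; last by rewrite FE.
by rewrite csum; apply: ideal0; apply: ideal_gen_ideal.
Qed.

End Basis.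

Theorem free_over_regular : free_over (fun a : R => exists F, a = pi (subst y F)).
Proof. by have [B [homB indB maxB]] := max_indep; apply: (basis_free homB). Qed.

End Freeness.

(** * Complete intersections that are generically linear *)

Section Elimination.
Variables (k : closedFieldType) (n R C m : nat).
Local Notation P := {mpoly k[n]}.
Variables (a : 'M[P]_(R, C)) (beta : 'I_C -> 'I_m -> 'I_n) (kap : 'I_R -> 'I_C).
Hypothesis beta_inj : forall x c x' c', beta x c = beta x' c' -> x = x' /\ c = c'.
Hypothesis kap_inj : injective kap.

Definition unknowns : {set 'I_n} := [set beta u.1 u.2 | u : 'I_C * 'I_m].
Hypothesis kill_a : forall i x, kill k unknowns (a i x) = a i x.

(** The unknowns in the columns of the pivot minor, for which Cramer's rule solves. *)
Definition eliminated : {set 'I_n} := [set beta (kap u.1) u.2 | u : 'I_R * 'I_m].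

(** The matrix equation a Y = 0 in the matrix of unknowns Y with m columns, entry by entry. *)
Definition linear_system (u : 'I_R * 'I_m) : P := \sum_x a u.1 x * 'X_(beta x u.2).

Definition pivot : P := \det (colsub kap a).

Local Notation E := eliminated.
Local Notation g := linear_system.

Let rest i c : P := \sum_(x | x \notin kap @: 'I_R) a i x * 'X_(beta x c).
Let num i c : P := - \sum_j (\adj (colsub kap a)) i j * rest j c.

Let gE i c : g (i, c) = \sum_j colsub kap a i j * 'X_(beta (kap j) c) + rest i c.
Proof.
rewrite /linear_system /= (bigID (mem (kap @: 'I_R))) /=; congr (_ + _).
rewrite (big_imset _ (in2W kap_inj)) /=; apply: eq_bigr => j _.
by rewrite mxE.
Qed.

Let cramer i c : \sum_j (\adj (colsub kap a)) i j * g (j, c) =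
  pivot * 'X_(beta (kap i) c) - num i c.
Proof.
rewrite opprK; under eq_bigr do rewrite gE mulrDr; rewrite big_split /=; congr (_ + _).
under eq_bigr do rewrite mulr_sumr; rewrite exchange_big /=.
transitivity (\sum_l (\adj (colsub kap a) *m colsub kap a) i l * 'X_(beta (kap l) c)).
  by apply: eq_bigr => l _; rewrite mxE mulr_suml; apply: eq_bigr => j _; rewrite mulrA.
rewrite mul_adj_mx (bigD1 i) //= mxE eqxx mulr1n big1 ?addr0 // => l /negPf li.
by rewrite mxE eq_sym li mul0r.
Qed.

Let EB : E \subset unknowns.
Proof. by apply/fintype.subsetP => _ /imsetP[[i c] _ ->]; apply/imsetP; exists (kap i, c). Qed.

Let killE_a i x : kill k E (a i x) = a i x.
Proof. by rewrite -[a i x]kill_a kill_kill; have /finset.setUidPr -> := EB. Qed.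

Let map_killE : map_mx (kill k E) (colsub kap a) = colsub kap a.
Proof. by apply/matrixP => i j; rewrite !mxE killE_a. Qed.

Let beta_E x c : x \notin kap @: 'I_R -> beta x c \notin E.
Proof.
apply: contra => /imsetP[[i c'] _ /= /beta_inj[-> _]]; exact: imset_f.
Qed.

Lemma kill_pivot : kill k E pivot = pivot.
Proof. by rewrite /pivot -det_map_mx map_killE. Qed.

Let kill_num i c : kill k E (num i c) = num i c.
Proof.
rewrite /num rmorphN rmorph_sum; congr (- _); apply: eq_bigr => j _.
rewrite rmorphM; congr (_ * _).
  have := map_mx_adj (kill k E) (colsub kap a); rewrite map_killE => /matrixP/(_ i j).
  by rewrite mxE.
rewrite /rest rmorph_sum; apply: eq_bigr => x xK; rewrite rmorphM /= killE_a.
by rewrite /kill substXU (negPf (beta_E c xK)).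
Qed.

(** Cramer's rule, carried out inside the ideal of the equations. *)
Lemma elimination i : i \in E ->
  exists q, kill k E q = q /\ ideal_gen g [set: 'I_R * 'I_m] (pivot * 'X_i - q).
Proof.
move=> /imsetP[[j c] _ ->] /=; exists (num j c); split; first exact: kill_num.
rewrite -cramer; have idg := ideal_gen_ideal g [set: 'I_R * 'I_m].
apply: ideal_sum => // l _; apply: idealMl => //.
by apply: ideal_gen_mem; rewrite inE.
Qed.

Lemma card_eliminated : #|E| = (R * m)%N.
Proof.
rewrite card_in_imset ?cardX ?card_prod ?card_ord // => -[i c] [i' c'] _ _ /= /beta_inj[].
by move=> /kap_inj -> ->.
Qed.

Lemma kill_eval S (p : P) v v' : kill k S p = p ->
  (forall i, i \notin S -> v i = v' i) -> p.@[v] = p.@[v'].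
Proof.
move=> pS vv'; suff E w : p.@[w] = p.@[fun i => if i \in S then 0 else w i].
  by rewrite (E v) (E v'); apply: meval_eq => i; case: ifPn => // /vv'.
rewrite -{1}pS; apply: (mpoly_rmorph_eq (F := meval w \o kill k S) (G := meval _)) => [c|i] /=.
  by rewrite !mevalC /= mmapC mevalC.
by rewrite mmapX mmap1U mevalXU; case: ifP => _; rewrite ?meval0 ?mevalXU.
Qed.

(* Cramer's rule extends any values of the other variables to a zero of the
   system, as soon as the pivot does not vanish. *)
Lemma elimination_dominant (U : P) : pivot != 0 -> kill k E U = U ->
  (forall v, (forall u, (g u).@[v] = 0) -> U.@[v] = 0) -> U = 0.
Proof.
move=> piv0 UE vanish; apply/eqP/contraT => U0.
have [v] := mpoly_nonroot (mulf_neq0 U0 piv0).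
rewrite mevalM mulf_eq0 negb_or => /andP[Uv pv].
have /choice[sol solE] : forall i, exists x, i \in E ->
    exists j c, i = beta (kap j) c /\ x = (pivot.@[v])^-1 * (num j c).@[v].
  move=> i; have [/imsetP[[j c] _ ->]|nE] := boolP (i \in E); last by exists 0.
  by exists ((pivot.@[v])^-1 * (num j c).@[v]) => _; exists j, c.
pose v' i := if i \in E then sol i else v i.
have vv' i : i \notin E -> v i = v' i by rewrite /v' => /negPf ->.
case/eqP: Uv; rewrite (kill_eval UE vv'); apply: vanish => -[i c].
have v'E j : v' (beta (kap j) c) = (pivot.@[v])^-1 * (num j c).@[v].
  have bE : beta (kap j) c \in E by apply/imsetP; exists (j, c).
  by rewrite /v' bE; have [j' [c' [/beta_inj[/kap_inj -> ->] ->]]] := solE _ bE.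
have aE x y : (a x y).@[v'] = (a x y).@[v] by rewrite (kill_eval (killE_a x y) vv').
have restE j : (rest j c).@[v'] = (rest j c).@[v].
  rewrite /rest !raddf_sum; apply: eq_bigr => x xK; rewrite /= !mevalM aE !mevalXU.
  by rewrite -vv' // beta_E.
rewrite gE mevalD restE; apply/eqP; rewrite addr_eq0; apply/eqP.
rewrite raddf_sum /=.
transitivity (\sum_j (pivot.@[v])^-1 * ((colsub kap a i j).@[v] * (num j c).@[v])).
  apply: eq_bigr => j _; rewrite mevalM mevalXU v'E mulrCA; congr (_ * (_ * _)).
  by rewrite mxE aE.
rewrite -mulr_sumr; apply: (mulfI pv); rewrite mulrA mulfV // mul1r mulrN -mevalM -mevalN.
transitivity (\sum_j (colsub kap a i j * num j c)).@[v].
  by rewrite raddf_sum; apply: eq_bigr => j _; rewrite /= mevalM.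
congr (_.@[v]); rewrite /num; under eq_bigr do rewrite mulrN; rewrite sumrN; congr (- _).
under eq_bigr do rewrite mulr_sumr; rewrite exchange_big /=.
transitivity (\sum_l (colsub kap a *m \adj (colsub kap a)) i l * rest l c).
  by apply: eq_bigr => l _; rewrite mxE mulr_suml; apply: eq_bigr => j _; rewrite mulrA.
rewrite mul_mx_adj (bigD1 i) //= mxE eqxx mulr1n big1 ?addr0 // => l /negPf li.
by rewrite mxE eq_sym li mul0r.
Qed.

Lemma homog_pivot (mf : measure n) (e : 'I_C -> nat) :
  (forall i x, a i x \is (e x).-homog for mf) ->
  pivot \is (\sum_i e (kap i)).-homog for mf.
Proof.
move=> hom_a; rewrite /pivot /determinant; apply: rpred_sum => s _.
have hom_prod : \prod_i colsub kap a i (s i) \is (\sum_i e (kap i)).-homog for mf.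
  have -> : (\sum_i e (kap i) = \sum_i e (kap (s i)))%N by rewrite (reindex_inj (@perm_inj _ s)).
  elim/big_rec2: _ => [|i p e' _ hom_p]; first exact: dhomog1.
  by apply: dhomogM => //; rewrite mxE.
by rewrite mulr_sign; case: ifP => _ //; rewrite dhomogN.
Qed.

End Elimination.

(** * The ideal of a generically linear complete intersection *)

Section ReducedCompleteIntersection.
Variables (k : closedFieldType) (n : nat) (mf : measure n).
Hypothesis mf_gt0 : forall i, (0 < mf U_(i)%MM)%N.
Local Notation P := {mpoly k[n]}.
Variables (t : nat) (g : 'I_t -> P) (E : {set 'I_n}) (delta : P).
Hypotheses (hom_g : forall i, homog_pos mf (g i)) (hom_delta : homog_pos mf delta).
Hypotheses (card_E : #|E| = t) (delta0 : delta != 0) (kill_delta : kill k E delta = delta).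

Local Notation G := (ideal_gen g [set: 'I_t]).
Let idG : is_ideal G. Proof. exact: ideal_gen_ideal. Qed.

Hypothesis elim : forall i, i \in E -> exists q, kill k E q = q /\ G (delta * 'X_i - q).
Hypothesis dominant : forall U : P, kill k E U = U ->
  (forall v, (forall i, (g i).@[v] = 0) -> U.@[v] = 0) -> U = 0.

Definition vanishing_ideal (p : P) : Prop :=
  forall v, (forall i, (g i).@[v] = 0) -> p.@[v] = 0.
Local Notation I := vanishing_ideal.
Hypothesis primeI : is_prime I.

Let idI : is_ideal I. Proof. by case: primeI. Qed.

Let GI p : G p -> I p.
Proof. by apply: ideal_gen_sub => // i _ v; apply. Qed.

Let I_delta : ~ I delta.
Proof. by move=> Id; have /eqP := dominant kill_delta Id; apply/negP. Qed.

(** Multiplying by delta once per factor lets each eliminated variable be replaced. The bound on the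
    degree of the result, linear in m, is what the growth estimate needs. *)
Let reduce : exists W, forall m p, wdeg_le mf m p ->
  exists Q, [/\ kill k E Q = Q, wdeg_le mf (m * W) Q & G (delta ^+ m * p - Q)].
Proof.
have /choice[q qP] : forall i, exists q, kill k E q = q /\ G (delta * 'X_i - q).
  move=> i; have [/elim//|iE] := boolP (i \in E); exists (delta * 'X_i).
  rewrite subrr; split; last exact: ideal0.
  by rewrite rmorphM kill_delta /kill substXU (negPf iE).
have /choice[w wP] : forall i, exists w, wdeg_le mf w (q i) by move=> i; apply: wdeg_le_ex.
have [w0 w0P] := wdeg_le_ex mf delta; pose W := (w0 + \sum_i w i)%N.
exists W => m p pm.
suff mon (u : 'X_{1..n}) : (mf u <= m)%N ->
    exists Q, [/\ kill k E Q = Q, wdeg_le mf (m * W) Q & G (delta ^+ m * 'X_[u] - Q)].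
  have /choice[Q QP] : forall u, exists Q, u \in msupp p ->
      [/\ kill k E Q = Q, wdeg_le mf (m * W) Q & G (delta ^+ m * 'X_[u] - Q)].
    move=> u; have [/pm/mon[Q QP]|nu] := boolP (u \in msupp p); last by exists 0.
    by exists Q.
  exists (\sum_(u <- msupp p) p@_u *: Q u); split.
  - rewrite rmorph_sum; apply: eq_big_seq => u /QP[QE _ _].
    by rewrite -mul_mpolyC rmorphM QE /kill substC.
  - rewrite big_seq; apply: big_ind => [||u /QP[_ Qw _]]; first by move=> ?; rewrite msupp0.
      exact: wdeg_leD.
    rewrite -mul_mpolyC -[X in wdeg_le _ X _]add0n; apply: wdeg_leM => //.
    exact: wdeg_leC.
  - rewrite {1}(mpolyE p) mulr_sumr -sumrB big_seq; apply: ideal_sum => // u /QP[_ _ QG].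
    by rewrite -scalerAr -scalerBr -mul_mpolyC; apply: idealMl.
(* As the weights are positive, a monomial of weight at most m has at most m factors. *)
move=> um; have mdeg_u : (mdeg u <= m)%N.
  apply: leq_trans um; rewrite mdegE mfE; apply: leq_sum => i _.
  by rewrite -{1}[u i]muln1 leq_mul2l mf_gt0 orbT.
exists (delta ^+ (m - mdeg u) * \prod_i q i ^+ u i); split.
- rewrite rmorphM rmorphXn kill_delta rmorph_prod; congr (_ * _).
  by apply: eq_bigr => i _; rewrite rmorphXn (proj1 (qP i)).
- apply: (@wdeg_leW _ _ _ ((m - mdeg u) * w0 + \sum_i u i * w i)%N); last first.
    by apply: wdeg_leM; [apply: wdeg_leX | apply: wdeg_le_prod => i; apply: wdeg_leX].
  have : (\sum_i u i * w i <= mdeg u * \sum_i w i)%N.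
    rewrite mdegE big_distrl; apply: leq_sum => i _ /=.
    by rewrite leq_mul2l (bigD1 i) //= leq_addr orbT.
  by have := leq_mul (leq_subr (mdeg u) m) (leqnn w0);
    have := leq_mul mdeg_u (leqnn (\sum_i w i)); rewrite /W mulnDr; lia.
have -> : delta ^+ m * 'X_[u] = delta ^+ (m - mdeg u) * \prod_i (delta * 'X_i) ^+ u i.
  have -> : \prod_i (delta * 'X_i) ^+ u i = delta ^+ mdeg u * 'X_[u].
    rewrite mdegE -prodrXr mpolyXE_id -big_split; apply: eq_bigr => i _.
    by rewrite exprMn.
  by rewrite mulrA -exprD subnK.
rewrite -mulrBr; apply: idealMl => //.
elim/big_rec2: _ => [|i x y _ Gxy]; first by rewrite subrr; apply: ideal0.
by apply: ideal_congrM => //; apply: ideal_congrX => //; apply: (proj2 (qP i)).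
Qed.

(** Multiplication by delta^m is injective modulo I and sends elements of degree at most m into the
    span of monomials in the n - t remaining variables, with exponents at most m W. *)
Lemma growth_vanishing : growth_le mf I (n - t).
Proof.
have [W redW] := reduce; exists (W.+1 ^ (n - t))%N => m T p pm indep.
pose F : finType := {i : 'I_n | i \notin E}.
have card_F : #|F| = (n - t)%N.
  by rewrite card_sig -card_E -[X in (X - _)%N](card_ord n) -(cardsC E) addKn; apply: eq_card => i; rewrite !inE.
pose S : finType := {ffun F -> 'I_(m * W).+1}.
pose ex (s : S) : 'X_{1..n} := [multinom (if insub i is Some j then s j : nat else 0%N) | i < n].
apply: (@leq_trans #|S|); last first.
  by rewrite card_ffun card_F card_ord -expnMn; apply: leq_expn2r; lia.
apply: (@span_independent k n I T S (fun u => delta ^+ m * p u) (fun s => 'X_[ex s]) idI) => [u|c Ic]; last first.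
  apply: indep; apply: (nonzerodivisor_exp (J := I) (a := delta) (m := m)) => [x|].
    by have [_ _ prI] := primeI; move=> /prI[/I_delta//|].
  by rewrite mulr_sumr; under eq_bigr do rewrite -scalerAr.
have [Q [QE Qw /GI QI]] := redW m (p u) (pm u).
apply: spanned_mod_fin => //; rewrite -[X in spanned_mod _ _ X](subrK Q).
move=> Z IZ ZD ZZ eZ; apply: (ZD) => [|]; first exact: IZ.
suff : spanned_mod I (fun x => exists s, x = 'X_[ex s]) Q by apply.
rewrite -QE {1}(mpolyE Q) rmorph_sum big_seq; apply: spanned_mod_sum => // v vQ.
rewrite -mul_mpolyC rmorphM {1}/kill substC mul_mpolyC; apply: spanned_mod_scale.
rewrite /kill substX; have [|] := pickP [pred i | (i \in E) && (v i != 0%N)].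
  move=> i /andP[iE vi]; rewrite (bigD1 i) //= iE expr0n (negPf vi) mul0r => *.
  by move=> Z' IZ' *; apply: IZ'; apply: ideal0.
move=> none Z' _ _ _; apply; have small i : (v i < (m * W).+1)%N.
  rewrite ltnS; apply: leq_trans (Qw v vQ); rewrite mfE (bigD1 i) //=.
  by apply: leq_trans (leq_addr _ _); rewrite leq_pmulr.
exists [ffun j : F => Ordinal (small (val j))]; rewrite mpolyXE_id; apply: eq_bigr => i _.
rewrite mnmE; case: insubP => [j iE <-|]; first by rewrite ffunE (negPf (valP j)).
by rewrite negbK => iE; rewrite iE; have /negbT := none i; rewrite /= iE /= negbK => /eqP ->.
Qed.

(** The reduced form of p vanishes on the zeros of g and has no eliminated variable, so it is 0 by
    [dominant]. *)
Let torsion p : I p -> exists c, G (delta ^+ c * p).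
Proof.
move=> Ip; have [W redW] := reduce; have [m pm] := wdeg_le_ex mf p.
have [Q [QE _ QG]] := redW m p pm; exists m; suff Q0 : Q = 0 by rewrite Q0 subr0 in QG.
apply: dominant => // v gv; have := GI QG gv; rewrite mevalB mevalM (Ip v gv) mulr0 sub0r.
by move=> /eqP; rewrite oppr_eq0 => /eqP.
Qed.

Lemma vanishing_sub_prime (p : P -> Prop) : is_prime p -> (forall f, G f -> p f) ->
  forall f, I f -> p f.
Proof.
move=> prp Gp f If; have [m /Gp] : radical G f; last exact: prime_exp.
apply: nullstellensatz => // v Gv; apply: If => i; apply: Gv.
by apply: ideal_gen_mem; rewrite inE.
Qed.

Definition join_family s (h : 'I_s -> P) (i : 'I_(t + s)) : P :=
  match fintype.split i with inl x => g x | inr y => h y end.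

(** Regularity of g and h jointly, used only for index sets that contain all of g, is regularity of
    h modulo G. *)
Lemma join_regular s (h : 'I_s -> P) q : (t + s + q)%N = n ->
  (forall j, homog_pos mf (h j)) ->
  (forall p, is_prime p -> (forall f, G f -> p f) -> (forall j, p (h j)) -> growth_le mf p q) ->
  forall (S : {set 'I_s}) j, j \notin S ->
    nonzerodivisor_mod (ideal_add G (ideal_gen h S)) (h j).
Proof.
move=> tsq hom_h growth_h S j jS u.
pose f := join_family h; have fl x : f (lshift s x) = g x by rewrite /f /join_family (unsplitK (inl x)).
have fr y : f (rshift t y) = h y by rewrite /f /join_family (unsplitK (inr y)).
have hom_f i : homog_pos mf (f i) by rewrite /f /join_family; case: fintype.split.
have reg_f : strongly_regular f.
  apply: (regular_of_growth mf_gt0 tsq hom_f) => p prp fp; apply: growth_h => // [v|y].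
    apply: ideal_gen_sub => [|x _]; first by case: prp.
    by apply: fp; rewrite -fl; apply: ideal_gen_mem; rewrite inE.
  by apply: fp; rewrite -fr; apply: ideal_gen_mem; rewrite inE.
pose S' : {set 'I_(t + s)} := [set i | match fintype.split i with inl _ => true | inr y => y \in S end].
have S'l x : lshift s x \in S' by rewrite inE (unsplitK (inl x)).
have S'r y : (rshift t y \in S') = (y \in S) by rewrite inE (unsplitK (inr y)).
have idS := ideal_gen_ideal h S; have idS' := ideal_gen_ideal f S'.
have S'E v : ideal_gen f S' v <-> ideal_add G (ideal_gen h S) v.
  split.
    apply: ideal_gen_sub => [|i]; first exact: ideal_add_ideal.
    rewrite /f /join_family inE; case: fintype.split => [x _|y yS].
      by apply: ideal_addl => //; apply: ideal_gen_mem; rewrite inE.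
    by apply: ideal_addr => //; apply: ideal_gen_mem.
  apply: (ideal_add_sub idS') => f'; apply: (ideal_gen_sub idS') => i Si.
    by rewrite -fl; apply: ideal_gen_mem.
  by rewrite -fr; apply: ideal_gen_mem; rewrite S'r.
by move=> /S'E; rewrite -fr => /reg_f h'; apply/S'E/h'; rewrite S'r.
Qed.

(* g and delta form a regular sequence, so that delta is not a zero divisor
   modulo g. *)
Lemma vanishing_ideal_gen p : I p -> G p.
Proof.
have leqt : (t <= n)%N by rewrite -card_E -[X in (_ <= X)%N](card_ord n) max_card.
pose h (_ : 'I_1) := delta.
have drop J : is_prime J -> (forall f, G f -> J f) -> J delta ->
    exists2 q, (n - t)%N = q.+1 & growth_le mf J q.
  move=> prJ GJ Jd; have [idJ J1 _] := prJ.
  by apply: (growth_drop primeI idJ _ J1 Jd I_delta growth_vanishing) => f; apply: vanishing_sub_prime.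
have hom_f i : homog_pos mf (join_family h i) by rewrite /join_family; case: fintype.split.
(* A prime containing g and delta exists since they have no constant terms; it serves to show that n
   - t is positive. *)
have [//|_ _ -> ->|f Jf f1|J [prJ fJ _]] := @exists_prime_disjoint _ (ideal_gen (join_family h)
    [set: 'I_(t + 1)]) (fun f => f = 1) (ideal_gen_ideal _ _).
- by rewrite mulr1.
- by move: Jf; rewrite f1; apply: proper_gen hom_f.
have [q nq _] : exists2 q, (n - t)%N = q.+1 & growth_le mf J q.
  apply: drop => //.
    move=> f; apply: ideal_gen_sub => [|x _]; first by case: prJ.
    apply: fJ; have -> : g x = join_family h (lshift 1 x) by rewrite /join_family (unsplitK (inl x)).
    by apply: ideal_gen_mem; rewrite inE.
  apply: fJ; have {1}-> : delta = join_family h (rshift t ord0) by rewrite /join_family (unsplitK (inr _)).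
  by apply: ideal_gen_mem; rewrite inE.
have reg : nonzerodivisor_mod (ideal_add G (ideal_gen h finset.set0)) delta.
  apply: (@join_regular 1 h q) (ord0) _ => //; [lia | | by rewrite inE].
  by move=> J' prJ' GJ' hJ'; have [q' nq' gr] := drop J' prJ' GJ' (hJ' ord0); have -> : q = q' by lia.
have G0 f : ideal_add G (ideal_gen h finset.set0) f <-> G f.
  split; last by apply: ideal_addl; apply: ideal_gen_ideal.
  by apply: ideal_add_sub => // f' [h' ->]; rewrite big_set0; apply: ideal0.
move=> /torsion[c Gc]; apply/G0; apply: (nonzerodivisor_exp (m := c) reg).
exact/G0.
Qed.

End ReducedCompleteIntersection.

(** * The relations of a canonical algebra *)

Section WeightedMeasure.
Variables (n : nat) (w : 'I_n -> nat).

Definition weighted (m : 'X_{1..n}) : nat := (\sum_i m i * w i)%N.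

Fact weighted0 : weighted 0%MM = 0%N.
Proof. by rewrite /weighted big1 // => i _; rewrite mnm0E. Qed.

Fact weightedD : {morph weighted : m1 m2 / (m1 + m2)%MM >-> (m1 + m2)%N}.
Proof.
move=> m1 m2; rewrite /weighted -big_split; apply: eq_bigr => i _.
by rewrite mnmDE mulnDl.
Qed.

HB.instance Definition _ := isMeasure.Build n weighted weighted0 weightedD.

Lemma weighted1 i : weighted U_(i)%MM = w i.
Proof.
rewrite /weighted (bigD1 i) //= mnm1E eqxx mul1n big1 ?addn0 // => j /negPf ji.
by rewrite mnm1E eq_sym ji.
Qed.

End WeightedMeasure.

Section Relations.
Variables (k : closedFieldType) (L : canonicalData k) (d : dimvec L).
Local Notation N := #|Defs.coord d|.
Local Notation P := {mpoly k[N]}.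

Lemma len_gt0 (i : 'I_(arms L)) : (0 < len i)%N.
Proof. by have := len_gt1 i; lia. Qed.

Section GenericPaths.
Variable A : comNzRingType.
Implicit Type M : forall a : arrow L, 'M[A]_(d (tgt a), d (src a)).

(** [arm_map] and [arm_path] are repeated over any commutative ring so that they apply to the
    matrices of coordinate functions. *)
Definition generic_map M (i : 'I_(arms L)) (j : nat) :
    'M[A]_(d (arm_vertex i j), d (arm_vertex i j.+1)) :=
  if @idP (j < len i)%N is ReflectT lt_j then
    M (Tagged (fun i : 'I_(arms L) => 'I_(len i)) (Ordinal lt_j))
  else 0.

Fixpoint generic_path M (i : 'I_(arms L)) (j : nat) :
    'M[A]_(d (vertex0 L), d (arm_vertex i j)) :=
  if j is j'.+1 then generic_path M i j' *m generic_map M i j' else 1%:M.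

Definition arrow_at (i : 'I_(arms L)) (j : nat) (lt_j : (j < len i)%N) : arrow L :=
  Tagged (fun i : 'I_(arms L) => 'I_(len i)) (Ordinal lt_j).

Lemma generic_mapE M i j (lt_j : (j < len i)%N) : generic_map M i j = M (arrow_at lt_j).
Proof.
rewrite /generic_map; case: {-}_ / idP => [lt_j'|//].
by rewrite (eq_irrelevance lt_j' lt_j).
Qed.

Lemma generic_map_out M i j : ~ (j < len i)%N -> generic_map M i j = 0.
Proof. by rewrite /generic_map; case: {-}_ / idP. Qed.

End GenericPaths.

Lemma generic_path_rep (M : rep d) i j : generic_path M i j = arm_path M i j.
Proof. by []. Qed.

Lemma generic_path_map (A B : comNzRingType) (f : {rmorphism A -> B})
    (M : forall a : arrow L, 'M[A]_(d (tgt a), d (src a)))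
    (M' : forall a : arrow L, 'M[B]_(d (tgt a), d (src a))) i j :
  (forall j' (lt_j : (j' < len i)%N), (j' < j)%N ->
     M' (arrow_at lt_j) = map_mx f (M (arrow_at lt_j))) ->
  generic_path M' i j = map_mx f (generic_path M i j).
Proof.
elim: j => [|j IHj] MM' /=; first by rewrite map_mx1.
rewrite map_mxM IHj => [|j' lt_j jj']; last by apply: MM'; apply: leqW.
congr (_ *m _); have [lt_j|nlt] := pselect (j < len i)%N.
  by rewrite !(generic_mapE _ lt_j) MM'.
by rewrite !generic_map_out // map_mx0.
Qed.

Definition coord_index (a : arrow L) (r : 'I_(d (tgt a))) (c : 'I_(d (src a))) : 'I_N :=
  enum_rank (Tagged (fun a : arrow L => ('I_(d (tgt a)) * 'I_(d (src a)))%type) (r, c)).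

Definition generic_rep (a : arrow L) : 'M[P]_(d (tgt a), d (src a)) :=
  \matrix_(r, c) 'X_(coord_index r c).

Definition rep_of (v : 'I_N -> k) : rep d := fun a => \matrix_(r, c) v (coord_index r c).

Lemma coordsE (M : rep d) a r c : coords M (@coord_index a r c) = M a r c.
Proof. by rewrite /coords /coord_index enum_rankK. Qed.

Lemma coords_rep_of v : coords (rep_of v) = v.
Proof.
apply/funext => i; rewrite /coords /rep_of mxE /coord_index.
by rewrite -[RHS](congr1 v (enum_valK i)); congr (v (enum_rank _)); case: (enum_val i) => a [].
Qed.

Lemma rep_of_coords M : rep_of (coords M) = M.
Proof.
apply: functional_extensionality_dep => a; apply/matrixP => r c.
by rewrite mxE coordsE.
Qed.

Lemma map_generic_rep (M : rep d) a : map_mx (meval (coords M)) (generic_rep a) = M a.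
Proof. by apply/matrixP => r c; rewrite !mxE mevalXU coordsE. Qed.

Lemma eval_generic_path (M : rep d) i j :
  map_mx (meval (coords M)) (generic_path generic_rep i j) = arm_path M i j.
Proof.
rewrite -generic_path_rep -(generic_path_map (M' := M)) // => j' lt_j _.
by rewrite map_generic_rep.
Qed.

Lemma last_lt (i : 'I_(arms L)) : ((len i).-1 < len i)%N.
Proof. by rewrite prednK // len_gt0. Qed.

Definition last_arrow (i : 'I_(arms L)) : arrow L := arrow_at (last_lt i).

Lemma last_src (i : 'I_(arms L)) : src (last_arrow i) = vertex_oo L.
Proof. by rewrite -[src _]/(arm_vertex i (len i).-1.+1) prednK ?len_gt0 // arm_vertex_len. Qed.

Lemma full_pathE (M : rep d) i r c : full_path M i r c =
  \sum_(t : 'I_(d (tgt (last_arrow i))))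
    arm_path M i (len i).-1 r t * M (last_arrow i) t (cast_ord (congr1 d (esym (last_src i))) c).
Proof.
(* The length is generalized to l so that the casts disappear on substitution. *)
have key l (e : arm_vertex i l = vertex_oo L) j (jl : j.+1 = l) (lt_j : (j < len i)%N)
    (es : src (arrow_at lt_j) = vertex_oo L) :
    castmx (erefl, congr1 d e) (arm_path M i l) r c =
    \sum_(t : 'I_(d (tgt (arrow_at lt_j))))
      arm_path M i j r t * M (arrow_at lt_j) t (cast_ord (congr1 d (esym es)) c).
  subst l; rewrite castmxE /= mxE; apply: eq_bigr => t _; rewrite cast_ord_id.
  congr (_ * _); have := generic_mapE M lt_j; rewrite /generic_map -/(arm_map M i j) => ->.
  by congr (M _ _ _); apply: val_inj.
exact: (key (len i) (arm_vertex_len i) (len i).-1 (prednK (len_gt0 i)) (last_lt i) (last_src i)).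
Qed.

Definition row_index : finType := ({i : 'I_(arms L) | (2 <= i)%N} * 'I_(d (vertex0 L)))%type.
Definition col_index : finType := {i : 'I_(arms L) & 'I_(d (tgt (last_arrow i)))}.

Definition relation_coef (i i' : 'I_(arms L)) : k :=
  (i' == arm1 L)%:R + lam i * (i' == arm2 L)%:R - (i' == i)%:R.

Lemma relation_coefE (i : 'I_(arms L)) (F : 'I_(arms L) -> k) :
  \sum_i' relation_coef i i' * F i' = F (arm1 L) + lam i * F (arm2 L) - F i.
Proof.
have pick j : \sum_(i' : 'I_(arms L)) (i' == j)%:R * F i' = F j.
  by rewrite (bigD1 j) //= eqxx mul1r big1 ?addr0 // => l /negPf ->; rewrite mul0r.
under eq_bigr do rewrite /relation_coef mulrBl mulrDl -mulrA.
by rewrite sumrB big_split /= -mulr_sumr !pick.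
Qed.

(** The relations as a linear system in the rows of the last arrows, the products of the other
    arrows of the arms being the coefficients. *)
Definition rel_matrix : 'M[P]_(#|row_index|, #|col_index|) :=
  \matrix_(x, y) let: (i, r) := enum_val x in let: existT i' t := enum_val y in
    relation_coef (val i) i' *: generic_path generic_rep i' (len i').-1 r t.

Definition rel_var (y : 'I_#|col_index|) (c : 'I_(d (vertex_oo L))) : 'I_N :=
  let: existT i t := enum_val y in
  @coord_index (last_arrow i) t (cast_ord (congr1 d (esym (last_src i))) c).

Definition relation := linear_system rel_matrix rel_var.

Lemma coord_index_inj a a' r c r' c' : @coord_index a r c = @coord_index a' r' c' ->
  Tagged (fun a : arrow L => ('I_(d (tgt a)) * 'I_(d (src a)))%type) (r, c) =
  Tagged (fun a : arrow L => ('I_(d (tgt a)) * 'I_(d (src a)))%type) (r', c').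
Proof. exact: enum_rank_inj. Qed.

Lemma rel_var_inj y c y' c' : rel_var y c = rel_var y' c' -> y = y' /\ c = c'.
Proof.
rewrite /rel_var; case Ey: (enum_val y) => [i t]; case Ey': (enum_val y') => [i' t'].
move=> /coord_index_inj E; have /= ii' := congr1 (fun u => tag (tag u)) E.
subst i'; move/eqP: E; rewrite eq_Tagged => /eqP E.
split; last exact: cast_ord_inj (congr1 snd E).
by apply: enum_val_inj; rewrite Ey Ey' (congr1 fst E : t = t').
Qed.

Lemma kill_rel_matrix x y : kill k (unknowns rel_var) (rel_matrix x y) = rel_matrix x y.
Proof.
rewrite mxE; case: (enum_val x) => i r; case: (enum_val y) => i' t.
rewrite -mul_mpolyC rmorphM {1}/kill substC; congr (_ * _).
have := @generic_path_map _ _ (kill k (unknowns rel_var)) generic_rep generic_rep i' (len i').-1.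
move=> fixed; have /fixed/matrixP/(_ r t) : forall j' (lt_j : (j' < len i')%N), (j' < (len i').-1)%N ->
    generic_rep (arrow_at lt_j) = map_mx (kill k (unknowns rel_var)) (generic_rep (arrow_at lt_j)).
  move=> j lt_j jl; apply/matrixP => r' c'; rewrite !mxE /kill substXU ifN //.
  apply/imsetP => -[[y' c''] _ /=]; rewrite /rel_var; case: (enum_val y') => i'' t'.
  move=> /coord_index_inj E; have /= E' := congr1 tag E.
  have ii := congr1 (fun u => tag u) E'; rewrite /= in ii; subst i''.
  by move/eqP: E'; rewrite eq_Tagged => /eqP /(congr1 val) /= jE; rewrite jE ltnn in jl.
by rewrite [RHS]mxE.
Qed.

Lemma eval_relation (M : rep d) x c : (relation (x, c)).@[coords M] =
  let: (i, r) := enum_val x in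
  (full_path M (arm1 L) + lam (val i) *: full_path M (arm2 L) - full_path M (val i)) r c.
Proof.
rewrite /relation /linear_system /=; case Ex: (enum_val x) => [i r].
rewrite !mxE -(relation_coefE (val i) (fun i' => full_path M i' r c)) raddf_sum /=.
pose F i' (t : 'I_(d (tgt (last_arrow i')))) := relation_coef (val i) i' *
  (arm_path M i' (len i').-1 r t *
   M (last_arrow i') t (cast_ord (congr1 d (esym (last_src i'))) c)).
transitivity (\sum_i' \sum_t F i' t).
  rewrite (sig_big_dep xpredT (fun _ => xpredT) F) /= (reindex _ (onW_bij _ (@enum_val_bij col_index))) /=; apply: eq_bigr => y _.
  rewrite mevalM mevalXU mxE Ex /rel_var /F; case: (enum_val y) => i' t /=.
  by rewrite mevalZ coordsE -mulrA -eval_generic_path mxE.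
apply: eq_bigr => i' _.
by rewrite /F -mulr_sumr full_pathE.
Qed.

Lemma module_varietyE (M : rep d) : module_variety M <-> forall u, (relation u).@[coords M] = 0.
Proof.
split=> [relM [x c]|rel0 i i2].
  by rewrite eval_relation; case: (enum_val x) => i r; rewrite relM ?mxE // (valP i).
apply/matrixP => r c; pose i' : {i : 'I_(arms L) | (2 <= i)%N} := Sub i i2.
have := rel0 (enum_rank ((i', r) : row_index), c).
by rewrite eval_relation enum_rankK => ->; rewrite mxE.
Qed.

Lemma module_variety0 : @module_variety k L d (rep_of (fun=> 0)).
Proof.
apply/module_varietyE => -[x c]; rewrite eval_relation; case: (enum_val x) => i r.
have full0 i' : full_path (rep_of (fun=> 0)) i' = 0.
  apply/matrixP => r' c'; rewrite full_pathE mxE big1 // => t _.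
  by rewrite [rep_of _ _ _ _]mxE mulr0.
by rewrite !full0 scaler0 addr0 subr0 mxE.
Qed.

Definition grading_deg : nat := (\prod_(i < arms L) len i)%N.
Definition arm_weight (i : 'I_(arms L)) : nat := grading_deg %/ len i.

Lemma arm_weight_mul i : (len i * arm_weight i)%N = grading_deg.
Proof. by rewrite mulnC divnK // /grading_deg (bigD1 i) //= dvdn_mulr. Qed.

Lemma arm_weight_gt0 i : (0 < arm_weight i)%N.
Proof.
have : (0 < grading_deg)%N by apply: prodn_gt0 => i'; apply: len_gt0.
by rewrite -(arm_weight_mul i) muln_gt0 => /andP[].
Qed.

Definition coord_weight (x : 'I_N) : nat := arm_weight (tag (tag (enum_val x))).

Definition grading : measure N := weighted coord_weight.

Lemma grading_gt0 x : (0 < grading U_(x)%MM)%N.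
Proof. by rewrite /grading /= weighted1 arm_weight_gt0. Qed.

Lemma homog_coord a r c : ('X_(@coord_index a r c) : P) \is (arm_weight (tag a)).-homog for grading.
Proof. by rewrite dhomogX /= weighted1 /coord_weight /coord_index enum_rankK. Qed.

Lemma homog_generic_path i j r c :
  generic_path generic_rep i j r c \is (j * arm_weight i)%N.-homog for grading.
Proof.
elim: j c => [|j IHj] c /=.
  by rewrite mxE; case: (r == c); [rewrite mul0n; apply: dhomog1 | apply: dhomog0].
rewrite mxE; apply: rpred_sum => t _; rewrite mulSnr; apply: dhomogM; first exact: IHj.
have [lt_j|nlt] := pselect (j < len i)%N; last by rewrite generic_map_out // mxE; apply: dhomog0.
by rewrite (generic_mapE _ lt_j) mxE; apply: homog_coord.
Qed.

Definition col_degree (y : 'I_#|col_index|) : nat :=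
  let i := tag (enum_val y) in ((len i).-1 * arm_weight i)%N.

Lemma homog_rel_matrix x y : rel_matrix x y \is (col_degree y).-homog for grading.
Proof.
rewrite mxE /col_degree; case: (enum_val x) => i r; case: (enum_val y) => i' t /=.
by apply: rpredZ; apply: homog_generic_path.
Qed.

Lemma col_degree_gt0 y : (0 < col_degree y)%N.
Proof.
rewrite /col_degree muln_gt0 arm_weight_gt0 andbT.
by have := len_gt1 (tag (enum_val y)); lia.
Qed.

Lemma homog_relation u : homog_pos grading (relation u).
Proof.
exists grading_deg; first by apply: prodn_gt0 => i; apply: len_gt0.
rewrite /relation /linear_system; apply: rpred_sum => y _.
have -> : grading_deg = (col_degree y + arm_weight (tag (enum_val y)))%N.
  rewrite /col_degree -mulSnr prednK ?len_gt0 //; exact/esym/arm_weight_mul.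
apply: dhomogM; first exact: homog_rel_matrix.
by rewrite /rel_var; case: (enum_val y) => i t /=; apply: homog_coord.
Qed.


(** * A representation at which the linear system has full rank *)

Section SpecialPoint.
Variable S : 'I_(arms L) -> {set 'I_(d (vertex0 L))}.
Hypothesis disjoint_S : forall i i' x, x \in S i -> x \in S i' -> i = i'.
Hypothesis dim_S : forall (i : 'I_(arms L)) j, (0 < j < len i)%N ->
  (#|~: S i| <= d (arm_vertex i j))%N.

Let l i : seq nat := [seq val x | x <- enum (~: S i)].

Let size_l i : size (l i) = #|~: S i|.
Proof. by rewrite size_map -cardE. Qed.

Let mem_l i (x : 'I_(d (vertex0 L))) : ((x : nat) \in l i) = (x \notin S i).
Proof. by rewrite mem_map ?mem_enum ?inE //; apply: val_inj. Qed.

(* The cokernel of the product of all the arrows of arm i but the last is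
   supported on S i. *)
Let special_rep : rep d := fun a => \matrix_(r, c)
  (if tagged a == 0%N :> nat then ((r : nat) \in l (tag a)) && (index (r : nat) (l (tag a)) == c)
   else (r == c :> nat))%:R.

Let special_path i j r c : (0 < j < len i)%N ->
  arm_path special_rep i j r c = (((r : nat) \in l i) && (index (r : nat) (l i) == c))%:R.
Proof.
elim: j c => // -[|j] IHj c /andP[_ jl].
  have l0 : (0 < len i)%N by apply: ltnW.
  by rewrite -generic_path_rep /= mul1mx (generic_mapE _ l0) mxE.
have jl' : (j.+1 < len i)%N by apply: ltnW.
have jl2 : (0 < j.+1 < len i)%N by rewrite jl'.
rewrite -[LHS]/((arm_path special_rep i j.+1 *m generic_map special_rep i j.+1) r c).
rewrite mxE (generic_mapE _ jl').
have small : ((r : nat) \in l i) -> (index (r : nat) (l i) < d (arm_vertex i j.+1))%N.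
  by move=> rl; apply: leq_trans (dim_S (i := i) (j := j.+1) jl'); rewrite -size_l index_mem.
have [rl|rl] := boolP ((r : nat) \in l i); last first.
  rewrite big1 // => t _; rewrite (IHj _ jl2).
  by rewrite (negPf rl) mul0r.
rewrite (bigD1 (Ordinal (small rl))) //= (IHj _ jl2) rl eqxx mul1r mxE /= big1 ?addr0 // => t ne.
rewrite (IHj _ jl2) rl; case: eqP => [e|]; last by rewrite mul0r.
by case/eqP: ne; apply: val_inj.
Qed.

(** The columns of arm i' say that the combination of the U_i with coefficients [relation_coef]
    vanishes off S i'. For an arm i >= 2 this puts the support of U_i in S i; at r in S i, the first
    arm then gives U_i r = 0, as the sets are disjoint. *)
Let special_kernel (U : {i : 'I_(arms L) | (2 <= i)%N} -> 'I_(d (vertex0 L)) -> k) :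
  (forall i' (t : 'I_(d (tgt (last_arrow i')))), \sum_i \sum_r
     U i r * (relation_coef (val i) i' * arm_path special_rep i' (len i').-1 r t) = 0) ->
  forall i r, U i r = 0.
Proof.
move=> ker; have pick i' r : r \notin S i' -> \sum_i U i r * relation_coef (val i) i' = 0.
  move=> rS; have li : (0 < (len i').-1 < len i')%N by have := len_gt1 i'; lia.
  have lt_t : (index (r : nat) (l i') < d (tgt (last_arrow i')))%N.
    by apply: leq_trans (dim_S li); rewrite -size_l index_mem mem_l.
  apply: etrans (ker i' (Ordinal lt_t)); apply: eq_bigr => i _.
  rewrite (bigD1 r) //= special_path // mem_l rS eqxx mulr1 big1 ?addr0 // => r' r'r.
  rewrite special_path //; case: andP => [[r'l /eqP e]|]; last by rewrite !mulr0.
  have rl : (r : nat) \in l i' by rewrite mem_l.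
  by case/eqP: r'r; apply: val_inj; apply: (index_inj 0%N r'l rl e).
have vanish i r : r \notin S (val i) -> U i r = 0.
  move=> /pick; rewrite (bigD1 i) //= big1 ?addr0 => [|i' i'i].
    rewrite /relation_coef eqxx.
    have -> : (val i == arm1 L) = false by apply/negbTE/eqP => e; have := valP i; rewrite e.
    have -> : (val i == arm2 L) = false by apply/negbTE/eqP => e; have := valP i; rewrite e.
    by rewrite mulr0 addr0 sub0r mulrN1 => /eqP; rewrite oppr_eq0 => /eqP.
  rewrite /relation_coef.
  have -> : (val i == arm1 L) = false by apply/negbTE/eqP => e; have := valP i; rewrite e.
  have -> : (val i == arm2 L) = false by apply/negbTE/eqP => e; have := valP i; rewrite e.
  by rewrite eq_sym val_eqE (negPf i'i) !mulr0 addr0 subr0 mulr0.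
move=> i r; have [rS|/vanish//] := boolP (r \in S (val i)).
have arm1i (i' : {i : 'I_(arms L) | (2 <= i)%N}) : (arm1 L == val i') = false.
  by apply/negbTE/eqP => e; have := valP i'; rewrite -e.
have : r \notin S (arm1 L).
  by apply/negP => rS1; have := arm1i i; rewrite (disjoint_S rS1 rS) eqxx.
move=> /pick; rewrite (bigD1 i) //= big1 ?addr0 => [|i' i'i].
  by rewrite /relation_coef eqxx arm1i mulr0 addr0 subr0 mulr1.
rewrite vanish ?mul0r //; apply/negP => rS'; case/eqP: i'i; apply: val_inj.
exact: disjoint_S rS' rS.
Qed.

(** At the special representation the rows are independent, so some maximal minor is nonzero
    there. *)
Lemma pivot_neq0 : exists kap : 'I_#|row_index| -> 'I_#|col_index|,
  injective kap /\ pivot rel_matrix kap != 0.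
Proof.
pose v := coords special_rep; pose Mv := map_mx (meval v) rel_matrix.
have free_Mv : row_free Mv.
  rewrite -kermx_eq0; apply/rowV0P => u /sub_kermxP uM; apply/rowP => x; rewrite mxE.
  rewrite -[x]enum_valK; case: (enum_val x) => i r.
  apply: (special_kernel (U := fun i r => u 0 (enum_rank ((i, r) : row_index)))) => i' t.
  pose y : 'I_#|col_index| := enum_rank (Tagged (fun i => 'I_(d (tgt (last_arrow i)))) t : col_index).
  have uMy : (u *m Mv) 0 y = 0 by rewrite uM mxE.
  apply: etrans uMy; rewrite mxE pair_bigA /=.
  rewrite [RHS](reindex _ (onW_bij _ (@enum_rank_bij row_index))) /=; apply: eq_bigr => -[i1 r1] _.
  by rewrite !mxE !enum_rankK /= mevalZ -eval_generic_path mxE.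
have full_Mv : row_full Mv^T by rewrite /row_full mxrank_tr.
exists (fullrankfun full_Mv); split; first exact: fullrankfun_inj.
have : \det (colsub (fullrankfun full_Mv) Mv) != 0.
  rewrite -det_tr -unitfE -unitmxE.
  have -> : (colsub (fullrankfun full_Mv) Mv)^T = rowsub (fullrankfun full_Mv) Mv^T.
    by apply/matrixP => i j; rewrite !mxE.
  exact: fullrowsub_unit.
apply: contraNneq => p0.
have <- : (pivot rel_matrix (fullrankfun full_Mv)).@[v] = \det (colsub (fullrankfun full_Mv) Mv).
  by rewrite /pivot -det_map_mx; congr (\det _); apply/matrixP => i j; rewrite !mxE.
by rewrite p0 meval0.
Qed.

End SpecialPoint.

(** The q i fit disjointly into d_0, which provides the sets S i. *)
Lemma pivot_exists (q : 'I_(arms L) -> nat) : (\sum_i q i <= d (vertex0 L))%N ->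
  (forall (i : 'I_(arms L)) j, (0 < j < len i)%N ->
     (d (vertex0 L) <= d (arm_vertex i j) + q i)%N) ->
  exists kap : 'I_#|row_index| -> 'I_#|col_index|, injective kap /\ pivot rel_matrix kap != 0.
Proof.
move=> sum_q dim_q; pose T : finType := {i : 'I_(arms L) & 'I_(q i)}.
have card_T : (#|T| <= d (vertex0 L))%N.
  rewrite card_tagged sumnE big_map big_enum /=; under eq_bigr do rewrite card_ord.
  exact: sum_q.
pose e (t : T) : 'I_(d (vertex0 L)) := widen_ord card_T (enum_rank t).
have e_inj : injective e by move=> t t' /(congr1 val) /= /val_inj/enum_rank_inj.
pose S i := [set e (Tagged (fun i => 'I_(q i)) t) | t in 'I_(q i)].
apply: (@pivot_neq0 S) => [i i' x /imsetP[t _ ->] /imsetP[t' _ /e_inj]|i j jl].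
  by move/(congr1 tag).
rewrite -(leq_add2r #|S i|) [X in (X <= _)%N]addnC cardsC card_ord card_imset ?card_ord; first exact: dim_q.
by move=> t t' /e_inj/eqP; rewrite eq_Tagged => /eqP.
Qed.

End Relations.

(** * Dimension inequalities from the canonical decomposition *)

Section Decomposition.
Variables (k : closedFieldType) (L : canonicalData k) (d : dimvec L).
Variables (p : nat) (q : forall i : 'I_(arms L), 'I_(len i) -> nat).
Hypothesis pq_decomposition : canonical_decomposition d p q.

(** The multiplicity of e_{i,0}. It bounds by how much d_0 exceeds the dimensions along arm i, and
    the sum over all arms is at most d_0. *)
Let q0 (i : 'I_(arms L)) : nat := q (Ordinal (len_gt0 i)).

Let e_vertexE (x y : vertex L) : e_vertex y x = (x == y)%:R.
Proof. by rewrite ffunE. Qed.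

Let h_vecE (x : vertex L) : h_vec L x = 1.
Proof.
rewrite /h_vec sum_ffunE (bigD1 x) //= e_vertexE eqxx big1 ?addr0 // => y yx.
by rewrite e_vertexE eq_sym (negPf yx).
Qed.

Let e_arm0E (i : 'I_(arms L)) x :
  e_arm i 0 x = 1 - \sum_(1 <= l < len i) (x == arm_vertex i l)%:R.
Proof.
rewrite /e_arm eqxx !ffunE h_vecE; congr (_ - _); rewrite sum_ffunE.
by apply: eq_bigr => l _; rewrite e_vertexE.
Qed.

Let dE x : (d x)%:Z = p%:Z + \sum_(i < arms L) \sum_(j < len i) e_arm i j x *+ q j.
Proof.
have [/(congr1 (fun f : {ffun vertex L -> int} => f x)) + _] := pq_decomposition.
rewrite !ffunE => ->; rewrite ffunMnE h_vecE; congr (_ + _).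
  by rewrite natz.
rewrite sum_ffunE; apply: eq_bigr => i _; rewrite sum_ffunE; apply: eq_bigr => j _.
by rewrite ffunMnE.
Qed.

Let arm_vertex_inner (i : 'I_(arms L)) l : (0 < l < len i)%N ->
  exists j : 'I_(len i).-1, arm_vertex i l = inner_vertex j /\ l = j.+1.
Proof.
case: l => // l /andP[_ ll]; have lt_l : (l < (len i).-1)%N by lia.
by exists (Ordinal lt_l); rewrite /= insubT.
Qed.

Let arm_vertex_inj (i i' : 'I_(arms L)) l l' : (0 < l < len i)%N -> (0 < l' < len i')%N ->
  arm_vertex i l = arm_vertex i' l' -> i = i' /\ l = l'.
Proof.
move=> /arm_vertex_inner[j [-> ->]] /arm_vertex_inner[j' [-> ->]].
move=> /(congr1 (fun u : vertex L => if u is inr v then v else Tagged (fun i => 'I_(len i).-1) j)) /= E.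
have /= ii' := congr1 (fun u => tag u) E; subst i'.
by move/eqP: E; rewrite eq_Tagged => /eqP /= ->.
Qed.

Let vertex0_inner (i : 'I_(arms L)) l : (0 < l < len i)%N -> (vertex0 L == arm_vertex i l) = false.
Proof. by move=> /arm_vertex_inner[j [-> _]]; apply/eqP. Qed.

Lemma decomposition_vertex0 : d (vertex0 L) = (p + \sum_i q0 i)%N.
Proof.
apply/eqP; rewrite -eqz_nat dE PoszD; apply/eqP; congr (_ + _).
rewrite -[RHS]natz natr_sum; apply: eq_bigr => i _.
rewrite (bigD1 (Ordinal (len_gt0 i))) //= e_arm0E big_nat big1 => [|l ll]; last first.
  by rewrite vertex0_inner.
rewrite subr0 big1 ?addr0 // => j j0.
have j0' : (0 < j)%N by rewrite lt0n; apply: contra j0 => /eqP e; apply/eqP/val_inj.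
by rewrite /e_arm gtn_eqF // e_vertexE vertex0_inner ?j0' //= mul0rn.
Qed.

(** At (i, j) the vector e_{i,0} vanishes, while h and the other e_{i',0} contribute as at the
    vertex 0, and the remaining terms are non-negative. *)
Lemma decomposition_inner (i : 'I_(arms L)) j : (0 < j < len i)%N ->
  (d (vertex0 L) <= d (arm_vertex i j) + q0 i)%N.
Proof.
move=> ji; rewrite -lez_nat decomposition_vertex0 !PoszD dE -addrA Num.Theory.lerD2l.
have -> : (\sum_i q0 i)%N%:Z = \sum_(i' | i' != i) (q0 i')%:Z + (q0 i)%:Z.
  rewrite -natz natr_sum (bigD1 i) //= addrC natz; congr (_ + _).
  by apply: eq_bigr => i' _; rewrite natz.
rewrite Num.Theory.lerD2r [X in (_ <= X)%R](bigD1 i) //= -[X in (X <= _)%R]add0r.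
have pos (i' : 'I_(arms L)) (l : 'I_(len i')) : (0 < l)%N -> 0 <= e_arm i' l (arm_vertex i j).
  by move=> l0; rewrite /e_arm gtn_eqF // e_vertexE Num.Theory.ler0n.
apply: Num.Theory.lerD.
  apply: Num.Theory.sumr_ge0 => l _; apply: Num.Theory.mulrn_wge0.
  have [l0|] := ltnP 0 l; first exact: pos.
  rewrite leqn0 => /eqP ->; rewrite e_arm0E.
  have jn : j \in index_iota 1 (len i) by rewrite mem_index_iota.
  rewrite (bigD1_seq j) ?iota_uniq //= eqxx big_seq_cond big1 ?addr0 ?subrr //.
  move=> l' /andP[]; rewrite mem_index_iota => l'i; case: eqP => // l'j _.
  by case: eqP => // /(arm_vertex_inj ji l'i)[_ /esym].
apply: Num.Theory.ler_sum => i' i'i; rewrite (bigD1 (Ordinal (len_gt0 i'))) //=.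
rewrite e_arm0E big_nat big1 => [|l ll]; last first.
  by case: eqP => // /(arm_vertex_inj ji ll)[ii' _]; rewrite ii' eqxx in i'i.
rewrite subr0 -[X in (X <= _)%R]addr0 -natz Num.Theory.lerD2l.
apply: Num.Theory.sumr_ge0 => l l0; apply: Num.Theory.mulrn_wge0; apply: pos.
by rewrite lt0n; apply: contra l0 => /eqP e; apply/eqP/val_inj.
Qed.

Lemma decomposition_pivot :
  exists kap : 'I_#|row_index d| -> 'I_#|col_index d|, injective kap /\ pivot (rel_matrix d) kap != 0.
Proof.
apply: (@pivot_exists _ _ d q0); first by rewrite decomposition_vertex0 leq_addl.
exact: decomposition_inner.
Qed.

End Decomposition.

(** * Geometry of the module variety *)

Lemma growth_leS (k : closedFieldType) n (mf : measure n) (I J : {mpoly k[n]} -> Prop) q :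
  (forall p, I p -> J p) -> growth_le mf I q -> growth_le mf J q.
Proof.
move=> IJ [C bound]; exists C => m T p pm indep; apply: (bound m T p pm) => c /IJ.
exact: indep.
Qed.

Section ZariskiTopology.
Variables (k : closedFieldType) (L : canonicalData k) (d : dimvec L).
Local Notation P := {mpoly k[#|Defs.coord d|]}.
Implicit Types (Y Z : set (rep d)) (I : P -> Prop).

Definition ideal_of Y (p : P) : Prop := forall M, Y M -> p.@[coords M] = 0.

Definition zeros_of I : set (rep d) := [set M | forall p, I p -> p.@[coords M] = 0]%classic.

Lemma ideal_of_ideal Y : is_ideal (ideal_of Y).
Proof.
split=> [M _|a b Ja Jb M YM|a b Jb M YM]; first exact: meval0.
- by rewrite mevalD Ja ?Jb ?addr0.
- by rewrite mevalM Jb ?mulr0.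
Qed.

Lemma ideal_ofS Y Z : (Y `<=` Z)%classic -> forall p, ideal_of Z p -> ideal_of Y p.
Proof. by move=> YZ p Zp M /YZ; apply: Zp. Qed.

Lemma zariski_closed_eq0 (p : P) : zariski_closed [set M | p.@[coords M] = 0]%classic.
Proof.
exists [set p]%classic; apply/seteqP; split=> M /= pM; last exact: pM.
by move=> _ ->.
Qed.

Lemma irreducible_prime Y : irreducible Y -> is_prime (ideal_of Y).
Proof.
move=> [[M YM] irrY]; split=> [||a b Yab]; first exact: ideal_of_ideal.
  by move=> /(_ M YM); rewrite meval1 => /eqP; rewrite oner_eq0.
have [M' YM'|Ya|Yb] := irrY _ _ (zariski_closed_eq0 a) (zariski_closed_eq0 b).
- have /eqP := Yab M' YM'; rewrite mevalM mulf_eq0 => /orP[] /eqP h; [left | right]; exact: h.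
- by left.
- by right.
Qed.

Lemma closed_mem Y M : zariski_closed Y -> (forall p, ideal_of Y p -> p.@[coords M] = 0) -> Y M.
Proof. by move=> [S ->] YM p Sp; apply: YM => M' /(_ p Sp). Qed.

Lemma ideal_of_zeros I : is_prime I -> forall p, ideal_of (zeros_of I) p -> I p.
Proof.
move=> prI p Ip; have [m] : radical I p; last exact: prime_exp.
apply: nullstellensatz => [|v Iv]; first by case: prI.
by have := Ip (rep_of v); rewrite coords_rep_of; apply=> f; rewrite coords_rep_of; apply: Iv.
Qed.

(** Codimension is about irreducible closed sets, the growth estimates about primes; the
    Nullstellensatz passes from a prime to a set that is nonempty and irreducible. *)
Lemma zeros_irr_closed I : is_prime I -> irr_closed (zeros_of I).
Proof.
move=> prI; have [idI I1 prodI] := prI; split; first by exists I.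
split.
  have [v Iv] := weak_nullstellensatz idI I1; exists (rep_of v) => p Ip.
  by rewrite coords_rep_of Iv.
move=> _ _ [S1 ->] [S2 ->] cover.
have witness (S : set P) : ~ (zeros_of I `<=` [set M | forall p, S p -> p.@[coords M] = 0])%classic ->
    exists2 p, S p & ~ I p.
  move=> nsub; apply: contrapT => nop; apply: nsub => M IM p Sp; apply: IM.
  by apply: contrapT => Ip; apply: nop; exists p.
apply: contrapT => /not_orP[/witness[p1 Sp1 Ip1] /witness[p2 Sp2 Ip2]].
have /prodI[//|//] : I (p1 * p2).
apply: ideal_of_zeros => // M /cover[SM|SM]; rewrite mevalM.
  by rewrite (SM p1 Sp1) mul0r.
by rewrite (SM p2 Sp2) mulr0.
Qed.

(** Going down the chain from its top, each strict inclusion costs one by [growth_drop]. *)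
Lemma chain_growth (mf : measure #|Defs.coord d|) X Y r e : irr_chain X Y r ->
  growth_le mf (ideal_of X) e -> exists2 q, e = (q + r)%N & growth_le mf (ideal_of Y) q.
Proof.
move=> [Ch [ChY irrCh stepCh]] growthX.
suff main i : (i <= r)%N -> exists2 q, e = (q + i)%N & growth_le mf (ideal_of (Ch (r - i)%N)) q.
  by have := main r (leqnn r); rewrite subnn ChY.
elim: i => [|i IHi] ir.
  exists e; first by rewrite addn0.
  rewrite subn0; apply: growth_leS growthX; apply: ideal_ofS.
  by have [] := irrCh r (leqnn r).
have [q -> growth_q] := IHi (ltnW ir); set j := (r - i.+1)%N.
have rij : (r - i)%N = j.+1 by rewrite /j; lia.
have jr : (j < r)%N by rewrite /j; lia.
rewrite rij in growth_q; have [[_ irr1] _] := irrCh j.+1 jr.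
have [[cl0 irr0] _] := irrCh j (ltnW jr); have [sub /existsNP[M /not_implyP[M1 M0]]] := stepCh j jr.
have [f f0 fM] : exists2 f, ideal_of (Ch j) f & f.@[coords M] <> 0.
  apply: contrapT => nof; apply: M0; apply: closed_mem => // p p0.
  by apply: contrapT => pM; apply: nof; exists p.
have [id0 one0 _] := irreducible_prime irr0.
have nf : ~ ideal_of (Ch j.+1) f by move=> /(_ M M1).
have [q' -> growth_q'] := growth_drop (irreducible_prime irr1) id0 (ideal_ofS sub) one0 f0 nf growth_q.
by exists q' => //; rewrite addSnnS.
Qed.

End ZariskiTopology.

Section CoordinateRing.
Variables (k : closedFieldType) (L : canonicalData k) (d : dimvec L).
Local Notation P := {mpoly k[#|Defs.coord d|]}.
Local Notation X := (@module_variety k L d).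

Lemma restrict_subproof (p : P) :
  (fun M : X => p.@[coords (val M)]) \in @polynomial_function k L d.
Proof. by apply/asboolP; exists p. Qed.

Definition restrict (p : P) : coordinate_ring d := CoordinateRing (restrict_subproof p).

Lemma coordinate_ring_eq (f g : coordinate_ring d) : (forall M, f M = g M) -> f = g.
Proof. by move=> fg; apply: val_inj; apply/funext. Qed.

Lemma restrict_is_zmod_morphism : zmod_morphism restrict.
Proof. by move=> p q; apply: coordinate_ring_eq => M; rewrite /= mevalB. Qed.

Lemma restrict_is_monoid_morphism : monoid_morphism restrict.
Proof.
split; first by apply: coordinate_ring_eq => M; rewrite /= meval1.
by move=> p q; apply: coordinate_ring_eq => M; rewrite /= mevalM.
Qed.

HB.instance Definition _ :=
  GRing.isZmodMorphism.Build P (coordinate_ring d) restrict restrict_is_zmod_morphism.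
HB.instance Definition _ :=
  GRing.isMonoidMorphism.Build P (coordinate_ring d) restrict restrict_is_monoid_morphism.

Lemma restrict_surj f : exists p, f = restrict p.
Proof.
have /asboolP[p fE] := valP f; exists p; apply: coordinate_ring_eq => M.
exact: fE.
Qed.

Lemma restrict_eq0 p : restrict p = 0 <-> ideal_of X p.
Proof.
split=> [p0 M XM|Xp]; last by apply: coordinate_ring_eq => M; apply: Xp; apply: set_mem (valP M).
exact: (congr1 (fun f : coordinate_ring d => f (SigSub (mem_set XM))) p0).
Qed.

End CoordinateRing.

(** * Regular sequences on the module variety *)

Section Regularity.
Variables (k : closedFieldType) (L : canonicalData k) (d : dimvec L).
Local Notation N := #|Defs.coord d|.
Local Notation P := {mpoly k[N]}.
Local Notation X := (@module_variety k L d).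
Local Notation mf := (grading d).
Hypothesis irrX : irreducible X.
Hypothesis d0_gt0 : (0 < d (vertex0 L))%N.
Variable kap : 'I_#|row_index d| -> 'I_#|col_index d|.
Hypotheses (kap_inj : injective kap) (pivot0 : pivot (rel_matrix d) kap != 0).

Let T : finType := ('I_#|row_index d| * 'I_(d (vertex_oo L)))%type.
Let g (i : 'I_#|T|) : P := relation (enum_val i).
Let E : {set 'I_N} := eliminated (@rel_var _ _ d) kap.
Let G : P -> Prop := ideal_gen g [set: 'I_#|T|].

Let idG : is_ideal G. Proof. exact: ideal_gen_ideal. Qed.

Let G_relation (p : P) : ideal_gen (@relation _ _ d) [set: T] p -> G p.
Proof.
apply: ideal_gen_sub => // u _.
have -> : relation u = g (enum_rank u) by rewrite /g enum_rankK.
by apply: ideal_gen_mem; rewrite inE.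
Qed.

Let gP v : (forall i, (g i).@[v] = 0) <-> X (rep_of v).
Proof.
split=> [gv|/module_varietyE rel i]; last by have := rel (enum_val i); rewrite coords_rep_of.
by apply/module_varietyE => u; rewrite coords_rep_of; have := gv (enum_rank u); rewrite /g enum_rankK.
Qed.

Let vanishingE p : vanishing_ideal g p <-> ideal_of X p.
Proof.
split=> [gp M XM|Xp v /gP XM]; last by have := Xp _ XM; rewrite coords_rep_of.
by apply: gp; apply/gP; rewrite rep_of_coords.
Qed.

Let prime_van : is_prime (vanishing_ideal g).
Proof.
have -> : vanishing_ideal g = ideal_of X by apply/funext => p; apply/propext.
exact: irreducible_prime.
Qed.

Let card_E : #|E| = #|T|.
Proof. by rewrite (card_eliminated (@rel_var_inj _ _ d) kap_inj) [RHS]card_prod !card_ord. Qed.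

Let hom_g i : homog_pos mf (g i).
Proof. exact: homog_relation. Qed.

Let hom_pivot : homog_pos mf (pivot (rel_matrix d) kap).
Proof.
exists (\sum_i col_degree (kap i))%N; last by apply: homog_pivot; apply: homog_rel_matrix.
(* A third arm and d_0 > 0 provide a row, so the pivot has positive degree. *)
have row : row_index d by split; [exists (Ordinal (arms_ge3 L)) | exact: Ordinal d0_gt0].
by rewrite (bigD1 (enum_rank row)) //= addn_gt0 col_degree_gt0.
Qed.

Let kill_piv : kill k E (pivot (rel_matrix d) kap) = pivot (rel_matrix d) kap.
Proof. exact: kill_pivot (@kill_rel_matrix _ _ d). Qed.

Let elimE i : i \in E -> exists q, kill k E q = q /\ G (pivot (rel_matrix d) kap * 'X_i - q).
Proof.
move=> /(elimination (@rel_var_inj _ _ d) kap_inj (@kill_rel_matrix _ _ d))[q [qE /G_relation]].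
by exists q.
Qed.

Let dominantE (U : P) : kill k E U = U ->
  (forall v, (forall i, (g i).@[v] = 0) -> U.@[v] = 0) -> U = 0.
Proof.
move=> UE vanU; apply: (elimination_dominant (@rel_var_inj _ _ d) kap_inj (@kill_rel_matrix _ _ d) pivot0 UE).
by move=> v rel; apply: vanU => i; apply: rel.
Qed.

Lemma ideal_of_variety p : ideal_of X p <-> G p.
Proof.
split; last first.
  by move=> Gp; apply/vanishingE; move: Gp; apply: ideal_gen_sub => [|i _ v]; [case: prime_van | apply].
move=> /vanishingE; apply: (vanishing_ideal_gen (@grading_gt0 _ _ d) hom_g hom_pivot card_E pivot0 kill_piv elimE dominantE prime_van).
Qed.

Lemma growth_variety : growth_le mf (ideal_of X) (N - #|T|).
Proof.
have -> : ideal_of X = vanishing_ideal g.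
  by apply/funext => p; apply/propext; have [vi iv] := vanishingE p; split; [exact: iv | exact: vi].
exact: (growth_vanishing (@grading_gt0 _ _ d) card_E pivot0 kill_piv elimE dominantE prime_van).
Qed.

Lemma homogeneous_restrict : homogeneous_ideal mf (fun p => restrict p = 0).
Proof.
move=> e p /restrict_eq0/ideal_of_variety Gp; apply/restrict_eq0/ideal_of_variety.
by apply: homogeneous_gen Gp => i; apply: homog_pos_homog.
Qed.

(** The zeros of a prime I containing g and h lie in Z, so a chain of length s leads from them into
    X, and the growth of P/I is s below that of X. Then [join_regular] applies. *)
Lemma restrict_regular s (h : 'I_s -> P) (Z : set (rep d)) : codim_ge X Z s ->
  (forall j, homog_pos mf (h j)) ->
  (forall M, X M -> (forall j, (h j).@[coords M] = 0) -> Z M) ->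
  forall (S : {set 'I_s}) j, j \notin S ->
    nonzerodivisor_mod (ideal_gen (@restrict k L d \o h) S) (restrict (h j)).
Proof.
move=> codimZ hom_h hZ.
have growthp (I : P -> Prop) : is_prime I -> (forall f, G f -> I f) -> (forall j, I (h j)) ->
    exists2 q, (N - #|T|)%N = (q + s)%N & growth_le mf I q.
  move=> prI GI hI; have : irr_chain X (zeros_of I) s.
    apply: codimZ; first exact: zeros_irr_closed.
    move=> M IM; apply: hZ => [|j]; last exact: IM.
    rewrite -(rep_of_coords M); apply/gP => i; apply: IM; apply: GI.
    by apply: ideal_gen_mem; rewrite inE.
  move=> /chain_growth/(_ growth_variety)[q qE gr]; exists q => //.
  by apply: growth_leS gr; apply: ideal_of_zeros.
have leT : (#|T| <= N)%N by rewrite -card_E -[X in (_ <= X)%N]card_ord max_card.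
(* Some prime contains g and h, as they have no constant terms; this shows t + s <= N. *)
have [q qE] : exists q, (N - #|T|)%N = (q + s)%N.
  have hom_f i : homog_pos mf (join_family g h i) by rewrite /join_family; case: fintype.split.
  have [//|_ _ -> ->|f Jf f1|I [prI fI _]] := @exists_prime_disjoint _ (ideal_gen (join_family g h)
      [set: 'I_(#|T| + s)]) (fun f => f = 1) (ideal_gen_ideal _ _).
  - by rewrite mulr1.
  - by move: Jf; rewrite f1; apply: proper_gen hom_f.
  have [||q] := growthp I prI; last by exists q.
    move=> f; apply: ideal_gen_sub => [|x _]; first by case: prI.
    apply: fI; have -> : g x = join_family g h (lshift s x) by rewrite /join_family (unsplitK (inl x)).
    by apply: ideal_gen_mem; rewrite inE.
  move=> y; apply: fI; have -> : h y = join_family g h (rshift #|T| y) by rewrite /join_family (unsplitK (inr y)).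
  by apply: ideal_gen_mem; rewrite inE.
move=> S j jS a; have [u ->] := restrict_surj a.
have genE v : ideal_gen (@restrict k L d \o h) S (restrict v) <-> ideal_add G (ideal_gen h S) v.
  split=> [[c vE]|[v1 [v2 [/ideal_of_variety/restrict_eq0 v1G [c ->] ->]]]]; last first.
    rewrite rmorphD /= v1G add0r rmorph_sum; exists (@restrict k L d \o c).
    by apply: eq_bigr => i _; rewrite rmorphM.
  have /choice[c' c'E] : forall i, exists q, c i = restrict q by move=> i; apply: restrict_surj.
  exists (v - \sum_(i in S) c' i * h i), (\sum_(i in S) c' i * h i).
  split; [|by exists c'|by rewrite subrK].
  apply/ideal_of_variety/restrict_eq0; rewrite rmorphB /= vE rmorph_sum; apply/eqP.
  by rewrite subr_eq0; apply/eqP/eq_bigr => i _; rewrite rmorphM /= -c'E.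
rewrite -rmorphM => /genE gu; apply/genE; move: gu.
apply: (@join_regular k N mf (@grading_gt0 _ _ d) _ g hom_g s h q) => //.
  by move: qE leT; lia.
move=> I prI GI hI; have [q' q'E gr] := growthp I prI GI hI.
by have -> : q = q' by move: qE q'E; lia.
Qed.

End Regularity.

(** * Semi-invariants *)

Lemma poly_eq_nonzero (k : closedFieldType) (p q : {poly k}) :
  (forall x, x != 0 -> p.[x] = q.[x]) -> p = q.
Proof.
move=> pq; apply/eqP; rewrite -subr_eq0; apply/contraT => pq0.
have /closed_nonrootP[x] : 'X * (p - q) != 0 by rewrite mulf_neq0 ?polyX_eq0.
rewrite rootE hornerM hornerX mulf_eq0 negb_or => /andP[x0].
by rewrite hornerD hornerN pq // subrr eqxx.
Qed.

Section Torus.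
Variables (k : closedFieldType) (L : canonicalData k) (d : dimvec L).
Local Notation N := #|Defs.coord d|.
Local Notation P := {mpoly k[N]}.
Local Notation X := (@module_variety k L d).
Local Notation mf := (grading d).

Definition origin : X := SigSub (mem_set (module_variety0 d)).

Lemma coords_origin : coords (val origin) = fun=> 0.
Proof. exact: coords_rep_of. Qed.

(** A potential on the vertices whose difference along each arrow is the degree of that arrow. *)
Definition vertex_weight (x : vertex L) : nat :=
  match x with
  | inl b => if b then grading_deg L else 0%N
  | inr (existT i j) => (j.+1 * arm_weight i)%N
  end.

Lemma vertex_weight_arm (i : 'I_(arms L)) j : (j <= len i)%N ->
  vertex_weight (arm_vertex i j) = (j * arm_weight i)%N.
Proof.
case: j => [|j] ji //; have [lt_j|] := ltnP j (len i).-1; first by rewrite /= insubT.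
move=> le_j; have -> : j.+1 = len i by move: ji le_j (len_gt0 i); lia.
by rewrite arm_vertex_len arm_weight_mul.
Qed.

Lemma vertex_weight_arrow (a : arrow L) :
  vertex_weight (src a) = (vertex_weight (tgt a) + arm_weight (tag a))%N.
Proof.
case: a => i j; rewrite /src /tgt !vertex_weight_arm /= ?mulSnr //; exact: ltnW.
Qed.

Lemma torus_subproof (x : k) (x0 : x != 0) y : (x ^+ vertex_weight y)%:M \in @unitmx k (d y).
Proof. by rewrite unitmxE det_scalar unitfE !expf_neq0. Qed.

(* The one-parameter subgroup that induces the grading. *)
Definition torus (x : k) (x0 : x != 0) : GL d :=
  exist _ (fun y => (x ^+ vertex_weight y)%:M) (torus_subproof x0).

Lemma coords_torus x (x0 : x != 0) (M : rep d) i :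
  coords (act_rep (invGL (torus x0)) M) i = x ^+ coord_weight i * coords M i.
Proof.
rewrite /coords /coord_weight /act_rep /=; case: (enum_val i) => a [r c] /=.
rewrite invmxK invmx_scalar mul_scalar_mx mul_mx_scalar !mxE vertex_weight_arrow exprD.
by rewrite -mulrA mulrCA mulrA mulrACA mulrA; field; rewrite expf_neq0.
Qed.

Lemma meval_weighted x v e (p : P) : p \is e.-homog for mf ->
  p.@[fun i => x ^+ coord_weight i * v i] = x ^+ e * p.@[v].
Proof.
move=> /dhomogP homp; rewrite !mevalE mulr_sumr; apply: eq_big_seq => m /homp <-.
rewrite mulrCA; congr (_ * _); rewrite /= /weighted -prodrXr -big_split; apply: eq_bigr => i _.
by rewrite exprMn -exprM mulnC.
Qed.

Lemma torus_weight x (x0 : x != 0) (sigma : weight L) :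
  \prod_y \det (sval (torus x0) y) ^ sigma y =
  x ^ (\sum_y (vertex_weight y * d y)%N%:Z * sigma y).
Proof.
rewrite (big_morph (fun z : int => x ^ z) (fun a b => expfzDr a b x0) (expr0z x)).
by apply: eq_bigr => y _; rewrite /= det_scalar -exprM -exprz_exp.
Qed.

(** On X, the sum of the x^e p_e equals x^z p for all x != 0, where z is the exponent of the weight
    on [torus]. Comparing coefficients in x, f is the component of degree z. *)
Lemma semi_invariant_homog sigma (f : coordinate_ring d) : semi_invariant sigma f ->
  exists e p, p \is e.-homog for mf /\ f = restrict p.
Proof.
move=> semi; have [p fE] := restrict_surj f; have [m pm] := wdeg_le_ex mf p.
set z := \sum_y (vertex_weight y * d y)%N%:Z * sigma y.
have key x (M : X) : x != 0 ->
    \sum_(e < m.+1) x ^+ e * (pihomog mf e p).@[coords (val M)] = x ^ z * p.@[coords (val M)].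
  move=> x0; have := semi (torus x0) M; rewrite torus_weight fE /= -/z => <-.
  have -> : p.@[coords (act_rep (invGL (torus x0)) (val M))] =
      p.@[fun i => x ^+ coord_weight i * coords (val M) i].
    by apply: meval_eq => i; apply: coords_torus.
  rewrite {2}(homog_sum pm) raddf_sum; apply: eq_bigr => e _.
  by rewrite /= (meval_weighted _ _ (pihomogP _ _ _)).
pose Q (M : X) : {poly k} := \poly_(e < m.+1) (pihomog mf e p).@[coords (val M)].
have QE M x : (Q M).[x] = \sum_(e < m.+1) x ^+ e * (pihomog mf e p).@[coords (val M)].
  by rewrite horner_poly; apply: eq_bigr => e _; rewrite mulrC.
have small e M : (m.+1 <= e)%N -> (pihomog mf e p).@[coords (val M)] = 0.
  move=> me; rewrite (_ : pihomog mf e p = 0) ?meval0 // pihomogE big_seq_cond big1 //.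
  by move=> u /andP[/pm um /eqP ue]; move: um me; rewrite ue; lia.
(* For negative z, clearing the denominator and comparing constant terms in x gives f = 0. *)
case: z key => n key; [exists n, (pihomog mf n p) | exists 0%N, 0].
  split; first exact: pihomogP.
  rewrite fE; apply: coordinate_ring_eq => M /=.
  have QM : Q M = (p.@[coords (val M)])%:P * 'X^n.
    by apply: poly_eq_nonzero => x x0; rewrite QE key // !hornerE mulrC.
  have := congr1 (fun h : {poly k} => h`_n) QM; rewrite coefCM coefXn eqxx mulr1 => <-.
  by rewrite coef_poly; case: ltnP => // /small ->.
split; first exact: dhomog0.
rewrite rmorph0 fE; apply: coordinate_ring_eq => M /=.
have QM : Q M * 'X^(n.+1) = (p.@[coords (val M)])%:P.
  apply: poly_eq_nonzero => x x0; rewrite hornerM hornerXn QE key // hornerC.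
  by rewrite NegzE -exprnN mulrAC mulVf ?mul1r // expf_neq0.
have := congr1 (fun h : {poly k} => h`_0) QM.
by rewrite coefMXn coefC /= => <-.
Qed.

Lemma homog0_const (p : P) : p \is 0.-homog for mf -> p = (p@_0%MM)%:MP.
Proof.
move=> /dhomogP homp; apply/mpolyP => m; rewrite mcoeffC; have [->|m0] := eqVneq m 0%MM.
  by rewrite mulr1.
rewrite mulr0; apply/eqP; rewrite mcoeff_eq0; apply: contra m0 => /homp mf0.
apply/eqP/mnmP => i; rewrite mnm0E; apply/eqP; move/eqP: mf0; apply: contraTT => mi.
by rewrite mfE (bigD1 i) //= addn_eq0 negb_and muln_eq0 negb_or mi -lt0n grading_gt0.
Qed.

Lemma restrict_origin (p : P) : restrict p origin = p@_0%MM.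
Proof.
rewrite -[LHS]/(p.@[coords (val origin)]) coords_origin.
by apply: (mpoly_rmorph_eq (F := meval (fun=> 0)) (G := mcoeff 0%MM)) => [c|i] /=;
  rewrite ?mevalC ?mcoeffC ?eqxx ?mulr1 ?mevalXU ?mcoeffX ?mnm1_eq0.
Qed.

Lemma act_origin g : act g origin = origin.
Proof.
apply: val_inj; apply: functional_extensionality_dep => a; apply/matrixP => r c.
rewrite /= /act_rep (_ : rep_of (fun=> 0) a = 0); last by apply/matrixP => i j; rewrite !mxE.
by rewrite mulmx0 mul0mx mxE.
Qed.

(** GL(d) fixes the origin, and a suitable scalar at a vertex where sigma is nonzero has character
    different from 1. *)
Lemma semi_invariant_origin sigma (f : coordinate_ring d) : admissible d sigma ->
  (exists x, sigma x != 0) -> semi_invariant sigma f -> f origin = 0.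
Proof.
move=> adm [x sx] semi; have dx : (0 < d x)%N by rewrite lt0n; apply: contraNneq sx => /adm ->.
pose z := (d x)%:Z * sigma x; have z0 : z != 0 by rewrite mulf_neq0 // -lt0n.
have [l l0 lz] : exists2 l : k, l != 0 & l ^ z != 1.
  have n0 : (0 < `|z|)%N by rewrite lt0n absz_eq0.
  have Xn1 : 'X^`|z| - 1 != 0 :> {poly k}.
    rewrite subr_eq0; apply/eqP => /(congr1 (fun p : {poly k} => size p)).
    by rewrite size_polyXn size_poly1 => -[] zn; rewrite zn in n0.
  have /closed_nonrootP[l] := mulf_neq0 (negbT (polyX_eq0 k)) Xn1.
  rewrite rootE hornerM hornerX mulf_eq0 negb_or !hornerE subr_eq0 => /andP[l0 ln].
  exists l => //; apply: contra ln; case: (z) => m /=; first by [].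
  by rewrite NegzE -exprnN invr_eq1.
have unit_g y : ((if y == x then l else 1)%:M : 'M[k]_(d y)) \in unitmx.
  by rewrite unitmxE det_scalar unitfE expf_neq0 //; case: ifP => _; rewrite ?oner_neq0.
pose g : GL d := exist _ (fun y => (if y == x then l else 1)%:M) unit_g.
have := semi g origin; rewrite act_origin (bigD1 x) //= big1 ?mulr1 => [|y /negPf yx]; last first.
  by rewrite yx det1 exp1rz.
rewrite eqxx det_scalar -[l ^+ d x]/(l ^ (d x)%:Z) exprz_exp -/z => fE.
apply/eqP; apply: contraNT lz => f0; apply/eqP; apply: (mulIf f0).
by rewrite -fE mul1r.
Qed.

End Torus.

(** * Homogeneous generators of the ring of semi-invariants *)

Section Generators.
Variables (k : closedFieldType) (L : canonicalData k) (d : dimvec L).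
Local Notation N := #|Defs.coord d|.
Local Notation P := {mpoly k[N]}.
Local Notation mf := (grading d).
Local Notation restrict := (@restrict k L d).
Local Notation SI := (@SI k L d).

Lemma meval_subst n r (y : 'I_r -> {mpoly k[n]}) v F :
  (subst y F).@[v] = F.@[fun i => (y i).@[v]].
Proof.
apply: (mpoly_rmorph_eq (F := meval v \o subst y) (G := meval _)) => [c|i] /=.
  by rewrite mmapC !mevalC.
by rewrite mmapX mmap1U mevalXU.
Qed.

Lemma meval0_coef n (F : {mpoly k[n]}) : F.@[fun=> 0] = F@_0%MM.
Proof.
by apply: (mpoly_rmorph_eq (F := meval (fun=> 0)) (G := mcoeff 0%MM)) => [c|i] /=;
  rewrite ?mevalC ?mcoeffC ?eqxx ?mulr1 ?mevalXU ?mcoeffX ?mnm1_eq0.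
Qed.

Lemma subst_coef0 n r (y : 'I_r -> {mpoly k[n]}) F : (forall i, (y i)@_0%MM = 0) ->
  (subst y F)@_0%MM = F@_0%MM.
Proof.
move=> y0; rewrite -!meval0_coef meval_subst; apply: meval_eq => i.
by rewrite meval0_coef y0.
Qed.

Lemma normalized_generators s : polynomial_ring_in SI s ->
  exists t : 'I_s -> P, [/\ forall F, restrict (subst t F) = 0 -> F = 0,
    forall f, SI f <-> exists F, f = restrict (subst t F) & forall i, (t i)@_0%MM = 0].
Proof.
move=> [phi [phiC phi_inj phiSI]]; pose c i := phi 'X_i (origin d).
have phiCE e : phi e%:MP = restrict e%:MP.
  by apply: coordinate_ring_eq => M; rewrite phiC /= mevalC.
have /choice[x xE] : forall i, exists x, phi 'X_i = restrict x by move=> i; apply: restrict_surj.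
have phiE F : phi F = restrict (subst x F).
  apply: (mpoly_rmorph_eq (F := phi) (G := restrict \o subst x)) => [e|i] /=.
    by rewrite mmapC.
  by rewrite mmapX mmap1U.
pose sh i : {mpoly k[s]} := 'X_i - (c i)%:MP; pose sh' i : {mpoly k[s]} := 'X_i + (c i)%:MP.
have shK F : subst sh' (subst sh F) = F.
  rewrite subst_comp -[RHS]subst_id; congr (subst _ F); apply/funext => i.
  by rewrite /sh rmorphB substXU substC addrK.
have sh'K F : subst sh (subst sh' F) = F.
  rewrite subst_comp -[RHS]subst_id; congr (subst _ F); apply/funext => i.
  by rewrite /sh' rmorphD substXU substC subrK.
pose t i : P := x i - (c i)%:MP.
have tE F : restrict (subst t F) = phi (subst sh F).
  rewrite phiE subst_comp; congr (restrict (subst _ F)); apply/funext => i.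
  by rewrite /sh rmorphB substXU substC.
exists t; split=> [F|f|i].
- by rewrite tE -(rmorph0 phi) => /phi_inj shF0; rewrite -[F]shK shF0 rmorph0.
- rewrite -phiSI; split=> [[F _ <-]|[F ->]]; last by rewrite tE; exists (subst sh F).
  by exists (subst sh' F); rewrite tE sh'K.
- by rewrite /t mcoeffB mcoeffC eqxx mulr1 -restrict_origin -xE subrr.
Qed.

Lemma semi_invariant_SI sigma f : admissible d sigma -> semi_invariant sigma f -> SI f.
Proof.
move=> adm semi; exists 1%N, (fun=> sigma), (fun=> f).
by split=> [i|]; [split | rewrite big_ord1].
Qed.

Lemma SI_decomposition f : SI f -> f (origin d) = 0 ->
  exists r (F : 'I_r -> P) (e : 'I_r -> nat),
    (forall j, [/\ (0 < e j)%N, F j \is (e j).-homog for mf & SI (restrict (F j))]) /\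
    f = \sum_j restrict (F j).
Proof.
move=> [r [sigma [f_ [semi fE]]]] f0.
have /choice[p pP] : forall j, exists p, exists e, p \is e.-homog for mf /\ f_ j = restrict p.
  move=> j; have [_ /semi_invariant_homog[e [p pP]]] := semi j; by exists p, e.
have /choice[e eP] := pP.
have SI0 : SI (restrict 0) by exists 0%N, (fun=> fun=> 0), (fun=> 0); split=> [[]//|]; rewrite big_ord0 rmorph0.
exists r, (fun j => if e j == 0%N then 0 else p j), (fun j => if e j == 0%N then 1%N else e j).
split=> [j|].
  have [homp fjE] := eP j; have [adm semij] := semi j; case: eqP => [_|/eqP ej].
    by split=> //; apply: dhomog0.
  by split=> //; [rewrite lt0n | rewrite -fjE; apply: semi_invariant_SI semij].
rewrite fE (bigID (fun j => e j == 0%N)) /= [RHS](bigID (fun j => e j == 0%N)) /=.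
congr (_ + _); last by apply: eq_bigr => j /negPf ->; have [_ ->] := eP j.
rewrite [RHS]big1 => [|j ->]; last by rewrite rmorph0.
have [c cE] : exists c : k, \sum_(j | e j == 0%N) f_ j = restrict c%:MP.
  exists (\sum_(j | e j == 0%N) (p j)@_0%MM); rewrite (raddf_sum (@mpolyC N k)) rmorph_sum.
  apply: eq_bigr => j /eqP ej; have [homp ->] := eP j; rewrite ej in homp.
  by rewrite {1}(homog0_const homp).
have restE : \sum_(j | e j != 0%N) f_ j = restrict (\sum_(j | e j != 0%N) p j).
  by rewrite rmorph_sum; apply: eq_bigr => j _; have [_ ->] := eP j.
have c0 : c = 0.
  have fE' : f = restrict (c%:MP + \sum_(j | e j != 0%N) p j).
    by rewrite rmorphD /= -restE -cE fE [LHS](bigID (fun j => e j == 0%N)).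
  move: f0; rewrite fE' restrict_origin mcoeffD mcoeffC eqxx mulr1 raddf_sum big1 ?addr0 // => j ej.
  by have [homp _] := eP j; apply: (@homog_pos_coef0 k N mf); exists (e j); rewrite ?lt0n.
by rewrite cE c0 mpolyC0 rmorph0.
Qed.

(** The constant term of h_l is that of the partial derivative of H in direction l. *)
Lemma order2_decomposition s (H : {mpoly k[s]}) : H@_0%MM = 0 -> (forall l, H@_U_(l)%MM = 0) ->
  exists h : 'I_s -> {mpoly k[s]}, H = \sum_i h i * 'X_i /\ forall i, (h i)@_0%MM = 0.
Proof.
move=> H0 H1; have [h hE] := kill_congr [set: 'I_s] H.
have killH : kill k [set: 'I_s] H = 0 by rewrite killT meval0_coef H0 mpolyC0.
have HE : H = \sum_i h i * 'X_i.
  by move: hE; rewrite killH subr0 => ->; apply: eq_bigl => i; rewrite inE.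
exists h; split=> // l; have := H1 l; rewrite -[U_(l)%MM]add0m.
have dH := mcoeff_deriv l 0%MM H; rewrite mnm0E mulr1n in dH; rewrite -dH HE.
have term i : (h i * 'X_i)^`M(l)@_0%MM = (h i)@_0%MM * (i == l)%:R.
  rewrite mderivM mcoeffD !rmorphM /= mcoeffX mnm1_eq0 mulr0 add0r mderivX mnm1E.
  case: eqP => [->|_]; last by rewrite scale0r mcoeff0.
  rewrite scale1r (_ : (U_(l) - U_(l))%MM = 0%MM) ?mpolyX0 ?mcoeff1 ?eqxx ?mulr1 //.
  by apply/mnmP => j; rewrite mnmBE subnn mnm0E.
rewrite (raddf_sum (mderiv l)) (raddf_sum (mcoeff 0%MM)) (bigD1 l) // big1 => [|i il].
  by rewrite /= addr0 term eqxx mulr1.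
by rewrite /= term (negPf il) mulr0.
Qed.

Section HomogeneousGenerators.
Variables (s : nat) (t : 'I_s -> P).
Hypothesis t_inj : forall F, restrict (subst t F) = 0 -> F = 0.
Hypothesis t_SI : forall f, SI f <-> exists F, f = restrict (subst t F).
Hypothesis t0 : forall i, (t i)@_0%MM = 0.
Hypothesis hom_ker : homogeneous_ideal mf (fun p => restrict p = 0).

Let t_SI_origin F : restrict (subst t F) (origin d) = F@_0%MM.
Proof. by rewrite restrict_origin subst_coef0. Qed.

Let homog_coef0 e (p : P) : (0 < e)%N -> p \is e.-homog for mf -> p@_0%MM = 0.
Proof. by move=> e0 hom_p; apply: (@homog_pos_coef0 k N mf); exists e. Qed.

(* The linear parts of the homogeneous components of the t_i span k^s, so that
   s of these components have linearly independent linear parts. *)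
Let generators : exists (y : 'I_s -> P) (Y : 'I_s -> {mpoly k[s]}),
  [/\ forall l, homog_pos mf (y l), forall l, restrict (y l) = restrict (subst t (Y l)) &
      (\matrix_(l < s, j < s) (Y l)@_U_(j)%MM) \in unitmx].
Proof.
have /choice[r rP] : forall i, exists r, exists (F : 'I_r -> P) (e : 'I_r -> nat),
    (forall j, [/\ (0 < e j)%N, F j \is (e j).-homog for mf & SI (restrict (F j))]) /\
    restrict (t i) = \sum_j restrict (F j).
  move=> i; apply: SI_decomposition.
    by apply/t_SI; exists 'X_i; rewrite substXU.
  by rewrite restrict_origin.
pose J : finType := {i : 'I_s & 'I_(r i)}.
have /choice[D DP] : forall i, exists D : nat -> P * nat,
    (forall j : 'I_(r i), [/\ (0 < (D j).2)%N, (D j).1 \is (D j).2.-homog for mf & SI (restrict (D j).1)]) /\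
    restrict (t i) = \sum_(j < r i) restrict (D j).1.
  move=> i; have [F [e [FP FE]]] := rP i.
  exists (fun n => if insub n is Some j then (F j, e j) else (0, 0%N)).
  by split=> [j|]; [rewrite valK; apply: FP | rewrite FE; apply: eq_bigr => j _; rewrite valK].
pose F (x : J) : P := (D (tag x) (tagged x)).1.
have homF x : homog_pos mf (F x).
  have [/(_ (tagged x))[e0 hom_e _] _] := DP (tag x).
  by exists (D (tag x) (tagged x)).2; [exact: e0 | exact: hom_e].
have /choice[Phi PhiE] : forall x, exists G, restrict (F x) = restrict (subst t G).
  by move=> x; apply/t_SI; have [/(_ (tagged x))[]] := DP (tag x).
(* The identity 'X_i = sum of the Phi makes their linear parts span k^s. *)
have XE i : 'X_i = \sum_(j < r i) Phi (Tagged (fun i => 'I_(r i)) j).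
  apply/eqP; rewrite -subr_eq0; apply/eqP/t_inj.
  rewrite (rmorphB (subst t)) substXU (rmorph_sum (subst t)).
  have [_ tE] := DP i; rewrite rmorphB /= tE rmorph_sum; apply/eqP; rewrite subr_eq0; apply/eqP.
  by apply: eq_bigr => j _; exact: (PhiE (Tagged (fun i => 'I_(r i)) j)).
pose A : 'M[k]_(#|J|, s) := \matrix_(x, l) (Phi (enum_val x))@_U_(l)%MM.
have full_A : row_full A.
  apply/row_fullP; exists (\matrix_(i, x) (tag (enum_val x) == i)%:R).
  apply/matrixP => i l; rewrite mxE.
  under eq_bigr do rewrite !mxE.
  pose f (x : J) := (tag x == i)%:R * (Phi x)@_U_(l)%MM.
  transitivity (\sum_(x : J) f x).
    by rewrite [RHS](reindex _ (onW_bij _ (@enum_val_bij J))).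
  pose f2 i' (j : 'I_(r i')) := f (Tagged (fun i => 'I_(r i)) j).
  transitivity (\sum_i' \sum_j f2 i' j).
    by rewrite (sig_big_dep xpredT (fun _ => xpredT) f2) /=; apply: eq_bigr => -[].
  rewrite (bigD1 i) //= [X in _ + X]big1 ?addr0 => [|i' /negPf i'i]; last first.
    by rewrite big1 // => j _; rewrite /f2 /f /= i'i mul0r.
  rewrite mxE -(mcoeffXU k i l) XE raddf_sum; apply: eq_bigr => j _.
  by rewrite /f2 /f /= eqxx mul1r.
pose sel := fullrankfun full_A.
exists (fun l => F (enum_val (sel l))), (fun l => Phi (enum_val (sel l))); split=> //.
have -> : \matrix_(l < s, j < s) (Phi (enum_val (sel l)))@_U_(j)%MM = rowsub sel A.
  by apply/matrixP => l j; rewrite !mxE.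
exact: fullrowsub_unit.
Qed.

Section Generation.
Variables (y : 'I_s -> P) (Y : 'I_s -> {mpoly k[s]}).
Hypothesis hom_y : forall l, homog_pos mf (y l).
Hypothesis yE : forall l, restrict (y l) = restrict (subst t (Y l)).
Hypothesis unitY : (\matrix_(l < s, j < s) (Y l)@_U_(j)%MM) \in unitmx.

Let inY f : Prop := exists F, f = restrict (subst y F).

Let inYC c : inY (restrict c%:MP).
Proof. by exists c%:MP; rewrite substC. Qed.

Let inYD f f' : inY f -> inY f' -> inY (f + f').
Proof. by move=> [F ->] [F' ->]; exists (F + F'); rewrite !rmorphD. Qed.

Let inYM f f' : inY f -> inY f' -> inY (f * f').
Proof. by move=> [F ->] [F' ->]; exists (F * F'); rewrite !rmorphM. Qed.

Let inY_sum (T : finType) (f : T -> coordinate_ring d) : (forall x, inY (f x)) -> inY (\sum_x f x).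
Proof.
move=> Yf; apply: big_ind => [|f1 f2|x _]; [|exact: inYD|exact: Yf].
by have := inYC 0; rewrite mpolyC0 rmorph0.
Qed.

(** As the linear parts of the Y_l are a basis, a combination of them removes the linear part of
    G. *)
Let linear_part G : G@_0%MM = 0 -> exists (c : 'I_s -> k) (h : 'I_s -> {mpoly k[s]}),
  G = \sum_l c l *: Y l + \sum_i h i * 'X_i /\ forall i, (h i)@_0%MM = 0.
Proof.
move=> G0; pose U : 'M[k]_s := \matrix_(l < s, j < s) (Y l)@_U_(j)%MM.
have unitU : U \in unitmx by [].
pose c := (\row_j G@_U_(j)%MM) *m invmx U.
have Y0 l : (Y l)@_0%MM = 0.
  by rewrite -t_SI_origin -yE restrict_origin; apply: homog_pos_coef0.
have [||h [hE h0]] := @order2_decomposition s (G - \sum_l c 0 l *: Y l).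
- rewrite mcoeffB G0 sub0r (raddf_sum (mcoeff _)) big1 ?oppr0 // => l _.
  by rewrite /= mcoeffZ Y0 mulr0.
- move=> j; rewrite mcoeffB (raddf_sum (mcoeff _)); apply/eqP; rewrite subr_eq0; apply/eqP.
  have := mulmxKV unitU (\row_j G@_U_(j)%MM); rewrite -/c => /matrixP/(_ 0 j).
  by rewrite [LHS]mxE [RHS]mxE => <-; apply: eq_bigr => l _; rewrite /= mcoeffZ [U l j]mxE.
by exists (fun l => c 0 l), h; split=> //; rewrite -hE addrC subrK.
Qed.

(** Graded Nakayama inside the semi-invariants. Up to a linear combination of the y_l, p is a sum of
    products h_i(t) t_i. Both factors vanish at the origin and split into homogeneous
    semi-invariants of positive degree, so the factors of the products of degree e have degree below
    e and are covered by induction. *)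
Let generation e (p : P) : p \is e.-homog for mf -> SI (restrict p) -> inY (restrict p).
Proof.
have [n] := ubnP e; elim: n e p => // n IHn e p en hom_p SIp.
have [e0|e_gt0] := posnP e.
  by move: hom_p; rewrite e0 => /homog0_const ->; apply: inYC.
have [G GE] := (t_SI _).1 SIp.
have G0 : G@_0%MM = 0 by rewrite -t_SI_origin -GE restrict_origin (homog_coef0 e_gt0).
have [c [h [GE' h0]]] := linear_part G0.
have SIt i : SI (restrict (t i)) by apply/t_SI; exists 'X_i; rewrite substXU.
have SIh i : SI (restrict (subst t (h i))) by apply/t_SI; exists (h i).
have decomp f : SI f -> f (origin d) = 0 -> exists (r : nat) (D : 'I_r -> P * nat),
    (forall j, [/\ (0 < (D j).2)%N, (D j).1 \is (D j).2.-homog for mf & SI (restrict (D j).1)]) /\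
    f = \sum_j restrict (D j).1.
  move=> SIf f0; have [r [F [e' [FP FE]]]] := SI_decomposition SIf f0.
  by exists r, (fun j => (F j, e' j)).
have /choice[W WP] : forall i, exists W : P,
    restrict W = restrict (subst t (h i * 'X_i)) /\ inY (restrict (pihomog mf e W)).
  move=> i; have [r [D [DP DE]]] := decomp _ (SIt i) (etrans (restrict_origin _) (t0 i)).
  have [r' [D' [DP' DE']]] := decomp _ (SIh i) (etrans (t_SI_origin _) (h0 i)).
  exists (\sum_j' \sum_j (D' j').1 * (D j).1); split.
    rewrite rmorphM substXU rmorphM /= DE DE' rmorph_sum mulr_suml; apply: eq_bigr => j' _.
    by rewrite rmorph_sum mulr_sumr; apply: eq_bigr => j _; rewrite rmorphM.
  rewrite (raddf_sum (pihomog mf e)) rmorph_sum; apply: inY_sum => j' /=.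
  rewrite (raddf_sum (pihomog mf e)) rmorph_sum; apply: inY_sum => j /=.
  have [e1 hom1 SI1] := DP' j'; have [e2 hom2 SI2] := DP j.
  have hom12 := dhomogM hom1 hom2; have [ee|ne] := eqVneq ((D' j').2 + (D j).2)%N e; last first.
    by rewrite (pihomog_ne0 ne hom12) -mpolyC0; apply: inYC.
  rewrite -ee pihomog_dE // rmorphM; apply: inYM.
    by apply: (IHn (D' j').2) => //; move: ee en e2; lia.
  by apply: (IHn (D j).2) => //; move: ee en e1; lia.
(* The component of degree e of this identity expresses p through known elements. *)
have : restrict (p - (\sum_l c l *: y l + \sum_i W i)) = 0.
  have cY l : restrict (subst t (c l *: Y l)) = restrict (c l *: y l).
    by rewrite substZ -!mul_mpolyC !(rmorphM restrict) /= yE.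
  have hX i : restrict (subst t (h i * 'X_i)) = restrict (W i) by have [-> _] := WP i.
  rewrite rmorphB /= GE GE' (rmorphD (subst t)) !(rmorph_sum (subst t)) !rmorphD !rmorph_sum.
  by rewrite (eq_bigr _ (fun l _ => cY l)) (eq_bigr _ (fun i _ => hX i)) subrr.
move=> /(hom_ker e); rewrite (raddfB (pihomog mf e)) /= (pihomog_dE hom_p) rmorphB.
move=> /eqP; rewrite subr_eq0 => /eqP ->; rewrite (raddfD (pihomog mf e)) rmorphD; apply: inYD.
  rewrite (raddf_sum (pihomog mf e)) rmorph_sum; apply: inY_sum => l.
  rewrite /= linearZ /= -mul_mpolyC rmorphM; apply: inYM; first exact: inYC.
  have [e' _ hom_e'] := hom_y l; have [<-|ne] := eqVneq e' e.
    by rewrite pihomog_dE //; exists 'X_l; rewrite substXU.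
  by rewrite (pihomog_ne0 ne) // -mpolyC0; apply: inYC.
rewrite (raddf_sum (pihomog mf e)) rmorph_sum; apply: inY_sum => i.
by have [] := WP i.
Qed.

Lemma SI_generated : SI = (fun f => exists F, f = restrict (subst y F)).
Proof.
apply/funext => f; apply/propext; split=> [SIf|[F ->]].
  have [r [sigma [f_ [semi ->]]]] := SIf; apply: inY_sum => j.
  have [adm semij] := semi j; have [e [p [hom_p fjE]]] := semi_invariant_homog semij.
  rewrite fjE; apply: generation hom_p _; rewrite -fjE; exact: semi_invariant_SI semij.
apply/t_SI; exists (subst Y F); rewrite subst_comp.
apply: (mpoly_rmorph_eq (F := restrict \o subst y) (G := restrict \o subst (fun i => subst t (Y i)))) => [c|i] /=.
  by rewrite !mmapC.
by rewrite !mmapX !mmap1U yE.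
Qed.

End Generation.

Lemma homogeneous_generators : exists y : 'I_s -> P, (forall l, homog_pos mf (y l)) /\
  SI = (fun f => exists F, f = restrict (subst y F)).
Proof.
have [y [Y [hom_y yE unitY]]] := generators.
by exists y; split=> //; apply: SI_generated yE unitY.
Qed.

End HomogeneousGenerators.

End Generators.

(** A semi-invariant of non-zero weight vanishes at the origin, so it is a polynomial in the y_l
    without constant term. *)
Lemma nullcone_mem (k : closedFieldType) (L : canonicalData k) (d : dimvec L) s
    (y : 'I_s -> {mpoly k[#|Defs.coord d|]}) (M : rep d) :
  (forall l, homog_pos (grading d) (y l)) ->
  @SI k L d = (fun f => exists F, f = restrict (subst y F)) ->
  module_variety M -> (forall l, (y l).@[coords M] = 0) -> nullcone M.
Proof.
move=> hom_y SIE XM yM; exists (SigSub (mem_set XM)) => // sigma f adm sigma0 semi.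
have [F fE] : exists F, f = restrict (subst y F).
  by have := semi_invariant_SI adm semi; rewrite SIE.
have F0 : F@_0%MM = 0.
  rewrite -(@subst_coef0 k _ _ y F) => [|l]; last exact: homog_pos_coef0 (hom_y l).
  by rewrite -restrict_origin -fE; apply: semi_invariant_origin semi.
rewrite fE -[LHS]/((subst y F).@[coords M]) meval_subst -F0 -meval0_coef.
exact: meval_eq.
Qed.

Theorem mainTheorem2 (k : closedFieldType) (char0 : [pchar k]%R =i pred0)
    (L : canonicalData k) (d : dimvec L)
    (d_regular : exists M : rep d, module_variety M /\ regular M)
    (p : nat) (q : forall i : 'I_(arms L), 'I_(len i) -> nat)
    (pq_decomposition : canonical_decomposition d p q)
    (p_gt0 : (0 < p)%N)
    (s : nat)
    (mod_irreducible : irreducible (@module_variety k L d))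
    (SI_polynomial : polynomial_ring_in (@SI k L d) s)
    (codim_nullcone :
       codim_eq (@module_variety k L d) (@nullcone k L d) s) :
  free_over (@SI k L d).
Proof.
have d0_gt0 : (0 < d (vertex0 L))%N.
  by rewrite (decomposition_vertex0 pq_decomposition) addn_gt0 p_gt0.
have [kap [kap_inj pivot0]] := decomposition_pivot pq_decomposition.
have hom_ker := homogeneous_restrict mod_irreducible d0_gt0 kap_inj pivot0.
have [t [t_inj t_SI t0]] := normalized_generators SI_polynomial.
have [y [hom_y SIE]] := homogeneous_generators t_inj t_SI t0 hom_ker.
rewrite SIE; apply: (free_over_regular (@restrict_surj _ _ d) hom_ker hom_y).
have [codim_ge_s _] := codim_nullcone.
apply: (restrict_regular mod_irreducible d0_gt0 kap_inj pivot0 codim_ge_s hom_y).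
by move=> M XM yM; apply: nullcone_mem hom_y SIE XM yM.
Qed.
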